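(* Let $R=\mathbb{k}[x_1,\dots,x_d]$ be a polynomial ring over a field $\mathbb{k}$, $\mathfrak m=(x_1,\dots,x_d)$ the maximal homogeneous ideal of $R$, and $L$ a lex-segment ideal. Then $L^{\rm sat}=L:\mathfrak m^\infty$ satisfies $G_\infty$, sliding depth, and $AN_{d-1}^-$. Moreover, $L$ satisfies $G_d$ and $AN_{d-1}^-$.
   Context: Lex-segment ideal: a monomial ideal $L=\bigoplus_{i\geqslant 0}L_i$ of $R$ such that, for every $i$, $L_i$ is spanned by the $\dim_{\mathbb{k}}L_i$ largest monomials of degree $i$ in the lexicographic order with $x_1>x_2>\cdots>x_d$. $G_s$: an ideal $I$ satisfies $G_s$ if $\mu(I_{\mathfrak p})\leqslant\operatorname{ht}(\mathfrak p)$ for every $\mathfrak p\in V(I)$ with $\operatorname{ht}(\mathfrak p)\leqslant s-1$ ($\mu$ = minimal number of generators); $G_\infty$ means $G_s$ for all $s$. Sliding depth: for a homogeneous ideal $I$ generated by homogeneous elements $a_1,\dots,a_n$ with Koszul homology modules $H_i=H_i(a_1,\dots,a_n;R)$, $I$ satisfies sliding depth if $\operatorname{depth}(H_i)\geqslant d-n+i$ for every $i$, with $\operatorname{depth}(0)=\infty$. Residual intersections: $K$ is an $s$-residual intersection of $I$ if $K=\mathfrak a:I$ for some ideal $\mathfrak a\subsetneq I$ generated by $s$ elements with $\operatorname{ht}(K)\geqslant s$; it is geometric if in addition $\operatorname{ht}(I+K)>s$ (the unit ideal has infinite height). An ideal $I$ of height $g$ satisfies $AN_s^-$ if for every $g\leqslant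 i\leqslant s$ and every geometric $i$-residual intersection $K$ of $I$ the ring $R/K$ is Cohen-Macaulay. *)

(* Defs.v *)
From HB Require Import structures.
From mathcomp Require Export all_boot all_order all_algebra.
From mathcomp Require Export boolp classical_sets.
From mathcomp Require Export mpoly.

Set Implicit Arguments.
Unset Strict Implicit.
Unset Printing Implicit Defensive.

Import Order.TTheory GRing.Theory Num.Theory.
Local Open Scope classical_set_scope.
Local Open Scope ring_scope.

(* Ideals of a ring [A] are sets [I : set A]. Heights, dimensions and depths  *)
(* may be infinite, so they enter only through predicates [*_ge _ n] meaning  *)
(* "the invariant is at least [n]"; "at most [n]" is [~ *_ge _ n.+1].         *)

Section Ideals.
Variable A : comNzRingType.
Implicit Types I J K : set A.

Definition is_ideal I : Prop :=
  [/\ I 0, forall x y, I x -> I y -> I (x + y) & forall a x, I x -> I (a * x)].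

Definition ideal_gen (S : set A) : set A :=
  [set x | exists n (c s : 'I_n -> A),
             (forall i, S (s i)) /\ x = \sum_(i < n) c i * s i].

Definition ideal_add I J : set A :=
  [set x | exists y z, [/\ I y, J z & x = y + z]].

Definition ideal_mul I J : set A :=
  ideal_gen [set x | exists y z, [/\ I y, J z & x = y * z]].

Fixpoint ideal_pow I (n : nat) : set A :=
  if n is n'.+1 then ideal_mul I (ideal_pow I n') else setT.

Definition colon I J : set A := [set x | forall y, J y -> I (x * y)].

Definition saturation I J : set A :=
  [set x | exists n, colon I (ideal_pow J n) x].

Definition is_prime I : Prop :=
  [/\ is_ideal I, ~ I 1 & forall x y, I (x * y) -> I x \/ I y].

Record spec := Spec { spec_ideal :> set A; specP : is_prime spec_ideal }.

Definition is_maximal (p : spec) : Prop :=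
  forall J, is_ideal J -> (p : set A) `<=` J -> ~ J 1 -> J = p.

Definition prime_chain (n : nat) (c : nat -> spec) : Prop :=
  forall i, (i < n)%N -> (c i : set A) `<` c i.+1.

Definition prime_height_ge (p : spec) (n : nat) : Prop :=
  exists c, prime_chain n c /\ (c n : set A) = p.

(* The unit ideal has infinite height: it satisfies this for every [n]. *)
Definition height_ge I (n : nat) : Prop :=
  forall p : spec, I `<=` p -> prime_height_ge p n.

(* Krull dimension of A / K, through the primes of [A] containing [K]. *)
Definition quo_dim_ge K (n : nat) : Prop :=
  exists c, prime_chain n c /\ K `<=` c 0%N.

Definition residual_intersection (s : nat) I K : Prop :=
  exists a : s.-tuple A,
    [/\ ideal_gen [set` a] `<` I, K = colon (ideal_gen [set` a]) I
      & height_ge K s].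

Definition geometric_residual_intersection (s : nat) I K : Prop :=
  residual_intersection s I K /\ height_ge (ideal_add I K) s.+1.

End Ideals.

(* A subquotient M = Z / B of an [A]-module V is given by two submodules      *)
(* B `<=` Z of V; its quotient M / (xs) M is then Z / (B + (xs) Z).           *)
Section Depth.
Variables (A : comNzRingType) (V : lmodType A).
Implicit Types (Z B : set V) (xs : seq A).

Definition add_scaled Z B xs : set V :=
  [set v | exists b (w : 'I_(size xs) -> V),
             [/\ B b, forall j, Z (w j) & v = b + \sum_(j < size xs) xs`_j *: w j]].

Definition regular_seq Z B xs : Prop :=
  (forall j, (j < size xs)%N -> forall z, Z z ->
     add_scaled Z B (take j xs) (xs`_j *: z) -> add_scaled Z B (take j xs) z)
  /\ ~ (Z `<=` add_scaled Z B xs).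

(* depth of Z / B with respect to the ideal [J], the zero module having       *)
(* infinite depth.                                                            *)
Definition depth_ge (J : set A) Z B (t : nat) : Prop :=
  Z `<=` B \/
  exists xs : t.-tuple A, (forall x, x \in xs -> J x) /\ regular_seq Z B xs.

End Depth.

(* The Koszul complex of a_1, ..., a_n: an element of the exterior algebra of *)
(* A^n is the function giving its coordinates on the e_S = e_{s_1} /\ ... /\  *)
(* e_{s_i}, S = {s_1 < ... < s_i}; the differential sends e_S to the sum over *)
(* j in S of (-1)^#{l in S | l < j} a_j e_{S \ j}.                            *)
Section Koszul.
Variables (A : comNzRingType) (n : nat) (a : n.-tuple A).

Definition exterior : lmodType A := {ffun {set 'I_n} -> A^o}.

Definition exterior_deg (i : nat) : set exterior :=
  [set f | forall S : {set 'I_n}, #|S| != i -> f S = 0].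

Definition koszul_diff (f : exterior) : exterior :=
  [ffun T : {set 'I_n} =>
     \sum_(j | j \notin T)
        (-1) ^+ #|[set l in T | (l < j)%N]%SET| * tnth a j * f (j |: T)%SET].

Definition koszul_cycles (i : nat) : set exterior :=
  [set f | exterior_deg i f /\ koszul_diff f = 0].

Definition koszul_boundaries (i : nat) : set exterior :=
  [set koszul_diff g | g in exterior_deg i.+1].

End Koszul.

(* For a domain [A], the localization A_p is the subring of the fractions     *)
(* a / s with [s] outside [p] in the fraction field.                          *)
Section Localization.
Variables (A : idomainType) (p : spec A).

Definition fractions_of (I : set A) : set {fraction A} :=
  [set z | exists a s, [/\ I a, ~ spec_ideal p s & z = tofrac a / tofrac s]].

Definition loc_pred : {pred {fraction A}} :=
  fun z => `[< fractions_of setT z >].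

Lemma spec_unit_closed (s t : A) : ~ spec_ideal p s -> ~ spec_ideal p t -> ~ spec_ideal p (s * t).
Proof. by case: (specP p) => _ _ pr ps pt /pr []. Qed.

Lemma spec_out_neq0 (s : A) : ~ spec_ideal p s -> tofrac s != 0.
Proof.
move=> ps; rewrite tofrac_eq0; apply/eqP => s0; apply: ps; rewrite s0.
by case: (specP p) => -[].
Qed.

Lemma loc_subring_closed : subring_closed loc_pred.
Proof.
split.
- apply/asboolP; exists 1, 1; split=> //; first by case: (specP p).
  by rewrite rmorph1 divr1.
- move=> _ _ /asboolP [a [s [_ ps ->]]] /asboolP [b [t [_ pt ->]]].
  apply/asboolP; exists (a * t - b * s), (s * t); split=> //.
    exact: spec_unit_closed.
  rewrite -[X in _ + X]mulNr addf_div ?spec_out_neq0 //.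
  by rewrite mulNr rmorphB !rmorphM.
- move=> _ _ /asboolP [a [s [_ ps ->]]] /asboolP [b [t [_ pt ->]]].
  apply/asboolP; exists (a * b), (s * t); split=> //.
    exact: spec_unit_closed.
  by rewrite !rmorphM /= mulf_div.
Qed.

HB.instance Definition _ :=
  GRing.isSubringClosed.Build _ loc_pred loc_subring_closed.

Record localization :=
  Localization { loc_val : {fraction A}; _ : loc_val \in loc_pred }.

HB.instance Definition _ := [isSub for loc_val].
HB.instance Definition _ := [Choice of localization by <:].
HB.instance Definition _ := [SubChoice_isSubComNzRing of localization by <:].

Definition loc_ideal (I : set A) : set localization :=
  [set z | fractions_of I (loc_val z)].

End Localization.

Arguments loc_ideal {A} p I.

Section Conditions.
Variable A : idomainType.
Implicit Types I K : set A.

(* mu(I_p) <= n *)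
Definition loc_mu_le (p : spec A) I (n : nat) : Prop :=
  exists2 m, (m <= n)%N &
    exists t : m.-tuple (localization p), ideal_gen [set` t] = loc_ideal p I.

(* As a prime of finite height, [p] satisfies mu(I_p) <= ht(p) if and only if *)
(* mu(I_p) <= n for some n <= ht(p).                                          *)
Definition G (s : nat) I : Prop :=
  forall p : spec A, I `<=` p -> ~ prime_height_ge p s ->
    exists n, prime_height_ge p n /\ loc_mu_le p I n.

Definition G_infty I : Prop := forall s, G s I.

(* (A / K)_p, written as A_p / K_p. *)
Definition quo_cohen_macaulay_at (p : spec A) K : Prop :=
  forall t,
    depth_ge (V := (localization p)^o) (loc_ideal p p) setT (loc_ideal p K) t
    <-> quo_dim_ge (loc_ideal p K) t.

Definition quo_cohen_macaulay K : Prop :=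
  forall p : spec A, is_maximal p -> K `<=` p -> quo_cohen_macaulay_at p K.

Definition AN_minus (s : int) I : Prop :=
  forall i : nat, ~ height_ge I i.+1 -> (i%:Z <= s)%R ->
  forall K, geometric_residual_intersection i I K -> quo_cohen_macaulay K.

End Conditions.

Section Polynomial.
Variables (k : fieldType) (d : nat).
Implicit Types I L : set {mpoly k[d]}.

Definition irrelevant_ideal : set {mpoly k[d]} :=
  ideal_gen (range (fun i : 'I_d => 'X_i)).

Definition monomial_ideal L : Prop :=
  exists S : set 'X_{1..d}, L = ideal_gen [set 'X_[m] | m in S].

(* The monomials of degree [i], in decreasing order. The library order        *)
(* compares degrees first; in a fixed degree it is the lexicographic order    *)
(* with X_0 > X_1 > ... (see [ltmcP]).                                        *)
Definition lex_monomials (i : nat) : seq 'X_{1..d} :=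
  sort (fun m1 m2 => (m2 <= m1)%O)
    [seq m <- [seq bmnm b | b <- enum {: 'X_{1..d < i.+1}}] | mdeg m == i].

(* L_i is the span of the first [r] monomials of degree [i]; these are        *)
(* linearly independent, so [r] is the dimension of L_i.                      *)
Definition lex_segment_ideal L : Prop :=
  monomial_ideal L /\
  forall i : nat, exists2 r, (r <= size (lex_monomials i))%N &
    forall f : {mpoly k[d]},
      (L f /\ f \is i.-homog) <->
      exists c : 'X_{1..d} -> k,
        f = \sum_(m <- take r (lex_monomials i)) c m *: 'X_[m].

(* The condition does not depend on the choice of homogeneous generators; it  *)
(* is required of all of them. The difference may be truncated since every    *)
(* depth is at least 0.                                                       *)
Definition sliding_depth I : Prop :=
  forall (n : nat) (a : n.-tuple {mpoly k[d]}),
    (forall x, x \in a -> exists e : nat, x \is e.-homog) ->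
    I = ideal_gen [set` a] ->
    forall i : nat,
      depth_ge irrelevant_ideal (koszul_cycles a i) (koszul_boundaries a i)
        (d + i - n)%N.

End Polynomial.

Arguments irrelevant_ideal : clear implicits.

(* Main.v *)
(* The saturation of a lex-segment ideal is 0 or, for the lexicographically   *)
(* least exponent c of x_1, ..., x_{d-1} occurring in it, the ideal           *)
(*   x_1^c_1 (x_1, x_2^c_2 (x_2, ... x_{d-1}^c_{d-1} (x_{d-1}, 1) ... )).     *)
(* Sliding depth passes to the multiples of the generators by a nonzero       *)
(* element, and from m to (x, m) when the variable x does not occur in m. At  *)
(* a prime containing exactly the first r variables, r <= ht p generators     *)
(* suffice, which is G_infty.                                                 *)
(*   Let K = a : I be an i-residual intersection of such a saturation I.      *)
(* Prime avoidance yields generators a_1, ..., a_i of a such that, for        *)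
(* K_j = (a_1, ..., a_j) : I, the element a_{j+1} is regular on R / K_j, the  *)
(* ideal I + K_j has height > j and K_j meets I in (a_1, ..., a_j). Then      *)
(* sliding depth modulo K_j descends to K_{j+1}, so that R / K has depth at   *)
(* least d - i at each maximal ideal, while its dimension is at most d - i.   *)
(* Finally a lex-segment ideal L agrees with its saturation at the primes     *)
(* other than the maximal homogeneous ideal, and a : L = a : L^sat for i < d  *)
(* because R / (a : L^sat) has positive depth.                                *)
From HB Require Import structures.
Require Import Defs.
From mathcomp Require Import generic_quotient ring_quotient ring zify.

Set Implicit Arguments.
Unset Strict Implicit.
Unset Printing Implicit Defensive.

Import Order.TTheory GRing.Theory Num.Theory.
Local Open Scope classical_set_scope.
Local Open Scope ring_scope.

(** * Depth through cochains on lists *)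

(** The monomials of the saturation I of L form an upward closed set for the lexicographic order
    that ignores the last variable. Hence I is 0 or arises from the unit ideal by repeating J -> x^c
    (x, J) with a new variable x each time ([saturation_lex], [lex_gens]). Near a prime P over I, as
    many generators suffice as there are certain distinct variables lying in P, and P has at least
    that height ([lex_gens_local], [variables_height]); this is the condition G_infinity.

    Depth is treated cohomologically. [cdepth J Z B t] says that a cohomology of Z / B with respect
    to J vanishes below degree t; it obeys the long exact sequences, drops by one modulo a regular
    element, and over a noetherian ring produces regular sequences ([cdepth_regular]). Let F be the
    Koszul complex of n generators m, and Z_i(K) the chains of degree i that are cycles modulo K.
    Sliding depth is used in the form [slides m K e]: F_i / Z_i(K) has depth at least e + i - n. For
    K = 0 and e = d this bounds the depth of Koszul homology ([cdepth_homology]). It depends only on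
    the ideal generated ([slides_change]), and the recursion for I preserves it ([cycle_iso_scale],
    [slides_cons], [slides_lex_gens]).

    For a residual intersection K = a : I of I with i generators, put K_j = (a_1, ..., a_j) : I.
    Passing from K_j to K' = K_j + (a_{j+1}) and on to K_{j+1} = K' : I lowers e by one in both
    [slides] and the depth of the quotient ([slides_step], [cdepth_residual], [slides_residual]);
    the depth of R / (K' : I) is the top degree of [slides], because F_n / Z_n(K') = R / (K' : I).
    That a_{j+1} is regular modulo K_j, and that K_{j+1} meets I inside K', come from comparing
    depth with height: if R / J has depth t at all maximal ideals, then an ideal of height at least
    h killing a nonzero element of R / J satisfies h + t <= d ([gdepth_height]). Suitable a_{j+1}
    are found by prime avoidance ([select_generator]). At the end the depth of R / K is at least d -
    i while ht K >= i, so depth and dimension agree ([quo_cohen_macaulay_of_depth]).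

    What this requires of R is proved on the way: it is noetherian ([noetherian_mpoly]), its primes
    have height at most d ([dim_mpoly]), and its depth at every maximal ideal is at least d
    ([cdepth_maximal], through Zariski's lemma).

    For L itself, a power of a variable outside P identifies L with I near P
    ([few_local_generators_saturation]), and a : L = a : I for fewer than d generators, since R / (a
    : I) then has positive depth at the irrelevant ideal ([colon_saturation]). *)

Section Cochains.
Variable A : comNzRingType.

Definition is_submod (V : lmodType A) (Z : set V) : Prop :=
  [/\ Z 0, forall x y, Z x -> Z y -> Z (x + y) & forall a x, Z x -> Z (a *: x)].

Section Submod.
Variables (V : lmodType A) (Z : set V).
Hypothesis sZ : is_submod Z.

Lemma submod0 : Z 0. Proof. by case: sZ. Qed.
Lemma submodD x y : Z x -> Z y -> Z (x + y). Proof. by case: sZ => _ + _; apply. Qed.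
Lemma submodZ a x : Z x -> Z (a *: x). Proof. by case: sZ => _ _; apply. Qed.
Lemma submodN x : Z x -> Z (- x).
Proof. by move=> /(submodZ (-1)); rewrite scaleN1r. Qed.
Lemma submodB x y : Z x -> Z y -> Z (x - y).
Proof. by move=> Zx Zy; apply: submodD => //; apply: submodN. Qed.
Lemma submod_subl x y : Z (x - y) -> Z y -> Z x.
Proof. by move=> Zxy Zy; rewrite -(subrK y x); apply: submodD. Qed.
Lemma submod_subr x y : Z (x - y) -> Z x -> Z y.
Proof. by move=> Zxy Zx; rewrite -(subKr x y); apply: submodB. Qed.
Lemma submod_sum (I : Type) (r : seq I) (P : pred I) (F : I -> V) :
  (forall i, P i -> Z (F i)) -> Z (\sum_(i <- r | P i) F i).
Proof. by move=> ZF; elim/big_ind: _ => //; [exact: submod0|exact: submodD]. Qed.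
End Submod.

Lemma submodT (V : lmodType A) : is_submod (setT : set V).
Proof. by split. Qed.

Lemma submod_zero (V : lmodType A) : is_submod ([set 0] : set V).
Proof.
by split=> [//|x y -> ->|a x ->]; rewrite /= ?addr0 ?scaler0.
Qed.

Lemma submod_add (V : lmodType A) (Z1 Z2 : set V) : is_submod Z1 -> is_submod Z2 ->
  is_submod [set v | exists z1 z2, [/\ Z1 z1, Z2 z2 & v = z1 + z2]].
Proof.
move=> s1 s2; split.
- by exists 0, 0; split; rewrite ?addr0 //; exact: submod0.
- move=> _ _ [x [y [Zx Zy ->]]] [x' [y' [Zx' Zy' ->]]]; exists (x + x'), (y + y').
  by split; [exact: submodD|exact: submodD|rewrite addrACA].
- move=> a _ [x [y [Zx Zy ->]]]; exists (a *: x), (a *: y).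
  by split; [exact: submodZ|exact: submodZ|rewrite scalerDr].
Qed.

Lemma submod_scale (V : lmodType A) (Z : set V) (x : A) : is_submod Z ->
  is_submod [set x *: z | z in Z].
Proof.
move=> sZ; split.
- by exists 0; [exact: submod0|rewrite scaler0].
- by move=> _ _ [u Zu <-] [v Zv <-]; exists (u + v); [exact: submodD|rewrite scalerDr].
- move=> a _ [u Zu <-]; exists (a *: u); first exact: submodZ.
  by rewrite !scalerA mulrC.
Qed.

Definition scaled_add (V : lmodType A) (B : set V) (x : A) (Z : set V) : set V :=
  [set v | exists b z, [/\ B b, [set x *: z | z in Z] z & v = b + z]].

Lemma submod_scaled_add (V : lmodType A) (Z B : set V) (x : A) :
  is_submod Z -> is_submod B -> is_submod (scaled_add B x Z).
Proof. by move=> sZ sB; apply: submod_add => //; apply: submod_scale. Qed.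

Variable J : set A.

Fixpoint list_in (j : nat) (s : seq A) : Prop :=
  match j, s with
  | 0%N, [::] => True
  | j'.+1, x :: s' => J x /\ list_in j' s'
  | _, _ => False
  end.

(* The Hom-dual of the differential of the tensor algebra on the elements of  *)
(* [J].  The evaluation at [x] in the first slot is a homotopy for the        *)
(* multiplication by [x], so [J] annihilates the cohomology: this is all one  *)
(* needs for the cohomology to measure depth.                                 *)
Fixpoint cobord (V : lmodType A) (f : seq A -> V) (s : seq A) : V :=
  match s with
  | [::] => 0
  | x :: s' => x *: f s' - cobord (fun u => f (x :: u)) s'
  end.

(** Cochains are arbitrary functions on lists from [J], with no linearity, and all identities hold
    modulo [B]. In degree 0 nothing is asked of [g]: its coboundary on the empty list is 0, so that
    the value of [f] itself must lie in [B]. *)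
Definition vanishes (V : lmodType A) (Z B : set V) (j : nat) : Prop :=
  forall f : seq A -> V,
    (forall s, list_in j s -> Z (f s)) ->
    (forall s, list_in j.+1 s -> B (cobord f s)) ->
    exists g : seq A -> V,
      (forall i s, j = i.+1 -> list_in i s -> Z (g s)) /\
      (forall s, list_in j s -> B (f s - cobord g s)).

Definition cdepth (V : lmodType A) (Z B : set V) (t : nat) : Prop :=
  forall j, (j < t)%N -> vanishes Z B j.

Lemma list_inS j s : list_in j.+1 s -> exists x s', [/\ s = x :: s', J x & list_in j s'].
Proof. by case: s => //= x s [Jx js]; exists x, s. Qed.

Section CobordTheory.
Variable V : lmodType A.
Implicit Types (f g : seq A -> V) (Z B : set V).

Lemma cobordD f g s : cobord (fun u => f u + g u) s = cobord f s + cobord g s.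
Proof.
elim: s f g => [|x s IH] f g /=; first by rewrite addr0.
by rewrite IH scalerDr opprD addrACA.
Qed.

Lemma cobordZ a f s : cobord (fun u => a *: f u) s = a *: cobord f s.
Proof.
elim: s f => [|x s IH] f /=; first by rewrite scaler0.
by rewrite IH scalerBr !scalerA mulrC.
Qed.

Lemma cobordN f s : cobord (fun u => - f u) s = - cobord f s.
Proof.
elim: s f => [|x s IH] f /=; first by rewrite oppr0.
by rewrite IH scalerN opprB addrC opprK.
Qed.

Lemma cobordB f g s : cobord (fun u => f u - g u) s = cobord f s - cobord g s.
Proof. by rewrite -cobordN -cobordD. Qed.

Lemma cobord_cobord f s : cobord (cobord f) s = 0.
Proof.
elim: s f => [|x s IH] f //=.
rewrite (cobordB (fun u => x *: f u) (fun u => cobord (fun u0 => f (x :: u0)) u)).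
by rewrite IH cobordZ subr0 subrr.
Qed.

Lemma cobord_mem Z j f : is_submod Z ->
  (forall i s, j = i.+1 -> list_in i s -> Z (f s)) ->
  forall s, list_in j s -> Z (cobord f s).
Proof.
move=> sZ; elim: j f => [|j IH] f Zf s.
  by case: s => // _; apply: submod0.
move=> /list_inS [x [s' [-> Jx js]]] /=; apply: submodB => //.
  by apply: submodZ => //; apply: (Zf j).
apply: IH => // i u ji iu; apply: (Zf i.+1) => //; by rewrite ji.
Qed.

Lemma eq_cobord_mem B j f g : is_submod B ->
  (forall i s, j = i.+1 -> list_in i s -> B (f s - g s)) ->
  forall s, list_in j s -> B (cobord f s - cobord g s).
Proof.
move=> sB Bfg s js; rewrite -cobordB.
exact: (cobord_mem sB Bfg).
Qed.

End CobordTheory.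

Section LinearFacts.
Variables (V W : lmodType A) (phi : V -> W).
Hypothesis lphi : linear phi.

Lemma lin0 : phi 0 = 0.
Proof. by have := lphi (-1) 0 0; rewrite scaler0 addr0 scaleN1r addNr. Qed.

Lemma linD u v : phi (u + v) = phi u + phi v.
Proof. by have := lphi 1 u v; rewrite !scale1r. Qed.

Lemma linZ a u : phi (a *: u) = a *: phi u.
Proof. by have := lphi a u 0; rewrite lin0 !addr0. Qed.

Lemma linN u : phi (- u) = - phi u.
Proof. by rewrite -scaleN1r linZ scaleN1r. Qed.

Lemma linB u v : phi (u - v) = phi u - phi v.
Proof. by rewrite linD linN. Qed.

Lemma cobord_linear f s : cobord (fun u => phi (f u)) s = phi (cobord f s).
Proof.
elim: s f => [|x s IH] f /=; first by rewrite lin0.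
by rewrite IH linB linZ.
Qed.
End LinearFacts.

Lemma choose_on (V : lmodType A) j (P : seq A -> V -> Prop) :
  (forall s, list_in j s -> exists v, P s v) ->
  exists g, forall s, list_in j s -> P s (g s).
Proof.
move=> H; have [s|g Hg] := @choice _ _ (fun s v => list_in j s -> P s v); last by exists g.
by have [/H [v Pv]|n] := pselect (list_in j s); [exists v|exists 0 => /n].
Qed.

Section ExactSequence.
Variables (V : lmodType A) (Z Z1 B : set V).
Hypotheses (sZ : is_submod Z) (sZ1 : is_submod Z1) (sB : is_submod B).
Hypotheses (Z1Z : Z1 `<=` Z) (BZ1 : B `<=` Z1).

(** This and the next two lemmas are the long exact sequence of 0 -> Z1/B -> Z/B -> Z/Z1 -> 0,
    carried out on cochains. Here a cocycle is made a coboundary modulo [Z1], and the remainder is a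
    cocycle of Z1/B; [vanishes_sub] and [vanishes_quo] go through the connecting map. *)
Lemma vanishes_ext j : vanishes Z1 B j -> vanishes Z Z1 j -> vanishes Z B j.
Proof.
move=> v1 v2 f Zf df.
have [|g [Zg fg]] := v2 f Zf; first by move=> s js; apply/BZ1/df.
have [|g' [Zg' fg']] := v1 (fun s => f s - cobord g s) fg.
  move=> s js; rewrite (cobordB f (cobord g)) cobord_cobord subr0; exact: df.
exists (fun s => g s + g' s); split.
  move=> i s ji is_; apply: submodD => //; first exact: (Zg i).
  exact/Z1Z/(Zg' i).
by move=> s js; rewrite cobordD opprD addrA; apply: fg'.
Qed.

Lemma vanishes_sub j : vanishes Z B j ->
  (forall i, j = i.+1 -> vanishes Z Z1 i) -> vanishes Z1 B j.
Proof.
move=> v1 v2 f Z1f df.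
have [|//|g [Zg fg]] := v1 f; first by move=> s js; apply/Z1Z/Z1f.
case: j => [|j] in v1 v2 Z1f df Zg fg *.
  by exists g; split.
have [||h [Zh gh]] := v2 j erefl g.
- by move=> s js; apply: (Zg j).
- move=> s js; apply: submod_subr (Z1f _ js) => //; apply: BZ1; exact: fg.
exists (fun s => g s - cobord h s); split; first by move=> i s [<-]; apply: gh.
by move=> s js; rewrite (cobordB g (cobord h)) cobord_cobord subr0; apply: fg.
Qed.

Lemma vanishes_quo j : vanishes Z B j -> vanishes Z1 B j.+1 -> vanishes Z Z1 j.
Proof.
move=> v1 v2 f Zf df.
have [|g [Z1g fg]] := v2 (cobord f) df.
  by move=> s _; rewrite cobord_cobord; apply: submod0.
have [||h [Zh fh]] := v1 (fun s => f s - g s).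
- by move=> s js; apply: submodB => //; [exact: Zf|apply/Z1Z/(Z1g j)].
- by move=> s js; rewrite cobordB; apply: fg.
exists h; split=> // s js; rewrite -(subrK (g s) (f s)) addrAC.
by apply: submodD => //; [apply/BZ1/fh|apply: (Z1g j)].
Qed.

Lemma cdepth_ext t : cdepth Z1 B t -> cdepth Z Z1 t -> cdepth Z B t.
Proof. by move=> h1 h2 j jt; apply: vanishes_ext; [apply: h1|apply: h2]. Qed.

Lemma cdepth_sub t : cdepth Z B t -> cdepth Z Z1 t.-1 -> cdepth Z1 B t.
Proof.
move=> h1 h2 j jt; apply: vanishes_sub; first exact: h1.
by move=> i ji; apply: h2; rewrite ji in jt; rewrite -ltnS (ltn_predK jt).
Qed.

Lemma cdepth_quo t : cdepth Z B t -> cdepth Z1 B t.+1 -> cdepth Z Z1 t.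
Proof. by move=> h1 h2 j jt; apply: vanishes_quo; [apply: h1|apply: h2]. Qed.
End ExactSequence.

Lemma cdepthW (V : lmodType A) (Z B : set V) t u : (u <= t)%N -> cdepth Z B t -> cdepth Z B u.
Proof. by move=> ut h j ju; apply: h; apply: leq_trans ut. Qed.

Lemma cdepth_trivial (V : lmodType A) (Z B : set V) t :
  is_submod Z -> is_submod B -> Z `<=` B -> cdepth Z B t.
Proof.
move=> sZ sB ZB j _ f Zf df; exists (fun=> 0); split; first by move=> *; apply: submod0.
move=> s js; apply: submodB => //; first exact/ZB/Zf.
by apply: (cobord_mem sB _ js) => *; apply: submod0.
Qed.

Section Transfer.
Variables (V' V : lmodType A) (phi : V' -> V) (Z' B' : set V') (Z B : set V).
Hypothesis lphi : linear phi.
Hypotheses (sZ' : is_submod Z') (sB' : is_submod B') (sZ : is_submod Z) (sB : is_submod B).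
Hypothesis phiZ : forall v, Z' v -> Z (phi v).
Hypothesis phiI : forall v, Z' v -> B (phi v) -> B' v.
Hypothesis phiB : forall v, B' v -> B (phi v).
Hypothesis phiS : forall z, Z z -> exists2 v, Z' v & B (z - phi v).

Lemma vanishes_image j : vanishes Z' B' j -> vanishes Z B j.
Proof.
move=> h f Zf df.
have [|f' Hf'] := @choose_on V' j (fun s v => Z' v /\ B (f s - phi v)).
  by move=> s js; have [v Zv Bv] := phiS (Zf s js); exists v.
have [||g' [Zg' fg']] := h f'; first by move=> s /Hf' [].
  move=> s js; apply: phiI.
    by apply: (cobord_mem sZ' _ js) => i u [<-] /Hf' [].
  rewrite -(cobord_linear lphi); apply: submod_subr (df s js) => //.
  by apply: (eq_cobord_mem sB _ js) => i u [<-] /Hf' [].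
exists (fun s => phi (g' s)); split.
  by move=> i s ji /(Zg' i s ji)/phiZ.
move=> s js; rewrite (cobord_linear lphi) -(subrK (phi (f' s)) (f s)) -addrA -(linB lphi).
by apply: submodD => //; [case: (Hf' s js)|apply/phiB/fg'].
Qed.

Lemma vanishes_preimage j : vanishes Z B j -> vanishes Z' B' j.
Proof.
move=> h f' Zf' df'.
have [||g [Zg fg]] := h (fun s => phi (f' s)).
- by move=> s /Zf'/phiZ.
- by move=> s js; rewrite (cobord_linear lphi); apply/phiB/df'.
case: j => [|j] in h Zf' df' Zg fg *.
  exists (fun=> 0); split=> // -[|//] js /=; rewrite subr0.
  by apply: phiI; [apply: Zf'|have := fg [::] I; rewrite /= subr0].
have [|g' Hg'] := @choose_on V' j (fun s v => Z' v /\ B (g s - phi v)).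
  by move=> s js; have [v Zv Bv] := phiS (Zg j s erefl js); exists v.
exists g'; split; first by move=> i s [<-] /Hg' [].
move=> s js; apply: phiI.
  apply: submodB => //; first exact: Zf'.
  by apply: (cobord_mem sZ' _ js) => i u [<-] /Hg' [].
rewrite (linB lphi) -(cobord_linear lphi) -(subrK (cobord g s) (phi (f' s))) -addrA.
apply: submodD => //; first exact: fg.
by apply: (eq_cobord_mem sB _ js) => i u [<-] /Hg' [].
Qed.

Lemma cdepth_image t : cdepth Z' B' t -> cdepth Z B t.
Proof. by move=> h j /h/vanishes_image. Qed.
Lemma cdepth_preimage t : cdepth Z B t -> cdepth Z' B' t.
Proof. by move=> h j /h/vanishes_preimage. Qed.
End Transfer.

(** Z'/B' is a direct summand of Z/B, [psi] being a left inverse of [phi] modulo [B']. *)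
Lemma cdepth_retract (V' V : lmodType A) (phi : V' -> V) (psi : V -> V')
    (Z' B' : set V') (Z B : set V) t :
  linear phi -> linear psi -> is_submod B' ->
  (forall v, Z' v -> Z (phi v)) -> (forall v, B' v -> B (phi v)) ->
  (forall v, Z v -> Z' (psi v)) -> (forall v, B v -> B' (psi v)) ->
  (forall v, Z' v -> B' (v - psi (phi v))) ->
  cdepth Z B t -> cdepth Z' B' t.
Proof.
move=> lphi lpsi sB' pZ pB qZ qB K h j /h {}h f Zf df.
have [||g [Zg fg]] := h (fun s => phi (f s)).
- by move=> s /Zf/pZ.
- by move=> s js; rewrite (cobord_linear lphi); apply/pB/df.
exists (fun s => psi (g s)); split; first by move=> i s ji /(Zg i s ji)/qZ.
move=> s js; rewrite (cobord_linear lpsi) -(subrK (psi (phi (f s))) (f s)) -addrA -(linB lpsi).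
by apply: submodD => //; [apply/K/Zf|apply/qB/fg].
Qed.

Section NonZeroDivisor.
Variables (V : lmodType A) (Z B : set V) (x : A).
Hypotheses (sZ : is_submod Z) (sB : is_submod B) (BZ : B `<=` Z).
Hypothesis xreg : forall z, Z z -> B (x *: z) -> B z.

(* Only this direction uses that [J] annihilates the cohomology. *)
Lemma vanishes_mod_inv j : J x -> (forall i, j = i.+1 -> vanishes Z (scaled_add B x Z) i) ->
  vanishes Z B j.
Proof.
move=> Jx h f Zf df.
case: j => [|j] in h Zf df *.
  exists (fun=> 0); split=> // -[|//] js /=; rewrite subr0; apply: xreg; first exact: Zf.
  by have := df [:: x]; rewrite /= subr0; apply.
(* The cocycle condition on [x :: s] says that x f is the coboundary of the function sending u to f
   (x :: u), modulo [B]. So that function is a cocycle modulo xZ and equals dg + xq; taking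
   coboundaries, x f = x dq modulo [B], and x cancels. *)
have [||g [Zg fg]] := h j erefl (fun s => f (x :: s)).
- by move=> s js; apply: Zf.
- move=> s js; have /= dfx := df (x :: s) (conj Jx js).
  exists (- (x *: f s - cobord (fun u => f (x :: u)) s)), (x *: f s); split.
  + exact: submodN.
  + by exists (f s) => //; apply: Zf.
  + by rewrite opprB subrK.
have [|q Hq] := @choose_on V j (fun s v => Z v /\ B (f (x :: s) - cobord g s - x *: v)).
  move=> s /fg [b [_ [Bb [z Zz <-] ->]]]; exists z; by rewrite addrK.
exists q; split; first by move=> i s [<-] /Hq [].
move=> s js; have Zd : Z (cobord q s).
  by apply: (cobord_mem sZ _ js) => i u [<-] /Hq [].
apply: xreg; first by apply: submodB => //; apply: Zf.
have /= dfx := df (x :: s) (conj Jx js).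
rewrite scalerBr -cobordZ.
rewrite -(subrK (cobord (fun u => f (x :: u)) s) (x *: f s)) -addrA; apply: submodD => //.
have : B (cobord (fun u => f (x :: u) - cobord g u - x *: q u) s).
  by apply: (cobord_mem sB _ js) => i u [<-] /Hq [].
rewrite (cobordB (fun u => f (x :: u) - cobord g u)) (cobordB (fun u => f (x :: u)) (cobord g)).
by rewrite cobord_cobord subr0.
Qed.

Lemma cdepth_mod_inv t : J x -> cdepth Z (scaled_add B x Z) t -> cdepth Z B t.+1.
Proof.
by move=> Jx h j jt; apply: vanishes_mod_inv => // i ji; apply: h; rewrite ji in jt.
Qed.

(** Multiplication by [x] is an isomorphism of Z/B onto (B + xZ)/B. *)
Lemma cdepth_scaled t : cdepth Z B t -> cdepth (scaled_add B x Z) B t.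
Proof.
have sX := submod_scaled_add x sZ sB.
apply: (@cdepth_image V V ( *:%R x)) => //.
- by move=> a u v; rewrite scalerDr !scalerA mulrC.
- by move=> v Zv; exists 0, (x *: v); split; [exact: submod0|exists v|rewrite add0r].
- by move=> v Bv; apply: submodZ.
- move=> _ [b [_ [Bb [z Zz <-] ->]]]; exists z => //=; by rewrite addrK.
Qed.

Lemma cdepth_mod t : cdepth Z B t.+1 -> cdepth Z (scaled_add B x Z) t.
Proof.
move=> h; have sX := submod_scaled_add x sZ sB.
apply: (@cdepth_quo V Z _ B) => //.
- move=> _ [b [_ [Bb [z Zz <-] ->]]]; apply: submodD => //; first exact: BZ.
  exact: submodZ.
- by move=> b Bb; exists b, 0; split=> //; [exists 0; rewrite ?scaler0 //; exact: submod0|rewrite addr0].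
- exact: cdepthW h.
- exact: cdepth_scaled.
Qed.
End NonZeroDivisor.

End Cochains.

(** * Koszul complexes and sliding depth *)

Section Koszul.
Variable A : comNzRingType.
Implicit Types (K I : set A) (m h : seq A).

(* The exterior algebra of [A^(n+1)] as a sum of two copies of that of [A^n]: *)
(* the elements without and with the first basis vector.                      *)
Fixpoint KV (n : nat) : lmodType A :=
  if n is n'.+1 then (KV n' * KV n')%type : lmodType A else A^o.

Definition shift_deg (V : lmodType A) (D : nat -> set V) (i : nat) : set V :=
  if i is i'.+1 then D i' else [set 0].

Fixpoint kdeg (n i : nat) : set (KV n) :=
  match n return set (KV n) with
  | 0%N => [set f | i = 0%N \/ f = 0]
  | n'.+1 => [set f | @kdeg n' i f.1 /\ shift_deg (@kdeg n') i f.2]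
  end.

Arguments kdeg : clear implicits.

Fixpoint kcoef (n : nat) K : set (KV n) :=
  match n return set (KV n) with
  | 0%N => K
  | n'.+1 => [set f | @kcoef n' K f.1 /\ @kcoef n' K f.2]
  end.

Arguments kcoef : clear implicits.

Fixpoint kd m : KV (size m) -> KV (size m) :=
  match m return KV (size m) -> KV (size m) with
  | [::] => fun=> 0
  | x :: m' => fun f => (kd (m := m') f.1 + x *: f.2, - kd (m := m') f.2)
  end.

(** Exterior multiplication on the left by the vector [h], whose missing entries count as 0. By
    [kd_wedge] it is a homotopy for the multiplication by [dot h m]. *)
Fixpoint wedge (n : nat) h : KV n -> KV n :=
  match n return KV n -> KV n with
  | 0%N => fun=> 0
  | n'.+1 => fun f => (wedge (n := n') (behead h) f.1,
                       head 0 h *: f.1 - wedge (n := n') (behead h) f.2)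
  end.

Fixpoint dot h m : A :=
  if m is x :: m' then head 0 h * x + dot (behead h) m' else 0.

Fixpoint ktop (n : nat) (r : A) : KV n :=
  if n is n'.+1 then (0, ktop n' r) else r.

(** The preimage of the cycles of the Koszul complex over A/K. Hence [kdeg] modulo [kcyc] is
    isomorphic to the boundaries of degree i - 1 over A/K. *)
Definition kcyc m K i : set (KV (size m)) :=
  [set f | kdeg (size m) i f /\ kcoef (size m) K (kd f)].

Arguments kcyc : clear implicits.

Definition kdegc n K i : set (KV n) := [set f | kdeg n i f /\ kcoef n K f].

Arguments kdegc : clear implicits.

Lemma submod_prod (V W : lmodType A) (Z1 : set V) (Z2 : set W) :
  is_submod Z1 -> is_submod Z2 -> is_submod [set f : V * W | Z1 f.1 /\ Z2 f.2].
Proof.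
move=> s1 s2; split; first by split; apply: submod0.
  by move=> x y [x1 x2] [y1 y2]; split; apply: submodD.
by move=> a x [x1 x2]; split; apply: submodZ.
Qed.

Lemma submod_setI (V : lmodType A) (Z1 Z2 : set V) :
  is_submod Z1 -> is_submod Z2 -> is_submod [set f | Z1 f /\ Z2 f].
Proof.
move=> s1 s2; split; first by split; apply: submod0.
  by move=> x y [x1 x2] [y1 y2]; split; apply: submodD.
by move=> a x [x1 x2]; split; apply: submodZ.
Qed.

Lemma submod_preimage (V W : lmodType A) (phi : V -> W) (Z : set W) :
  linear phi -> is_submod Z -> is_submod [set f | Z (phi f)].
Proof.
move=> lphi sZ; split=> /=; first by rewrite (lin0 lphi); apply: submod0.
  by move=> x y Zx Zy; rewrite (linD lphi); apply: submodD.
by move=> a x Zx; rewrite (linZ lphi); apply: submodZ.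
Qed.

Lemma submod_image (V W : lmodType A) (phi : V -> W) (Z : set V) :
  linear phi -> is_submod Z -> is_submod [set phi f | f in Z].
Proof.
move=> lphi sZ; split; first by exists 0; [exact: submod0|exact: lin0].
  by move=> _ _ [x Zx <-] [y Zy <-]; exists (x + y); [exact: submodD|exact: linD].
by move=> a _ [x Zx <-]; exists (a *: x); [exact: submodZ|exact: linZ].
Qed.

Lemma submod_shift (V : lmodType A) (D : nat -> set V) i :
  (forall i, is_submod (D i)) -> is_submod (shift_deg D i).
Proof. by move=> sD; case: i => [|i] //=; apply: submod_zero. Qed.

Lemma submod_kdeg n i : is_submod (kdeg n i).
Proof.
elim: n i => [|n IH] i /=; last by apply: submod_prod => //; apply: submod_shift.
split; first by right.
  by move=> x y [i0|->] [i1|->]; rewrite ?addr0; by [left|right].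
by move=> a x [i0|->]; rewrite ?scaler0; by [left|right].
Qed.

Lemma submod_kcoef n K : is_ideal K -> is_submod (kcoef n K).
Proof. by move=> iK; elim: n => [|n IH] //=; apply: submod_prod. Qed.

Lemma submod_kdegc n K i : is_ideal K -> is_submod (kdegc n K i).
Proof. by move=> iK; apply: submod_setI; [apply: submod_kdeg|apply: submod_kcoef]. Qed.

Lemma kd_linear m : linear (@kd m).
Proof.
elim: m => [|x m IH] a u v /=; first by rewrite scaler0 addr0.
rewrite !IH; congr pair => /=; last by rewrite opprD scalerN.
by rewrite !scalerDr !scalerA [x * a]mulrC addrACA.
Qed.

Lemma wedge_linear n h : linear (@wedge n h).
Proof.
elim: n h => [|n IH] h a u v /=; first by rewrite scaler0 addr0.
rewrite !IH; congr pair => /=.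
by rewrite !scalerDr !scalerA [head 0 h * a]mulrC opprD scalerN addrACA.
Qed.

Lemma submod_kcyc m K i : is_ideal K -> is_submod (kcyc m K i).
Proof.
move=> iK; apply: submod_setI; first exact: submod_kdeg.
by apply: submod_preimage; [apply: kd_linear|apply: submod_kcoef].
Qed.

Lemma kd_kd m (f : KV (size m)) : kd (kd f) = 0.
Proof.
elim: m f => [|x m IH] f //=.
have lk := @kd_linear m.
by rewrite (linD lk) (linZ lk) (linN lk) !IH !oppr0 add0r scalerN addrN.
Qed.

Lemma kd_deg m i (f : KV (size m)) :
  kdeg (size m) i f -> shift_deg (kdeg (size m)) i (kd f).
Proof.
elim: m i f => [|x m IH] i f /=.
  by case: i => [|i] //= _; right.
move=> [/IH f0]; case: i f0 => [|i] /= f0 f1.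
  by rewrite f0 f1 (lin0 (@kd_linear m)) scaler0 addr0 oppr0.
have s := submod_kdeg; split; first by apply: submodD => //; apply: submodZ.
by have := IH _ _ f1; case: (i) => [|i'] /= e; [rewrite e oppr0|apply: submodN].
Qed.

Lemma kd_coef m I (f : KV (size m)) : is_ideal I -> (forall x, x \in m -> I x) ->
  kcoef (size m) I (kd f).
Proof.
move=> iI; have Ix n (g : KV n) x : I x -> kcoef n I (x *: g).
  move=> Ix; elim: n g => [|n IH] g /=; last by split; apply: IH.
  by rewrite /GRing.scale /= mulrC; case: iI => _ _; apply.
elim: m f => [|x m IH] f Im /=; first by case: iI.
have s := submod_kcoef (size m) iI.
have Im' y : y \in m -> I y by move=> ym; apply: Im; rewrite inE ym orbT.
split; first by apply: submodD => //; [apply: IH|apply/Ix/Im; rewrite mem_head].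
by apply: submodN => //; apply: IH.
Qed.

Lemma kd_coefW m K (f : KV (size m)) : is_ideal K ->
  kcoef (size m) K f -> kcoef (size m) K (kd f).
Proof.
move=> iK; elim: m f => [|x m IH] f /=; first by move=> _; case: iK.
have s := submod_kcoef (size m) iK.
move=> [f0 f1]; split; last by apply: submodN => //; apply: IH.
by apply: submodD => //; [apply: IH|apply: submodZ].
Qed.

Lemma kd_wedge m h (f : KV (size m)) :
  kd (wedge h f) + wedge h (kd f) = dot h m *: f.
Proof.
elim: m h f => [|x m IH] h f /=; first by rewrite scale0r addr0.
case: f => f0 f1 /=.
have lk := @kd_linear m; have lw := @wedge_linear (size m) (behead h).
rewrite !(linD lk, linN lk, linZ lk, linD lw, linN lw, linZ lw).
congr pair => /=.
  rewrite scalerBr scalerA [head 0 h * x]mulrC scalerDl -IH.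
  by rewrite addrACA subrK addrC.
rewrite opprD !opprK scalerDr scalerA scalerDl -IH.
by rewrite addrACA addKr.
Qed.

Lemma wedge_deg n h i (f : KV n) : kdeg n i f -> kdeg n i.+1 (wedge h f).
Proof.
elim: n h i f => [|n IH] h i f /=; first by move=> _; right.
move=> [f0 f1]; split; first exact: IH.
apply: submodB; [exact: submod_kdeg|apply: submodZ => //; exact: submod_kdeg|].
case: i f0 f1 => [|i] /= _ f1; last exact: IH.
by rewrite f1 (lin0 (@wedge_linear n _)); exact: (submod0 (submod_kdeg _ _)).
Qed.

Lemma wedge_coef n h K (f : KV n) : is_ideal K -> kcoef n K f -> kcoef n K (wedge h f).
Proof.
move=> iK; elim: n h f => [|n IH] h f /=; first by move=> _; case: iK.
move=> [f0 f1]; split; first exact: IH.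
have s := submod_kcoef n iK.
by apply: submodB => //; [apply: submodZ|apply: IH].
Qed.

Lemma kdeg_big n i (f : KV n) : (n < i)%N -> kdeg n i f -> f = 0.
Proof.
elim: n i f => [|n IH] [|i] //= f; first by move=> _ [].
case: f => f0 f1 /= ni [k0 k1]; rewrite (IH i.+1 f0) //; last exact: ltnW.
by rewrite (IH i f1).
Qed.

Lemma ktop_linear n : linear (ktop n : A^o -> KV n).
Proof. by elim: n => [|n IH] a u v //=; rewrite IH; congr pair; rewrite /= scaler0 addr0. Qed.

Lemma kdeg_ktop n r : kdeg n n (ktop n r).
Proof. by elim: n => [|n IH] /=; [left|split=> //; exact: (submod0 (submod_kdeg _ _))]. Qed.

Lemma ktop_surj n (f : KV n) : kdeg n n f -> exists r, f = ktop n r.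
Proof.
elim: n f => [|n IH] f /=; first by exists f.
case: f => f0 f1 /= [/kdeg_big -> // /IH [r ->]]; by exists r.
Qed.

Lemma kcoef_ktop n K r : is_ideal K -> kcoef n K (ktop n r) <-> K r.
Proof.
move=> iK; elim: n => [|n IH] //=; split; first by move=> [_ /IH].
by move=> /IH Kr; split=> //; exact: (submod0 (submod_kcoef _ _)).
Qed.

(** In top degree n, chains modulo [kcyc] are A / (K : (m)). This is how [slides] yields the depth
    of a residual quotient. *)
Lemma kd_ktop m K r : is_ideal K ->
  kcoef (size m) K (kd (ktop (size m) r)) <-> forall x, x \in m -> K (r * x).
Proof.
move=> iK; elim: m => [|y m IH] /=; first by split=> // _; case: iK.
have s := submod_kcoef (size m) iK.
rewrite (lin0 (@kd_linear m)) add0r; split.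
  move=> [] k1 /(submodN s); rewrite opprK => /IH k2 x; rewrite inE => /orP[/eqP ->|]; last exact: k2.
  apply/(@kcoef_ktop (size m) K (r * y)) => //; rewrite mulrC.
  by rewrite (linZ (@ktop_linear (size m)) y r).
move=> k; split; last first.
  by apply: submodN => //; apply/IH => x xm; apply: k; rewrite inE xm orbT.
rewrite -(linZ (@ktop_linear (size m)) y r).
by apply/kcoef_ktop => //; rewrite /GRing.scale /= mulrC; apply: k; rewrite mem_head.
Qed.

Lemma dot_mem m I h : is_ideal I -> (forall x, x \in m -> I x) -> I (dot h m).
Proof.
move=> [I0 ID IM]; elim: m h => [|x m IH] h Im //=.
apply: ID; first by apply/IM/Im; rewrite mem_head.
by apply: IH => y ym; apply: Im; rewrite inE ym orbT.
Qed.

Lemma dot_ideal m : is_ideal [set x | exists h, x = dot h m].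
Proof.
split.
- exists [::]; elim: m => [|x m IH] //=; by rewrite mul0r -IH addr0.
- move=> _ _ [h ->] [g ->]; elim: m h g => [|x m IH] h g; first by exists [::]; rewrite /= addr0.
  have [l e] := IH (behead h) (behead g).
  by exists (head 0 h + head 0 g :: l); rewrite /= -e mulrDl addrACA.
- move=> a _ [h ->]; elim: m h => [|x m IH] h; first by exists [::]; rewrite /= mulr0.
  have [l e] := IH (behead h).
  by exists (a * head 0 h :: l); rewrite /= -e mulrDr mulrA.
Qed.

Lemma mem_dot m x : x \in m -> exists h, x = dot h m.
Proof.
elim: m => [|y m IH] //; rewrite inE => /orP[/eqP ->|/IH [h ->]].
  exists [:: 1] => /=; rewrite mul1r; suff -> : dot [::] m = 0 by rewrite addr0.
  by elim: m {IH} => [|z m IH] //=; rewrite mul0r add0r.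
by exists (0 :: h); rewrite /= mul0r add0r.
Qed.

Section Depth.
Variable J : set A.

Lemma cdepth_prod (V W : lmodType A) (Z1 B1 : set V) (Z2 B2 : set W) t :
  is_submod Z1 -> is_submod B1 -> is_submod Z2 -> is_submod B2 ->
  B1 `<=` Z1 -> B2 `<=` Z2 ->
  cdepth J Z1 B1 t -> cdepth J Z2 B2 t ->
  cdepth J (V := (V * W)%type) [set f | Z1 f.1 /\ Z2 f.2] [set f | B1 f.1 /\ B2 f.2] t.
Proof.
move=> sZ1 sB1 sZ2 sB2 BZ1 BZ2 d1 d2.
have sB := submod_prod sB1 sB2; have sZ := submod_prod sZ1 sZ2.
have sM := submod_prod sZ1 sB2.
apply: (@cdepth_ext _ _ _ _ [set f | Z1 f.1 /\ B2 f.2]) => //.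
- by move=> f [f1 /BZ2].
- by move=> f [/BZ1].
- apply: (@cdepth_image _ _ V _ (fun v => (v, 0)) Z1 B1) => //=.
  + by move=> a u v; congr pair; rewrite /= scaler0 addr0.
  + by move=> v Zv; split=> //; apply: submod0.
  + by move=> v _ [].
  + by move=> v Bv; split=> //; apply: submod0.
  + move=> [f g] /= [Zf Bg]; exists f => //; rewrite subrr subr0; split=> //; exact: submod0.
- apply: (@cdepth_image _ _ W _ (fun v => (0, v)) Z2 B2) => //=.
  + by move=> a u v; congr pair; rewrite /= scaler0 addr0.
  + by move=> v Zv; split=> //; apply: submod0.
  + by move=> v _ [].
  + by move=> v Bv; split=> //; apply: submod0.
  + move=> [f g] /= [Zf Zg]; exists g => //; rewrite subrr subr0; split=> //; exact: submod0.
Qed.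

Lemma cdepth_free n K i t : is_ideal K ->
  cdepth J (setT : set A^o) K t -> cdepth J (kdeg n i) (kdegc n K i) t.
Proof.
move=> iK d; elim: n i => [|n IH] i.
  case: i => [|i].
    apply: (@cdepth_image _ _ A^o _ id setT K) => //=.
    - exact: submod_kdegc.
    - by left.
    - by move=> v _ [].
    - by split=> //; left.
    - move=> z _; exists z => //; rewrite subrr; split; [by left|by case: iK].
  apply: cdepth_trivial; [exact: submod_kdeg|exact: submod_kdegc|].
  by move=> f [] // ->; exact: (submod0 (submod_kdegc _ _ _)).
have dS : cdepth J (shift_deg (kdeg n) i) [set f | shift_deg (kdeg n) i f /\ kcoef n K f] t.
  case: i => [|i] /=; last exact: IH.
  apply: cdepth_trivial; [exact: submod_zero| |].
    by apply: submod_setI; [apply: submod_zero|apply: submod_kcoef].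
  by move=> f ->; split=> //; exact: (submod0 (submod_kcoef _ _)).
have -> : kdegc n.+1 K i = [set f | kdegc n K i f.1 /\
            [set g | shift_deg (kdeg n) i g /\ kcoef n K g] f.2].
  by apply/seteqP; split=> f [] [? ?] [? ?]; do !split.
have sS : is_submod (shift_deg (kdeg n) i) by apply/submod_shift/submod_kdeg.
apply: cdepth_prod => //; first exact: submod_kdeg.
- exact: submod_kdegc.
- by apply: submod_setI => //; apply: submod_kcoef.
- by move=> f [].
- by move=> f [].
Qed.

(** Sliding depth over A/K, expressed through the boundaries F_i / Z_i(K) instead of the homology.
    In this form it passes through the step below, and its top degree speaks of the colon ideal. *)
Definition slides m K (e : nat) : Prop :=
  forall i, (i <= size m)%N -> cdepth J (kdeg (size m) i) (kcyc m K i) (e + i - size m).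

Section Step.
Variables (m : seq A) (K I : set A) (e : nat) (a : A).
Hypotheses (iK : is_ideal K) (iI : is_ideal I).
Hypothesis Im : forall x, x \in m -> I x.
Hypothesis aI : exists h, a = dot h m.
Hypothesis areg : forall z, K (a * z) -> K z.
Hypotheses (dK : cdepth J (setT : set A^o) K e.+1) (sl : slides m K e.+1).

Let K' : set A := scaled_add (V := A^o) K a setT.

Lemma ideal_scaled : is_ideal K'.
Proof. exact: (@submod_scaled_add A A^o setT K a (submodT _) iK). Qed.

Lemma cdepth_step : cdepth J (setT : set A^o) K' e.
Proof.
apply: cdepth_mod => //.
by move=> z _; apply: areg.
Qed.

Let areg_coef n (f : KV n) : kcoef n K (a *: f) -> kcoef n K f.
Proof. by elim: n f => [|n IH] f /=; [apply: areg|move=> [/IH ? /IH ?]]. Qed.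

Let coef_scaled n i (f : KV n) : kdeg n i f -> kcoef n K' f ->
  exists g w, [/\ kdeg n i w, kcoef n K g & f = g + a *: w].
Proof.
elim: n i f => [|n IH] i f /=.
  move=> [-> [b [_ [Kb [z _ <-] ->]]]|-> _]; first by exists b, z; split=> //; left.
  by exists 0, 0; split; [right|case: iK|rewrite scaler0 addr0].
case: f => f0 f1 /= [d0 d1] [/(IH i) -/(_ d0) [g0 [w0 [e0 k0 ->]]] k].
have [g1 [w1 [e1 k1 ->]]] : exists g1 w1, [/\ shift_deg (kdeg n) i w1, kcoef n K g1 & f1 = g1 + a *: w1].
  case: i d0 d1 e0 => [|i] /= d0 d1 e0; last exact: IH.
  by exists 0, 0; split; rewrite // ?scaler0 ?addr0 //; exact: (submod0 (submod_kcoef _ _)).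
by exists (g0, g1), (w0, w1).
Qed.

Let kcyc_sub i : kcyc m K i `<=` kcyc m K' i.
Proof.
move=> f [df kf]; split=> //; elim: (size m) (kd f) kf => [|n IH] g /=.
  by move=> Kg; exists g, 0; split; rewrite ?addr0 //; exists 0; rewrite ?scaler0.
by move=> [/IH ? /IH ?].
Qed.

(* The map is the homotopy [wedge h], where [a = dot h m].  *)
Lemma slides_step : slides m K' e.
Proof.
have sF i : is_submod (kdeg (size m) i) by apply: submod_kdeg.
have sK : is_submod (kcoef (size m) K) by apply: submod_kcoef.
have iK' := ideal_scaled.
have sc f : is_submod (kcyc m K f) by apply: submod_kcyc.
have sc' f : is_submod (kcyc m K' f) by apply: submod_kcyc.
have [h ah] := aI.
case=> [|i] im.
  apply: cdepth_trivial => // f df; split=> //.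
  by have /= -> := kd_deg df; exact: (submod0 (submod_kcoef _ _)).
(* The chain Z_{i+1}(K) in Z_{i+1}(K') in F_{i+1} reduces the claim to the depth of Z_{i+1}(K') /
   Z_{i+1}(K). *)
apply: (@cdepth_quo _ _ _ _ _ (kcyc m K i.+1)) => //; first by move=> f [].
  by apply: cdepthW (sl im); rewrite leq_sub2r // addSn.
(* That quotient is isomorphic to Z_i(K) / K F_i. If the differential of f is g + a w with g over
   [K], then w is a cycle modulo [K] because [a] is regular, and f minus the wedge of w is again a
   cycle modulo [K]. *)
apply: (@cdepth_image _ _ (KV (size m)) _ (@wedge _ h) (kcyc m K i) (kdegc (size m) K i)) => //.
- exact: wedge_linear.
- move=> f [df kf]; split; first exact: wedge_deg.
  have -> : kd (wedge h f) = a *: f - wedge h (kd f) by rewrite ah -kd_wedge addrK.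
  have kw : kcoef (size m) K (wedge h (kd f)) by apply: wedge_coef.
  elim: (size m) f {df kf} (wedge h (kd f)) kw => [|n IH] f g /=; last first.
    by move=> [k1 k2]; split; apply: IH.
  move=> Kg; exists (- g), (a *: f); split; [exact: (@submodN _ A^o)|by exists f|exact: addrC].
- move=> f [df kf] [_ kw]; split=> //; apply: areg_coef.
  rewrite ah -kd_wedge; apply: submodD => //; exact: wedge_coef.
- move=> f [df kf]; split; first exact: wedge_deg.
  have -> : kd (wedge h f) = a *: f - wedge h (kd f) by rewrite ah -kd_wedge addrK.
  apply: submodB => //; first exact: submodZ.
  by apply: wedge_coef => //; apply: kd_coefW.
- move=> f [df]; case/(coef_scaled (kd_deg df)) => g [w [dw kg e']].
  have kw : kcyc m K i w.
    split=> //; apply: areg_coef; rewrite -(linZ (@kd_linear m)).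
    have -> : a *: w = kd f - g by rewrite e' addrC addKr.
    rewrite (linB (@kd_linear m)) kd_kd sub0r; apply: submodN => //.
    exact: kd_coefW.
  exists w => //; split.
    by apply: submodB => //; apply: wedge_deg; case: kw.
  rewrite (linB (@kd_linear m)) e'.
  have -> : kd (wedge h w) = a *: w - wedge h (kd w) by rewrite ah -kd_wedge addrK.
  rewrite opprB -addrA [a *: w + _]addrC subrK.
  by apply: submodD => //; apply: wedge_coef => //; case: kw.
(* Now Z_i(K) / K F_i sits in the free module F_i / K F_i with quotient F_i / Z_i(K), whose depths
   are known. *)
- apply: (@cdepth_sub _ _ _ (kdeg (size m) i)) => //.
  + by move=> f [].
  + by move=> f [df kf]; split=> //; apply: kd_coefW.
  + apply: cdepth_free => //; apply: cdepthW dK.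
    by rewrite ltnS leq_subLR addnC leq_add2r.
  + by apply: cdepthW (sl (ltnW im)); rewrite addSnnS.
Qed.

Section Quotient.
Variable Kp : set A.
Hypothesis KpE : forall y, Kp y <-> forall x, x \in m -> K' (y * x).

Lemma ideal_quotient : is_ideal Kp.
Proof.
have [K0 KD KM] := ideal_scaled; split.
- by apply/KpE => x _; rewrite mul0r.
- by move=> x y /KpE hx /KpE hy; apply/KpE => z zm; rewrite mulrDl; apply: KD; auto.
- by move=> b x /KpE hx; apply/KpE => z zm; rewrite -mulrA; apply: KM; auto.
Qed.

(** The top degree of [slides_step], read through [ktop]. *)
Lemma cdepth_residual : cdepth J (setT : set A^o) Kp e.
Proof.
have iK' := ideal_scaled; have iKp := ideal_quotient.
have := slides_step (leqnn (size m)); rewrite addnK.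
apply: (@cdepth_preimage _ _ A^o _ (ktop (size m))) => //.
- exact: ktop_linear.
- exact: submod_kcyc.
- by move=> v _; apply: kdeg_ktop.
- by move=> v _ [_ /(kd_ktop _ _ iK')/KpE].
- by move=> v /KpE Kv; split; [exact: kdeg_ktop|exact/kd_ktop].
- by move=> z /ktop_surj [r ->]; exists r => //; rewrite subrr; exact: (submod0 (submod_kcyc _ _ _)).
Qed.

(** Koszul differentials have their coefficients in [I], and inside [I] lying in [Kp] or in [K'] is
    the same. So the cycles modulo [Kp] are those modulo [K']. *)
Lemma slides_residual : (forall y, Kp y -> I y -> K' y) -> slides m Kp e.
Proof.
move=> KpI i im; have := slides_step im.
suff -> : kcyc m Kp i = kcyc m K' i by [].
have iK' := ideal_scaled.
apply/seteqP; split=> f [df kf]; split=> //; last first.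
  elim: (size m) (kd f) kf => [|n IH] g /=; last by move=> [/IH ? /IH ?].
  move=> Kg; apply/KpE => x _; rewrite mulrC; case: iK' => _ _; exact.
have := kd_coef f iI Im.
elim: (size m) (kd f) kf => [|n IH] g /=; first exact: KpI.
by move=> [? ?] [? ?]; split; apply: IH.
Qed.
End Quotient.
End Step.

Section Zero.
Variable e : nat.
Hypothesis d0 : cdepth J (setT : set A^o) [set 0] e.

Lemma ideal_zero : is_ideal ([set 0] : set A).
Proof. exact: (@submod_zero A A^o). Qed.

Lemma kcoef0 n (f : KV n) : kcoef n [set 0] f <-> f = 0.
Proof.
elim: n f => [|n IH] f //=; case: f => f0 f1 /=; split.
  by move=> [/IH -> /IH ->].
by move=> [-> ->]; split; apply/IH.
Qed.

Lemma slides_nil : slides [::] [set 0] e.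
Proof.
case=> [|//] _; apply: cdepth_trivial; [exact: submod_kdeg|exact/submod_kcyc/ideal_zero|].
by move=> f df; split.
Qed.

Lemma slides_one : slides [:: 1] [set 0] e.
Proof.
have sc i : is_submod (kcyc [:: 1] [set 0] i) by apply/submod_kcyc/ideal_zero.
case=> [|[|//]] _.
  apply: cdepth_trivial => //; first exact: submod_kdeg.
  move=> f df; split=> //; have e0 : kd f = 0 := kd_deg df; rewrite e0; exact: (submod0 (submod_kcoef _ ideal_zero)).
rewrite addnK.
apply: (@cdepth_image _ _ A^o _ (ktop 1) setT [set 0]) => //.
- exact: ktop_linear.
- by move=> v _; apply: kdeg_ktop.
- by move=> v _ [_ /(kd_ktop _ _ ideal_zero)/(_ 1 (mem_head _ _))]; rewrite /= mulr1.
- by move=> v ->; rewrite (lin0 (ktop_linear 1)); apply: submod0.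
- by move=> z /(@ktop_surj 1) [r ->]; exists r => //; rewrite subrr; apply: submod0.
Qed.
End Zero.
End Depth.
End Koszul.

Arguments kdeg {A}.
Arguments kcoef {A}.
Arguments kdegc {A}.
Arguments kcyc {A}.
Arguments submod_kdeg {A}.

(** * Sliding depth over the ring itself: change of generators, homology, new variables *)

Section KoszulZero.
Variable A : comNzRingType.
Implicit Types m h : seq A.

Definition kbnd m i : set (KV A (size m)) := [set kd g | g in kdeg (size m) i.+1].
Arguments kbnd : clear implicits.

Definition spanned m (x : A) : Prop := exists h, x = dot h m.

Lemma kcyc0 m i (f : KV A (size m)) :
  kcyc m [set 0] i f <-> kdeg (size m) i f /\ kd f = 0.
Proof. by split=> -[df /kcoef0 kf]. Qed.

Lemma submod_kbnd m i : is_submod (kbnd m i).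
Proof. by apply: submod_image; [apply: kd_linear|apply: submod_kdeg]. Qed.

Section Isomorphism.

(** Weaker than [koszul_iso]: only the kernels have to correspond. This admits the scaling of all
    generators by a regular element, which multiplies the differential by that element. *)
Definition cycle_iso m m' : Prop := size m = size m' /\
  exists (phi : KV A (size m) -> KV A (size m')) (psi : KV A (size m') -> KV A (size m)),
    [/\ linear phi, cancel phi psi, cancel psi phi,
        (forall i f, kdeg (size m) i f <-> kdeg (size m') i (phi f)) &
        (forall f, kd f = 0 <-> kd (phi f) = 0)].

Definition koszul_iso m m' : Prop := size m = size m' /\
  exists (phi : KV A (size m) -> KV A (size m')) (psi : KV A (size m') -> KV A (size m)),
    [/\ linear phi, cancel phi psi, cancel psi phi,
        (forall i f, kdeg (size m) i f <-> kdeg (size m') i (phi f)) &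
        (forall f, kd (phi f) = phi (kd f))].

Lemma koszul_cycle_iso m m' : koszul_iso m m' -> cycle_iso m m'.
Proof.
move=> [e [phi [psi [lphi K K' D C]]]]; split=> //; exists phi, psi; split=> // f.
rewrite C; split=> [->|]; first exact: lin0.
by rewrite -[X in _ = X -> _](lin0 lphi) => /(can_inj K).
Qed.

Lemma koszul_iso_refl m : koszul_iso m m.
Proof. by split=> //; exists id, id; split. Qed.

Lemma koszul_iso_trans m1 m2 m3 : koszul_iso m1 m2 -> koszul_iso m2 m3 -> koszul_iso m1 m3.
Proof.
move=> [e [phi [psi [l K K' D C]]]] [e' [phi' [psi' [l' L L' D' C']]]].
split; first by rewrite e e'.
exists (phi' \o phi), (psi \o psi'); split.
- by move=> a u v; rewrite /= l l'.
- exact: can_comp.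
- exact: can_comp.
- by move=> i f; rewrite D D'.
- by move=> f; rewrite /= C' C.
Qed.

Lemma koszul_iso_sym m1 m2 : koszul_iso m1 m2 -> koszul_iso m2 m1.
Proof.
move=> [e [phi [psi [l K K' D C]]]]; split=> //; exists psi, phi; split=> //.
- by move=> a u v; apply: (can_inj K); rewrite l !K'.
- by move=> i f; rewrite D K'.
- by move=> f; apply: (can_inj K); rewrite K' -C K'.
Qed.

Lemma koszul_iso_cons x m1 m2 : koszul_iso m1 m2 -> koszul_iso (x :: m1) (x :: m2).
Proof.
move=> [e [phi [psi [l K K' D C]]]]; split; first by rewrite /= e.
exists (fun f => (phi f.1, phi f.2)), (fun f => (psi f.1, psi f.2)); split.
- by move=> a u v /=; rewrite !l.
- by case=> u v /=; rewrite !K.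
- by case=> u v /=; rewrite !K'.
- move=> i f /=; rewrite -D; case: i => [|i] /=; last by rewrite -D.
  split=> -[k] => [->|]; first by rewrite (lin0 l).
  by rewrite -[X in _ = X -> _](lin0 l) => /(can_inj K) ->.
- by move=> f /=; rewrite !C (linD l) (linZ l) (linN l).
Qed.

Lemma koszul_iso_swap x y m : koszul_iso [:: x, y & m] [:: y, x & m].
Proof.
split=> //; pose phi (f : KV A (size m).+2) : KV A (size m).+2 :=
  ((f.1.1, f.2.1), (f.1.2, - f.2.2)).
exists phi, phi; split.
- move=> a u v; rewrite /phi /=; congr pair; congr pair => /=.
  by rewrite opprD scalerN.
- by case=> [[? ?] [? ?]]; rewrite /phi /= opprK.
- by case=> [[? ?] [? ?]]; rewrite /phi /= opprK.
- have s j : is_submod (shift_deg (kdeg (A := A) (size m)) j).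
    by apply/submod_shift/submod_kdeg.
  have e f j : shift_deg (kdeg (A := A) (size m)) j (- f) <->
               shift_deg (kdeg (A := A) (size m)) j f.
    by split=> /(submodN (s j)); rewrite ?opprK.
  case=> [|i] [[f00 f01] [f10 f11]] /=.
    split=> -[[k1 k2] k3]; first by case: k3 => -> ->; rewrite k2 oppr0.
    by case: k3 => -> /eqP; rewrite oppr_eq0 => /eqP ->; rewrite k2.
  by rewrite e; split=> -[[? ?] [? ?]].
- move=> f; have l := @kd_linear A m; rewrite /phi /=; congr pair; congr pair => /=.
  + by rewrite addrAC.
  + by rewrite opprD scalerN.
  + by rewrite opprD scalerN opprK.
  + by rewrite (linN l) !opprK.
Qed.

Lemma koszul_iso_move x s t : koszul_iso (s ++ x :: t) (x :: s ++ t).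
Proof.
elim: s => [|y s IH] /=; first exact: koszul_iso_refl.
by apply: koszul_iso_trans (koszul_iso_swap _ _ _); apply: koszul_iso_cons.
Qed.

Lemma koszul_iso_cat s t : koszul_iso (s ++ t) (t ++ s).
Proof.
elim: t => [|x t IH] /=; first by rewrite cats0; apply: koszul_iso_refl.
by apply: koszul_iso_trans (koszul_iso_move _ _ _) _; apply: koszul_iso_cons.
Qed.

(** Changing the first basis vector by the combination [h] of the others turns the generator [b]
    into 0. *)
Lemma koszul_iso_spanned b m : spanned m b -> koszul_iso (b :: m) (0 :: m).
Proof.
move=> [h bh]; split=> //.
have lw := @wedge_linear A (size m) h; have l := @kd_linear A m.
exists (fun f => (f.1 + wedge h f.2, f.2)), (fun f => (f.1 - wedge h f.2, f.2)); split.
- move=> a u v /=; congr pair => /=.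
  by rewrite lw scalerDr addrACA.
- by case=> u v /=; rewrite addrK.
- by case=> u v /=; rewrite subrK.
- have s j : is_submod (kdeg (A := A) (size m) j) by apply: submod_kdeg.
  move=> i [u v] /=; have w : shift_deg (kdeg (size m)) i v -> kdeg (size m) i (wedge h v).
    case: i => [|i] /=; last exact: wedge_deg.
    by move=> ->; rewrite (lin0 lw); apply: submod0.
  split=> -[ku kv]; split=> //; first by apply: submodD => //; apply: w.
  by rewrite -(addrK (wedge h v) u); apply: submodB => //; apply: w.
- move=> f /=; congr pair; rewrite scale0r addr0 (linD l) (linN lw) bh -kd_wedge.
  by rewrite -!addrA subrr addr0.
Qed.

Lemma cycle_iso_scale y m : (forall z, y * z = 0 -> z = 0) ->
  cycle_iso m [seq y * x | x <- m].
Proof.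
move=> yreg; split; first by rewrite size_map.
suff [phi [psi [l K K' D C]]] : exists (phi : KV A (size m) -> KV A (size (map ( *%R y) m)))
    (psi : KV A (size (map ( *%R y) m)) -> KV A (size m)),
    [/\ linear phi, cancel phi psi, cancel psi phi,
        (forall i f, kdeg (size m) i f <-> kdeg (size (map ( *%R y) m)) i (phi f)) &
        (forall f, kd (phi f) = y *: phi (kd f))].
  exists phi, psi; split=> // f; rewrite C; split=> [->|]; first by rewrite (lin0 l) scaler0.
  have yregV n (g : KV A n) : y *: g = 0 -> g = 0.
    elim: n g => [|n IH] g /=; first exact: yreg.
    by case: g => u v [/IH -> /IH ->].
  by move=> /yregV; rewrite -[X in _ = X -> _](lin0 l) => /(can_inj K).
elim: m => [|x m [phi [psi [l K K' D C]]]] /=.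
  by exists id, id; split=> // f; rewrite scaler0.
exists (fun f => (phi f.1, phi f.2)), (fun f => (psi f.1, psi f.2)); split.
- by move=> a u v /=; rewrite !l.
- by case=> u v /=; rewrite !K.
- by case=> u v /=; rewrite !K'.
- move=> i f /=; rewrite -D; case: i => [|i] /=; last by rewrite -D.
  split=> -[k] => [->|]; first by rewrite (lin0 l).
  by rewrite -[X in _ = X -> _](lin0 l) => /(can_inj K) ->.
- move=> f /=; rewrite !C (linD l) (linZ l) (linN l); congr pair => /=.
    by rewrite scalerDr scalerA.
  by rewrite scalerN.
Qed.
End Isomorphism.

Section Slides.
Variables (J : set A) (e : nat).
Hypothesis d0 : cdepth J (setT : set A^o) [set 0] e.

Lemma slides_iso m m' : cycle_iso m m' -> slides J m [set 0] e -> slides J m' [set 0] e.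
Proof.
move=> [em [phi [psi [l K K' D C]]]] sl i im'.
have im : (i <= size m)%N by rewrite em.
have -> : (e + i - size m' = e + i - size m)%N by rewrite em.
move: (sl i im).
have i0 := ideal_zero A.
apply: (@cdepth_image _ _ _ _ phi) => //.
- exact: submod_kdeg.
- exact: submod_kcyc.
- by move=> v /D.
- by move=> v dv /kcyc0 [_ /C kv]; apply/kcyc0.
- by move=> v /kcyc0 [/D dv /C kv]; apply/kcyc0.
- move=> z dz; exists (psi z); first by apply/D; rewrite K'.
  by rewrite K' subrr; exact: (submod0 (submod_kcyc _ _ _)).
Qed.

Lemma slides_add0 m : slides J m [set 0] e -> slides J (0 :: m) [set 0] e.
Proof.
move=> sl i im; have i0 := ideal_zero A; have l := @kd_linear A m.
have sS j : is_submod (shift_deg (kdeg (A := A) (size m)) j).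
  by apply/submod_shift/submod_kdeg.
have -> : kcyc (0 :: m) [set 0] i = [set f | kcyc m [set 0] i f.1 /\
    [set g | shift_deg (kdeg (size m)) i g /\ kd g = 0] f.2].
  apply/seteqP; split=> -[u v] /=.
    move=> /kcyc0 /= [[du dv]]; rewrite scale0r addr0 => -[ku /eqP].
    by rewrite oppr_eq0 => /eqP kv; split=> //; apply/kcyc0.
  by move=> [/kcyc0 [du ku] [dv kv]]; apply/kcyc0; rewrite /= ku kv scale0r addr0 oppr0.
apply: cdepth_prod => //.
- exact: submod_kdeg.
- exact: submod_kcyc.
- exact: (submod_setI (sS i) (submod_preimage l (submod_zero _))).
- by move=> f [].
- by move=> f [].
- have [ism|] := leqP i (size m); first by apply: cdepthW (sl i ism); rewrite leq_sub2l.
  move=> mi; apply: cdepth_trivial; [exact: submod_kdeg|exact: submod_kcyc|].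
  by move=> f /(kdeg_big mi) ->; exact: (submod0 (submod_kcyc _ _ _)).
- case: i im => [|i] im.
    apply: cdepth_trivial => //; first exact: (submod_setI (sS 0%N) (submod_preimage l (submod_zero _))).
    by move=> f -> /=; split=> //; apply: lin0.
  have := sl i im; rewrite addnS subSS; congr cdepth.
  by apply/seteqP; split=> f /kcyc0.
Qed.

(** With first generator 0, the chains divisible by the first basis vector form a direct summand, a
    copy of the complex of [m] shifted by one degree. *)
Lemma slides_remove0 m : slides J (0 :: m) [set 0] e -> slides J m [set 0] e.
Proof.
move=> sl i im; have i0 := ideal_zero A; have l := @kd_linear A m.
have := sl i.+1 im; rewrite /= addnS subSS.
apply: (@cdepth_retract _ _ _ (KV A (size m).+1) (fun v => (0, v)) snd) => //.
- by move=> a u v; congr pair; rewrite /= scaler0 addr0.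
- exact: submod_kcyc.
- by move=> v dv; split=> //; exact: (submod0 (submod_kdeg (size m) i.+1)).
- move=> v /kcyc0 [dv kv]; apply/kcyc0; split=> /=.
    by split=> //; exact: (submod0 (submod_kdeg (size m) i.+1)).
  by rewrite kv (lin0 l) scale0r addr0 oppr0.
- by move=> [u v] /= [].
- move=> [u v] /kcyc0 /= [[_ dv] [_ /eqP]]; rewrite oppr_eq0 => /eqP kv.
  exact/kcyc0.
- by move=> v _; rewrite subrr; exact: (submod0 (submod_kcyc _ _ _)).
Qed.

(** Redundant generators are adjoined to pass from [m] to [a ++ m], and then the elements of [m],
    redundant in turn, are removed. *)
Lemma slides_change m a : (forall x, x \in a -> spanned m x) ->
  (forall x, x \in m -> spanned a x) -> slides J m [set 0] e -> slides J a [set 0] e.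
Proof.
move=> am ma sl.
have sub (s t : seq A) x : (forall y, y \in s -> spanned t y) -> spanned s x -> spanned t x.
  move=> st [h ->]; apply: (@dot_mem _ s (spanned t) h) => //; exact: dot_ideal.
have {}sl : slides J (a ++ m) [set 0] e.
  elim: a am {ma} => [|b a IH] am //=; have {IH} IH : slides J (a ++ m) [set 0] e.
    by apply: IH => x xa; apply: am; rewrite inE xa orbT.
  apply: slides_iso (slides_add0 IH); apply/koszul_cycle_iso/koszul_iso_sym/koszul_iso_spanned.
  apply: (sub m); last by apply: am; rewrite mem_head.
  by move=> y ym; apply: mem_dot; rewrite mem_cat ym orbT.
have {}sl : slides J (m ++ a) [set 0] e.
  by apply: slides_iso sl; apply/koszul_cycle_iso/koszul_iso_cat.
elim: m ma sl {am} => [|b m IH] ma //= sl; apply: IH.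
  by move=> x xm; apply: ma; rewrite inE xm orbT.
apply: slides_remove0; apply: slides_iso sl; apply/koszul_cycle_iso/koszul_iso_spanned.
apply: (sub a); last by apply: ma; rewrite mem_head.
by move=> y ya; apply: mem_dot; rewrite mem_cat ya orbT.
Qed.

Lemma cdepth_cycles m i : slides J m [set 0] e -> (i <= size m)%N ->
  cdepth J (kcyc m [set 0] i) [set 0] (minn e (e + i - size m).+1).
Proof.
move=> sl im; apply: (@cdepth_sub _ _ _ (kdeg (size m) i)).
- exact/submod_kcyc/ideal_zero.
- by move=> f [].
- by move=> _ ->; exact: (submod0 (submod_kcyc _ _ (ideal_zero A))).
- apply: cdepthW (geq_minl _ _) _.
  have := cdepth_free (n := size m) (i := i) (ideal_zero A) d0; congr cdepth.
  apply/seteqP; split=> f; first by move=> [_ /kcoef0].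
  by move=> ->; split; [exact: (submod0 (submod_kdeg _ _))|apply/kcoef0].
- by apply: cdepthW (sl i im); rewrite -ltnS; case: minn (geq_minr e (e + i - size m).+1).
Qed.

Lemma cdepth_boundaries m i : slides J m [set 0] e -> (i < size m)%N ->
  cdepth J (kbnd m i) [set 0] (e + i.+1 - size m).
Proof.
move=> sl im; have := sl i.+1 im.
apply: (@cdepth_image _ _ _ _ (@kd A m)).
- exact: kd_linear.
- exact: submod_kdeg.
- exact: submod_zero.
- by move=> v dv; exists v.
- by move=> v dv kv; apply/kcyc0.
- by move=> v /kcyc0 [].
- by move=> _ [g dg <-]; exists g => //; rewrite subrr.
Qed.

Lemma kbnd_sub m i : kbnd m i `<=` kcyc m [set 0] i.
Proof.
by move=> _ [g dg <-]; apply/kcyc0; split; [exact: (kd_deg dg)|exact: kd_kd].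
Qed.

(** H_i = Z_i / B_i, where Z_i is a submodule of the free F_i and B_i is isomorphic to F_{i+1} /
    Z_{i+1}. The bound for B_i is one better than needed, which makes up for the loss in passing to
    a quotient. *)
Lemma cdepth_homology m i : slides J m [set 0] e ->
  cdepth J (kcyc m [set 0] i) (kbnd m i) (e + i - size m).
Proof.
move=> sl; have i0 := ideal_zero A.
have sB := @submod_kbnd m i; have sZ := submod_kcyc m i i0.
have s0 := submod_zero (KV A (size m)).
have [im|mi] := leqP i (size m); last first.
  by apply: cdepth_trivial => // f [/(kdeg_big mi) -> _]; apply: submod0.
have [le_n|lt_n] := leqP (size m) (e + i); last first.
  by move/ltnW: lt_n; rewrite -subn_eq0 => /eqP ->.
apply: (@cdepth_quo _ _ _ _ _ [set 0]) => //.
- exact: kbnd_sub.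
- by move=> _ ->; apply: submod0.
- apply: cdepthW (cdepth_cycles sl im).
  by rewrite leq_min leqnSn andbT leq_subLR addnC leq_add2r.
- move: im; rewrite leq_eqVlt => /orP[/eqP im|im]; last first.
    by apply: cdepthW (cdepth_boundaries sl im); rewrite addnS subSn.
  apply: cdepth_trivial => // _ [g dg <-] /=; rewrite (kdeg_big _ dg) ?im //.
  exact: (lin0 (@kd_linear A m)).
Qed.

(* Filtration of the chains by the conditions [f.2 = 0] modulo cycles, then   *)
(* [f.2] a boundary, then [f.2] a cycle.                                      *)
Lemma slides_cons x m :
  (forall i f, kdeg (size m) i f -> kd f = 0 -> kbnd m i (x *: f) -> kbnd m i f) ->
  slides J m [set 0] e -> slides J (x :: m) [set 0] e.
Proof.
move=> xreg sl i im; have i0 := ideal_zero A; have l := @kd_linear A m.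
case: i im => [|i] im.
  apply: cdepth_trivial; [exact: submod_kdeg|exact: submod_kcyc|].
  by move=> f df; apply/kcyc0; split=> //; exact: (kd_deg df).
rewrite ltnS in im; set t := (e + i.+1 - size (x :: m))%N.
have et : t = (e + i - size m)%N by rewrite /t /= addnS subSS.
have sB := @submod_kbnd m i; have sZ := submod_kcyc m i i0.
have sD j : is_submod (@kdeg A (size m) j) by exact: submod_kdeg.
have sC := submod_kcyc (x :: m) i.+1 i0.
pose W : set (KV A (size m).+1) := [set f | kdeg (size m) i.+1 f.1 /\ kcyc m [set 0] i f.2].
pose W' : set (KV A (size m).+1) := [set f | kdeg (size m) i.+1 f.1 /\ kbnd m i f.2].
have sW : is_submod W by apply: submod_prod.
have sW' : is_submod W' by apply: submod_prod.
have W'W : W' `<=` W by move=> f [? /kbnd_sub].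
(* If (u, v) is a cycle then x v = - du is a boundary, so by [xreg] the cycle v is a boundary. *)
have CW' : kcyc (x :: m) [set 0] i.+1 `<=` W'.
  move=> [u v] /kcyc0 /= [[du dv] [ku /eqP]]; rewrite oppr_eq0 => /eqP kv.
  split=> //; apply: xreg => //; exists (- u); first exact: submodN.
  by rewrite (linN l); apply/eqP; rewrite eq_sym -addr_eq0 addrC ku.
apply: (@cdepth_ext _ _ _ _ W) => //.
- exact: submod_kdeg.
- by move=> [u v] /= [? []].
- by move=> f /CW' /W'W.
- apply: (@cdepth_ext _ _ _ _ W') => //.
  + apply: (@cdepth_image _ _ (KV A (size m)) (KV A (size m).+1) (fun v => (v, 0)) (kdeg (size m) i.+1) (kcyc m [set 0] i.+1)) => //.
    * by move=> a u v; congr pair; rewrite /= scaler0 addr0.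
    * by move=> v dv; split=> //; apply: submod0.
    * by move=> v dv /kcyc0 /= [_ [kv _]]; apply/kcyc0; split=> //; move: kv; rewrite scaler0 addr0.
    * move=> v /kcyc0 [dv kv]; apply/kcyc0; split=> /=; first by split=> //; apply: submod0.
      by rewrite kv (lin0 l) scaler0 addr0 oppr0.
    * move=> [u w] /= [du [g dg /= gw]]; subst w; exists (u + x *: g); first by apply: submodD => //; apply: submodZ.
      apply/kcyc0; split=> /=.
        by split; [apply: submodB => //; apply: submodD => //; apply: submodZ|rewrite subr0; exact: (kd_deg dg)].
      by rewrite !subr0 kd_kd oppr0 opprD addNKr (linN l) (linZ l) addNr.
    * have [lt_im|] := ltnP i (size m).
        by apply: cdepthW (sl i.+1 lt_im); rewrite et leq_sub2r // addnS leqnSn.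
      move=> mi; apply: cdepth_trivial; [exact: submod_kdeg|exact: submod_kcyc|].
      by move=> f /(kdeg_big (mi : (size m < i.+1)%N)) ->; exact: (submod0 (submod_kcyc _ _ _)).
  + apply: (@cdepth_image _ _ (KV A (size m)) (KV A (size m).+1) (fun v => (0, v)) (kcyc m [set 0] i) (kbnd m i)) => //.
    * by move=> a u v; congr pair; rewrite /= scaler0 addr0.
    * by move=> v dv; split=> //; apply: submod0.
    * by move=> v dv [].
    * by move=> v dv; split=> //; apply: submod0.
    * by move=> [u v] /= [du dv]; exists v => //; split=> /=; rewrite ?subr0 ?subrr //; apply: submod0.
    * by rewrite et; apply: cdepth_homology.
- apply: (@cdepth_image _ _ (KV A (size m)) (KV A (size m).+1) (fun v => (0, v)) (kdeg (size m) i) (kcyc m [set 0] i)) => //.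
  + by move=> a u v; congr pair; rewrite /= scaler0 addr0.
  + by move=> v dv; split=> //; apply: submod0.
  + by move=> v dv [].
  + by move=> v dv; split=> //; apply: submod0.
  + by move=> [u v] /= [du dv]; exists v => //; split=> /=; rewrite ?subr0 ?subrr //; apply: submod0.
  + by rewrite et; apply: sl.
Qed.
End Slides.

(** The case in view is a variable [x] absent from [m], with [pi] setting it to 0. If x f = dg,
    write g = pi g + x v; then d (pi g) = pi (x f) = 0, so x f = x dv and f = dv. *)
Lemma retraction_reg (x : A) (pi : {rmorphism A -> A}) m :
  (forall z, x * z = 0 -> z = 0) -> pi x = 0 -> (forall a, exists b, a = pi a + x * b) ->
  (forall y, y \in m -> pi y = y) ->
  forall i f, kdeg (size m) i f -> kd f = 0 -> kbnd m i (x *: f) -> kbnd m i f.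
Proof.
move=> xreg pix piE pim i f df kf [g dg gf].
pose fix kpi n : KV A n -> KV A n := match n return KV A n -> KV A n with
  | 0%N => pi | n'.+1 => fun f => (kpi n' f.1, kpi n' f.2) end.
have kpi0 n (u : KV A n) : kpi n (x *: u) = 0.
  elim: n u => [|n IH] u /=; first by rewrite /GRing.scale /= rmorphM pix mul0r.
  by rewrite !IH.
have kpiB n : {morph kpi n : u v / u + v}.
  by elim: n => [|n IH] u v /=; [exact: rmorphD|rewrite !IH].
have kpiZ n a u : kpi n (a *: u) = pi a *: kpi n u.
  by elim: n u => [|n IH] u /=; [exact: rmorphM|rewrite !IH].
have kpiN n u : kpi n (- u) = - kpi n u.
  by elim: n u => [|n IH] u /=; [exact: rmorphN|rewrite !IH].
have kpi_kd m' (u : KV A (size m')) : (forall y, y \in m' -> pi y = y) ->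
    kpi _ (kd u) = kd (kpi _ u).
  elim: m' u => [|y m' IH] u fix_m' /=; first exact: rmorph0.
  have fix_m z : z \in m' -> pi z = z by move=> zm; apply: fix_m'; rewrite inE zm orbT.
  by rewrite kpiB kpiZ kpiN !IH // fix_m' ?mem_head.
have split_kpi n j (u : KV A n) : kdeg n j u ->
    exists2 v, kdeg n j v & u = kpi n u + x *: v.
  elim: n j u => [|n IH] j u /=.
    move=> [->|->]; first by have [b e] := piE u; exists b; [left|].
    by exists 0; [right|rewrite rmorph0 scaler0 addr0].
  case: u => u0 u1 /= [/IH [v0 d0 {1}->] d1].
  have [v1 d1' {1}->] : exists2 v1, shift_deg (kdeg n) j v1 & u1 = kpi n u1 + x *: v1.
    case: j d1 {d0} => [|j] /= d1; last exact: IH.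
    by exists 0 => //; have := kpi0 n 0; rewrite d1 !scaler0 addr0 => ->.
  by exists (v0, v1).
have [v dv gE] := split_kpi _ _ _ dg; exists v => //.
have kv : x *: f = x *: kd v.
  have e0 : kd (kpi _ g) = 0 by rewrite -kpi_kd // gf kpi0.
  by rewrite -gf gE (linD (@kd_linear A m)) e0 add0r (linZ (@kd_linear A m)).
have xregV n (u : KV A n) : x *: u = 0 -> u = 0.
  elim: n u => [|n IH] u /=; first exact: xreg.
  by case: u => u0 u1 [/IH -> /IH ->].
by apply/esym/eqP; rewrite -subr_eq0; apply/eqP/xregV; rewrite scalerBr kv subrr.
Qed.

End KoszulZero.

Arguments kbnd {A}.

(** * Primes, heights and regular sequences *)

(** Propositional membership, for lists of sets and of primes without an [eqType] structure. *)
Fixpoint inL (T : Type) (x : T) (s : seq T) : Prop :=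
  if s is y :: s' then y = x \/ inL x s' else False.

Section Primes.
Variable A : comNzRingType.
Implicit Types (I K : set A) (p q : spec A).

Lemma idealT0 I : is_ideal I -> I 0. Proof. by case. Qed.
Lemma idealD I x y : is_ideal I -> I x -> I y -> I (x + y).
Proof. by case=> _ + _; apply. Qed.
Lemma idealM_l I a x : is_ideal I -> I x -> I (a * x).
Proof. by case=> _ _; apply. Qed.
Lemma idealM_r I a x : is_ideal I -> I x -> I (x * a).
Proof. by rewrite mulrC; apply: idealM_l. Qed.
Lemma idealN I x : is_ideal I -> I x -> I (- x).
Proof. by rewrite -mulN1r; apply: idealM_l. Qed.
Lemma idealB I x y : is_ideal I -> I x -> I y -> I (x - y).
Proof. by move=> iI Ix Iy; apply: idealD => //; apply: idealN. Qed.

Lemma spec_is_ideal p : is_ideal p. Proof. by case: (specP p). Qed.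
Lemma spec_proper p : ~ (p : set A) 1. Proof. by case: (specP p). Qed.
Lemma spec_mul p x y : (p : set A) (x * y) -> (p : set A) x \/ (p : set A) y.
Proof. by case: (specP p) => _ _; apply. Qed.
Lemma spec_mulN p x y : ~ (p : set A) x -> ~ (p : set A) y -> ~ (p : set A) (x * y).
Proof. by move=> nx ny /spec_mul []. Qed.
Lemma spec_exp p x n : (p : set A) (x ^+ n) -> (p : set A) x.
Proof.
elim: n => [|n IH]; first by rewrite expr0 => /spec_proper.
by rewrite exprS => /spec_mul [|/IH].
Qed.

Lemma ideal_principal_add I x : is_ideal I ->
  is_ideal [set y | exists a b, I a /\ y = a + b * x].
Proof.
move=> iI; split.
- by exists 0, 0; split; [exact: idealT0|rewrite mul0r addr0].
- move=> _ _ [a [b [Ia ->]]] [c [e [Ic ->]]]; exists (a + c), (b + e).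
  by split; [exact: idealD|rewrite mulrDl addrACA].
- move=> r _ [a [b [Ia ->]]]; exists (r * a), (r * b).
  by split; [exact: idealM_l|rewrite mulrDr mulrA].
Qed.

Section Avoiding.
Variables (I S : set A).
Hypotheses (iI : is_ideal I) (S1 : S 1) (SM : forall x y, S x -> S y -> S (x * y)).
Hypothesis IS : forall x, I x -> S x -> False.

Lemma maximal_avoiding : exists p : spec A,
  [/\ I `<=` p, (forall x, (p : set A) x -> S x -> False) &
      forall K, is_ideal K -> p `<=` K -> (forall x, K x -> S x -> False) -> K = p].
Proof.
pose T := {K : set A | [/\ is_ideal K, I `<=` K & forall x, K x -> S x -> False]}.
pose R (x y : T) : bool := `[< sval x `<=` sval y >].
have [||||[P [iP IP PS]] Pmax] := @Zorn T R.
- by move=> x; apply/asboolP.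
- by move=> x y z /asboolP xy /asboolP yz; apply/asboolP => a /xy/yz.
- move=> [x hx] [y hy] /asboolP /= xy /asboolP /= yx.
  have exy : x = y by apply/seteqP.
  by subst y; congr exist; apply: Prop_irrelevance.
- move=> C Ctot; have [[c0 C0]|nC] := pselect (exists c, C c); last first.
    have hI : [/\ is_ideal I, I `<=` I & forall x, I x -> S x -> False] by split.
    by exists (exist _ I hI) => s Cs; case: nC; exists s.
  pose U : set A := [set a | exists2 c : T, C c & sval c a].
  have hU : [/\ is_ideal U, I `<=` U & forall x, U x -> S x -> False].
    split.
    - split; first by exists c0 => //; case: (svalP c0) => /idealT0.
      + move=> x y [c Cc cx] [c' Cc' cy]; have [/asboolP h|/asboolP h] := Ctot _ _ Cc Cc'.
          by exists c' => //; apply: idealD => //; [case: (svalP c')|exact: h].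
        by exists c => //; apply: idealD => //; [case: (svalP c)|exact: h].
      + by move=> a x [c Cc cx]; exists c => //; apply: idealM_l => //; case: (svalP c).
    - by move=> x Ix; exists c0 => //; case: (svalP c0) => _ h _; apply: h.
    - by move=> x [c Cc cx]; case: (svalP c) => _ _ h; apply: h.
  by exists (exist _ U hU) => s Cs; apply/asboolP => a sa; exists s.
have Pmax' K : is_ideal K -> P `<=` K -> (forall x, K x -> S x -> False) -> K = P.
  move=> iK PK KS; have hK : [/\ is_ideal K, I `<=` K & forall x, K x -> S x -> False].
    by split=> // x /IP/PK.
  by have /(_ _)/(congr1 sval) := Pmax (exist _ K hK); apply; apply/asboolP.
have prP : is_prime P.
  split=> //; first by move=> /PS; apply.
  move=> x y Pxy; apply: contrapT => /not_orP [nx ny].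
  have meetS z : ~ P z -> exists a b, P a /\ S (a + b * z).
    move=> nz; apply: contrapT => H; apply: nz.
    rewrite -(Pmax' [set y | exists a b, P a /\ y = a + b * z]).
    - by exists 0, 1; split; [exact: idealT0|rewrite add0r mul1r].
    - exact: ideal_principal_add.
    - by move=> a Pa; exists a, 0; split=> //; rewrite mul0r addr0.
    - by move=> _ [a [b [Pa ->]]] Sab; apply: H; exists a, b.
  have [a [b [Pa Sa]]] := meetS _ nx; have [c [e [Pc Sc]]] := meetS _ ny.
  apply: (PS _ _ (SM Sa Sc)); rewrite mulrDl; apply: idealD => //; first exact: idealM_r.
  rewrite mulrDr; apply: idealD => //; first exact: idealM_l.
  by rewrite mulrACA; apply: idealM_l.
by exists (Spec prP); split.
Qed.
End Avoiding.

Lemma exists_maximal I : is_ideal I -> ~ I 1 -> exists2 p : spec A, is_maximal p & I `<=` p.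
Proof.
move=> iI nI; have [|x y -> ->|x Ix x1|p [Ip pS pmax]] := @maximal_avoiding I [set 1] iI.
- by [].
- by rewrite /= mulr1.
- by apply: nI; rewrite -x1.
exists p => // K iK pK nK; apply: pmax => // x Kx x1; apply: nK; by rewrite -x1.
Qed.

(** Zorn's lemma for the multiplicative set of the products s x^n with s outside [p]; as x cancels
    modulo [I], the ideal [I] misses it. This extends chains of primes at their lower end. *)
Lemma prime_below I p x : is_ideal I ->
  (forall s, ~ (p : set A) s -> ~ I s) -> (forall s, I (s * x) -> I s) ->
  exists q : spec A, [/\ I `<=` q, q `<=` p & ~ (q : set A) x].
Proof.
move=> iI Ip xreg.
pose S : set A := [set y | exists s n, ~ (p : set A) s /\ y = s * x ^+ n].
have [||y Iy [s [n [ns ye]]]|q [Iq qS _]] := @maximal_avoiding I S iI.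
- by exists 1, 0%N; split; [exact: spec_proper|rewrite mulr1].
- move=> _ _ [s [n [ns ->]]] [t [m [nt ->]]]; exists (s * t), (n + m)%N.
  by split; [exact: spec_mulN|rewrite exprD mulrACA].
- apply: (Ip s ns); rewrite ye in Iy; elim: n Iy {ye} => [|n IH]; first by rewrite mulr1.
  by rewrite exprSr mulrA => /xreg.
exists q; split=> // [a qa|qx].
  by apply: contrapT => npa; apply: (qS a qa); exists a, 0%N; rewrite mulr1.
by apply: (qS x qx); exists 1, 1%N; split; [exact: spec_proper|rewrite mul1r].
Qed.

Lemma prime_height0 p : prime_height_ge p 0.
Proof. by exists (fun=> p). Qed.

Lemma prime_heightW p n m : (m <= n)%N -> prime_height_ge p n -> prime_height_ge p m.
Proof.
move=> mn [c [ch cn]]; exists (fun i => c (i + (n - m))%N); split.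
  by move=> i im; apply: ch; rewrite -{2}(subnKC mn) ltn_add2r.
by rewrite subnKC.
Qed.

Lemma properP (X Y : set A) x : X `<=` Y -> Y x -> ~ X x -> X `<` Y.
Proof. by move=> XY Yx nX; split=> // YX; apply/nX/YX. Qed.

Lemma prime_heightS p q x n : q `<=` p -> (p : set A) x -> ~ (q : set A) x ->
  prime_height_ge q n -> prime_height_ge p n.+1.
Proof.
move=> qp px qx [c [ch cn]]; exists (fun i => if (i <= n)%N then c i else p); split.
  move=> i; rewrite ltnS leq_eqVlt => /orP[/eqP ->|lin].
    by rewrite eqxx ltnn cn; apply: properP px qx.
  by rewrite lin orbT; apply: ch.
by rewrite ltnn.
Qed.

Lemma prime_height_sub p q n : q `<=` p -> prime_height_ge q n -> prime_height_ge p n.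
Proof.
move=> qp hq; have [pq|] := pselect (p `<=` q); last first.
  move=> /existsNP [x /not_implyP [px nqx]].
  exact: (prime_heightW (leqnSn n)) (prime_heightS qp px nqx hq).
have e : (p : set A) = q by apply/seteqP.
by case: hq => c [ch cn]; exists c; rewrite cn e.
Qed.

Lemma is_ideal_scaled_add I x : is_ideal I -> is_ideal (scaled_add (V := A^o) I x setT).
Proof. move=> iI; exact: (@submod_scaled_add A A^o setT I x (submodT _) iI). Qed.

Lemma scaled_add_ideal I x y :
  scaled_add (V := A^o) I x setT y <-> exists a b, I a /\ y = a + b * x.
Proof.
split=> [[a [_ [Ia [b _ <-] ->]]]|[a [b [Ia ->]]]].
  by exists a, b; split=> //; rewrite /GRing.scale /= mulrC.
by exists a, (x * b); split; rewrite // mulrC //; exists b => //; rewrite mulrC.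
Qed.

Fixpoint regular (V : lmodType A) (Z B : set V) (xs : seq A) : Prop :=
  if xs is x :: xs' then
    (forall z, Z z -> B (x *: z) -> B z) /\ regular Z (scaled_add B x Z) xs'
  else True.

Lemma scaled_addS (V : lmodType A) (Z B : set V) x : is_submod Z -> B `<=` scaled_add B x Z.
Proof.
by move=> sZ b Bb; exists b, 0; rewrite addr0; split=> //; exists 0; [exact: submod0|rewrite scaler0].
Qed.

Lemma add_scaled_nil (V : lmodType A) (Z B : set V) : add_scaled Z B [::] = B.
Proof.
apply/seteqP; split=> [v [b [w [Bb _ ->]]]|b Bb]; first by rewrite big_ord0 addr0.
by exists b, (fun=> 0); split; rewrite ?big_ord0 ?addr0 //; case.
Qed.

Lemma add_scaled_cons (V : lmodType A) (Z B : set V) x xs :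
  add_scaled Z B (x :: xs) = add_scaled Z (scaled_add B x Z) xs.
Proof.
apply/seteqP; split=> v.
  move=> [b [w [Bb Zw ->]]]; rewrite big_ord_recl /=.
  exists (b + x *: w ord0), (fun j => w (lift ord0 j)); split=> //; last by rewrite addrA.
  by exists b, (x *: w ord0); split=> //; exists (w ord0).
move=> [_ [w [[b [_ [Bb [z Zz <-] ->]]] Zw ->]]].
exists b, (fun j => if unlift ord0 j is Some j' then w j' else z); split=> //.
  by move=> j; case: unliftP.
rewrite big_ord_recl unlift_none addrA; congr (_ + _).
by apply: eq_bigr => j _; rewrite liftK.
Qed.

Lemma regular_seqE (V : lmodType A) (Z B : set V) xs :
  (forall j, (j < size xs)%N -> forall z, Z z ->
     add_scaled Z B (take j xs) (xs`_j *: z) -> add_scaled Z B (take j xs) z)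
  <-> regular Z B xs.
Proof.
elim: xs B => [|x xs IH] B /=; first by split.
split.
  move=> h; split; first by have := h 0%N isT; rewrite take0 add_scaled_nil.
  by apply/IH => j jx z Zz; have := h j.+1 jx z Zz; rewrite /= add_scaled_cons.
move=> [h0 /IH h] [|j] jx z Zz /=; first by rewrite add_scaled_nil; apply: h0.
by rewrite add_scaled_cons; apply: h.
Qed.

(** Each regular element lies in the lowest prime found so far, and [prime_below] gives a smaller
    prime avoiding it. So the depth of a quotient is at most its dimension. *)
Lemma regular_chain I xs p : is_ideal I -> regular (V := A^o) setT I xs ->
  add_scaled (V := A^o) setT I xs `<=` p ->
  exists q : spec A, [/\ I `<=` q, q `<=` p &
    exists c, [/\ prime_chain (size xs) c, c 0%N = q & (c (size xs) : set A) = p]].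
Proof.
elim: xs I => [|x xs IH] I iI /=.
  rewrite add_scaled_nil => _ Ip; exists p; split=> //.
  by exists (fun=> p).
move=> [xreg reg]; rewrite add_scaled_cons => sub.
have [q [Iq qp [c [ch c0 cn]]]] := IH _ (is_ideal_scaled_add x iI) reg sub.
have Iq' : I `<=` q by move=> a Ia; apply/Iq/scaled_addS.
have qx : (q : set A) x by apply/Iq/scaled_add_ideal; exists 0, 1; rewrite add0r mul1r; split=> //; exact: idealT0.
have [|s|q' [Iq'' qq' nx]] := @prime_below I q x iI.
- by move=> s nqs Is; apply/nqs/Iq'.
- by rewrite mulrC; apply: xreg.
exists q'; split=> //; first by move=> a /qq'/qp.
exists (fun i => if i is i'.+1 then c i' else q'); split=> //.
case=> [|i] ilt; last exact: ch.
by rewrite c0; apply: properP qx nx.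
Qed.

Lemma chain_height n (c : nat -> spec A) m : prime_chain n c -> prime_height_ge (c 0%N) m ->
  prime_height_ge (c n) (m + n).
Proof.
elim: n => [|n IH] ch h0; first by rewrite addn0.
have [sub /existsNP [x /not_implyP [px nqx]]] := ch n (ltnSn n).
rewrite addnS; apply: (prime_heightS sub px nqx).
by apply: IH => // i ilt; apply: ch; apply: ltnW.
Qed.
End Primes.

(** * Noetherian modules, associated primes, prime avoidance and Nakayama's lemma *)

Section Noetherian.
Variable A : comNzRingType.

Section Span.
Variable V : lmodType A.
Implicit Types (N : set V) (s : seq V).

Fixpoint span s : set V :=
  if s is x :: s' then [set v | exists a w, span s' w /\ v = a *: x + w] else [set 0].

Lemma submod_span s : is_submod (span s).
Proof.
elim: s => [|x s IH] /=; first exact: submod_zero.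
split.
- by exists 0, 0; split; [exact: submod0|rewrite scale0r addr0].
- move=> _ _ [a [v [sv ->]]] [b [w [sw ->]]]; exists (a + b), (v + w).
  by split; [exact: submodD|rewrite scalerDl addrACA].
- move=> c _ [a [v [sv ->]]]; exists (c * a), (c *: v).
  by split; [exact: submodZ|rewrite scalerDr scalerA].
Qed.

Lemma mem_span s x : inL x s -> span s x.
Proof.
elim: s => //= y s IH [->|/IH sx].
  by exists 1, 0; split; [exact: (submod0 (submod_span s))|rewrite scale1r addr0].
by exists 0, x; rewrite scale0r add0r.
Qed.

Lemma span_sub s N : is_submod N -> (forall x, inL x s -> N x) -> span s `<=` N.
Proof.
move=> sN; elim: s => [|x s IH] sNx v /=; first by move=> ->; apply: submod0.
move=> [a [w [sw ->]]]; apply: submodD => //.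
  by apply: submodZ => //; apply: sNx; left.
by apply: IH => // y ys; apply: sNx; right.
Qed.

Lemma inL_cat (T : Type) (x : T) (s t : seq T) :
  inL x (s ++ t) <-> inL x s \/ inL x t.
Proof. by elim: s => [|y s IH] /=; [split=> [|[]]; auto|rewrite IH; tauto]. Qed.

Definition noetherian : Prop :=
  forall N, is_submod N -> exists2 s, (forall x, inL x s -> N x) & N `<=` span s.

Lemma noetherian_maximal (F : set (set V)) : noetherian ->
  (forall N, F N -> is_submod N) -> (exists N, F N) ->
  exists2 N, F N & forall N', F N' -> N `<=` N' -> N' `<=` N.
Proof.
move=> noe sF [N0 FN0]; apply: contrapT => H.
have step (N : {N | F N}) : exists N' : {N | F N}, sval N `<=` sval N' /\ ~ (sval N' `<=` sval N).
  apply: contrapT => H'; apply: H; exists (sval N); first exact: svalP.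
  move=> N' FN' NN'; apply: contrapT => nN'.
  by apply: H'; exists (exist _ N' FN').
have [nxt nxtP] := choice step.
pose c n := iter n nxt (exist _ N0 FN0).
have cmono i j : (i <= j)%N -> sval (c i) `<=` sval (c j).
  elim: j => [|j IH]; first by rewrite leqn0 => /eqP ->.
  rewrite leq_eqVlt => /orP[/eqP -> //|]; rewrite ltnS => /IH h v /h.
  by case: (nxtP (c j)) => + _; apply.
pose U : set V := [set v | exists n, sval (c n) v].
have sU : is_submod U.
  split; first by exists 0%N; exact: (submod0 (sF _ FN0)).
  - move=> x y [n cx] [m cy]; exists (maxn n m).
    apply: submodD; first exact/sF/svalP.
      by apply: cmono cx; rewrite leq_maxl.
    by apply: cmono cy; rewrite leq_maxr.
  - by move=> a x [n cx]; exists n; apply: submodZ => //; exact/sF/svalP.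
have [s sUx Us] := noe _ sU.
have [n cn] : exists n, forall x, inL x s -> sval (c n) x.
  elim: s sUx {Us} => [|x s IH] sUx; first by exists 0%N.
  have [|n cn] := IH; first by move=> y ys; apply: sUx; right.
  have [m cm] := sUx x (or_introl erefl); exists (maxn n m) => y /= [<-|ys].
    by apply: cmono cm; rewrite leq_maxr.
  by apply: cmono (cn _ ys); rewrite leq_maxl.
case: (nxtP (c n)) => _; apply => v cv.
apply: (span_sub _ cn); first exact/sF/svalP.
by apply: Us; exists n.+1.
Qed.

Definition ann (B : set V) (v : V) : set A := [set a | B (a *: v)].

Lemma ideal_ann B v : is_submod B -> is_ideal (ann B v).
Proof.
move=> sB; split; rewrite /ann /=; first by rewrite scale0r; apply: submod0.
  by move=> x y; rewrite scalerDl; apply: submodD.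
by move=> a x Bx; rewrite -scalerA; apply: submodZ.
Qed.
End Span.

Lemma finite_witnesses (T U : Type) (s : seq T) (P : T -> U -> Prop) :
  (forall x, inL x s -> exists y, P x y) ->
  exists t : seq U, (forall y, inL y t -> exists2 x, inL x s & P x y) /\
                    (forall x, inL x s -> exists2 y, inL y t & P x y).
Proof.
elim: s => [|x s IH] H; first by exists [::].
have [|t [ts st]] := IH; first by move=> y ys; apply: H; right.
have [y Pxy] := H x (or_introl erefl); exists (y :: t); split.
  move=> z /= [<-|/ts [w ws Pw]]; first by exists x; auto.
  by exists w; auto.
by move=> z /= [<-|/st [w ws Pw]]; [exists y; auto|exists w; auto].
Qed.

Lemma spec_prod_out (p : spec A) (s : seq (set A)) :
  (forall I, inL I s -> is_ideal I /\ ~ (I `<=` p)) ->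
  exists2 r, ~ (p : set A) r & forall I, inL I s -> I r.
Proof.
elim: s => [|I s IH] H; first by exists 1 => //; apply: spec_proper.
have [|r nr rs] := IH; first by move=> K Ks; apply: H; right.
have [iI /existsNP [x /not_implyP [Ix npx]]] := H I (or_introl erefl).
exists (x * r); first exact: spec_mulN.
move=> K [<-|Ks]; first exact: (idealM_r _ iI Ix).
by apply: idealM_l; [case: (H K (or_intror Ks))|apply: rs].
Qed.

(* The maximal ones among the annihilators of nonzero elements of [Z / B].    *)
Lemma zero_divisor_primes (V : lmodType A) (Z B : set V) : noetherian V -> noetherian A^o ->
  is_submod Z -> is_submod B ->
  exists ps : seq (spec A),
    (forall p, inL p ps -> exists u, [/\ Z u, ~ B u & (p : set A) = ann B u]) /\
    (forall x z, Z z -> ~ B z -> B (x *: z) -> exists2 p, inL p ps & (p : set A) x).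
Proof.
move=> noeV noeA sZ sB.
pose M : set V := [set u | [/\ Z u, ~ B u & forall v, Z v -> ~ B v -> ann B u `<=` ann B v -> ann B v `<=` ann B u]].
have primeM u : M u -> is_prime (ann B u).
  move=> [Zu nBu mu]; split; first exact: ideal_ann.
    by rewrite /ann /= scale1r.
  move=> a b; rewrite /ann /= => Bab; apply: contrapT => /not_orP [na nb].
  have h : ann B u `<=` ann B (b *: u).
    by move=> c; rewrite /ann /= => Bcu; rewrite scalerA mulrC -scalerA; apply: submodZ.
  apply: na; apply: (mu (b *: u)) => //; first exact: submodZ.
  by rewrite /ann /= scalerA.
have below z : Z z -> ~ B z -> exists2 u, M u & ann B z `<=` ann B u.
  move=> Zz nBz.
  pose F : set (set A^o) := [set I | exists2 u, Z u /\ ~ B u & I = ann B u /\ ann B z `<=` I].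
  have [|| I [u [Zu nBu] [Iu zI]] Imax] := @noetherian_maximal A^o F noeA.
  - by move=> _ [u _ [-> _]]; apply: ideal_ann.
  - by exists (ann B z); exists z; split.
  exists u; last by rewrite -Iu.
  split=> // v Zv nBv uv; rewrite -Iu; apply: Imax; last by rewrite Iu.
  by exists v => //; split=> //; move=> a /zI; rewrite Iu => /uv.
(* The submodule generated by [B] and all elements with a maximal annihilator. Finite generation
   leaves finitely many such elements [s], whose annihilators turn out to be all the maximal
   ones. *)
pose N : set V := [set v | exists s, (forall x, inL x s -> M x) /\ exists2 w, span s w & B (v - w)].
have spanW (s t : seq V) w : (forall x, inL x s -> inL x t) -> span s w -> span t w.
  by move=> st; apply: span_sub; [apply: submod_span|move=> x /st; apply: mem_span].
have sN : is_submod N.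
  split.
  - by exists [::]; split=> //; exists 0 => //; rewrite subr0; apply: submod0.
  - move=> x y [s [sM [v sv Bv]]] [t [tM [w tw Bw]]]; exists (s ++ t); split.
      by move=> z /inL_cat [/sM|/tM].
    exists (v + w); last by rewrite opprD addrACA; apply: submodD.
    apply: submodD; first exact: submod_span.
      by apply: spanW sv => z zs; apply/inL_cat; left.
    by apply: spanW tw => z zs; apply/inL_cat; right.
  - move=> a x [s [sM [v sv Bv]]]; exists s; split=> //; exists (a *: v).
      by apply: submodZ => //; apply: submod_span.
    by rewrite -scalerBr; apply: submodZ.
have [t tN Nt] := noeV _ sN.
have [s sM sN'] : exists2 s, (forall x, inL x s -> M x) & forall v, N v -> exists2 w, span s w & B (v - w).
  suff [s sM H] : exists2 s, (forall x, inL x s -> M x) &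
      forall v, span t v -> exists2 w, span s w & B (v - w).
    by exists s => // v /Nt/H.
  elim: t tN {Nt} => [|x t IH] tN.
    exists [::] => // v -> ; exists 0 => //=; by rewrite subr0; apply: submod0.
  have [|s sM H] := IH; first by move=> y yt; apply: tN; right.
  have [s' [s'M [w s'w Bw]]] := tN x (or_introl erefl).
  exists (s' ++ s); first by move=> z /inL_cat [/s'M|/sM].
  move=> _ [a [v [/H [w' sw' Bw'] ->]]]; exists (a *: w + w').
    apply: submodD; first exact: submod_span.
      by apply: submodZ; [exact: submod_span|apply: spanW s'w => z zs; apply/inL_cat; left].
    by apply: spanW sw' => z zs; apply/inL_cat; right.
  rewrite opprD addrACA -scalerBr; apply: submodD => //; exact: submodZ.
have [|ps [ps1 ps2]] := @finite_witnesses V (spec A) s (fun u p => (p : set A) = ann B u).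
  by move=> u /sM/primeM pu; exists (Spec pu).
exists ps; split; first by move=> p /ps1 [u /sM [Zu nBu _] pu]; exists u.
move=> x z Zz nBz Bxz; have [u Mu zu] := below z Zz nBz.
have [w sw Buw] : exists2 w, span s w & B (u - w).
  apply: sN'; exists [:: u]; split; first by move=> y [<-|].
  exists u; last by rewrite subrr; apply: submod0.
  by exists 1, 0; rewrite scale1r addr0.
(* Otherwise a product [r] of elements, one from each [ann B v] and outside the prime [ann B u],
   would carry the span of [s], hence [u], into [B]. *)
have [v vs vu] : exists2 v, inL v s & ann B v `<=` ann B u.
  apply: contrapT => H.
  have [|ss [ss1 ss2]] := @finite_witnesses V (set A) s (fun v I => I = ann B v).
    by move=> v _; exists (ann B v).
  have [|r nr rs] := @spec_prod_out (Spec (primeM u Mu)) ss.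
    move=> _ /ss1 [v vs ->]; split; first exact: ideal_ann.
    by move=> h; apply: H; exists v.
  apply: nr; rewrite /= /ann /= -(subrK w u) scalerDr; apply: submodD => //.
    exact: submodZ.
  have : span s `<=` [set v | B (r *: v)].
    apply: span_sub; first by apply: submod_preimage => // a y1 y2; rewrite scalerDr !scalerA mulrC.
    by move=> v vs; have [I Is Iv] := ss2 _ vs; have := rs _ Is; rewrite Iv.
  exact.
have [p pps pv] := ps2 _ vs; exists p => //; rewrite pv.
have [Zv nBv mv] := sM _ vs; case: Mu => Zu nBu mu.
by apply: (mv u Zu nBu vu); apply: zu.
Qed.

Lemma minimal_in_list (ps : seq (spec A)) : ps <> [::] ->
  exists2 p, inL p ps & forall q, inL q ps -> q `<=` p -> p `<=` q.
Proof.
elim: ps => // p ps IH _; have [->|nz] := pselect (ps = [::]).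
  by exists p; [left|move=> q [<-|]].
have [q qps qmin] := IH nz.
have [pq|npq] := pselect (p `<=` q).
  exists p; first by left.
  move=> r [<- //|rps rp] x px; apply: (qmin r) => //; last exact: pq.
  by move=> y /rp/pq.
exists q; first by right.
by move=> r [<- /npq //|]; apply: qmin.
Qed.

(* Prime avoidance within the coset [b + T]; the sets [N p] need only be      *)
(* "[p]-primary" subgroups.                                                   *)
Lemma coset_avoidance (N : set A -> set A) (b : A) (T : set A) (ps : seq (spec A)) :
  is_ideal T ->
  (forall p, inL p ps -> N p 0 /\ (forall x y, N p x -> N p y -> N p (x - y))) ->
  (forall p r v, inL p ps -> (p : set A) r -> T v -> N p (r * v)) ->
  (forall p r v, inL p ps -> ~ (p : set A) r -> T v -> N p (r * v) -> N p v) ->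
  (forall p, inL p ps -> ~ (N p b /\ T `<=` N p)) ->
  exists2 v, T v & forall p, inL p ps -> ~ N p (b + v).
Proof.
move=> iT; move: {2}(size ps).+1 (ltnSn (size ps)) => n.
elim: n ps => // n IH ps; rewrite ltnS => sn N0 N1 N2 N3.
have [ps0|nz] := pselect (ps = [::]).
  by exists 0; [exact: idealT0|rewrite ps0].
have [p pps pmin] := minimal_in_list nz.
(* All entries contained in the minimal prime p, thus equal to it as sets, are dropped at once; the
   others are not contained in p, so some product of their elements lies outside p. *)
have [qs [qsps psqs sqs]] : exists qs : seq (spec A),
  [/\ forall q, inL q qs -> inL q ps /\ ~ (q `<=` p),
      forall q, inL q ps -> q `<=` p \/ inL q qs & (size qs < size ps)%N].
  have [qs [h1 h2 h3 h4]] : exists qs : seq (spec A),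
    [/\ forall q, inL q qs -> inL q ps /\ ~ (q `<=` p),
      forall q, inL q ps -> q `<=` p \/ inL q qs, (size qs <= size ps)%N &
      (inL p ps -> (size qs < size ps)%N)].
    elim: (ps) => [|q ss [qs [h1 h2 h3 h4]]]; first by exists [::].
    have [qp|nqp] := pselect (q `<=` p).
      exists qs; split=> //=.
      - by move=> r /h1 [? ?]; auto.
      - by move=> r [<-|/h2]; auto.
      - exact: leqW.
    exists (q :: qs); split=> //=.
    - by move=> r [<-|/h1 [? ?]]; auto.
    - by move=> r [->|/h2 [|]]; auto.
    - by move=> [e|/h4 //]; case: nqp; rewrite e.
  by exists qs; split=> //; apply: h4.
have [|||||v Tv Hv] := IH qs.
- exact: leq_trans sqs sn.
- by move=> q /qsps [/N0].
- by move=> q r v /qsps [/N1 h _]; apply: h.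
- by move=> q r v /qsps [/N2 h _]; apply: h.
- by move=> q /qsps [/N3].
have eqp q : inL q ps -> q `<=` p -> (q : set A) = p.
  by move=> qps qp; apply/seteqP; split=> //; apply: pmin.
have [Npv|nNpv] := pselect (N p (b + v)); last first.
  exists v => // q qps; have [qp|/Hv //] := psqs q qps.
  by rewrite (eqp q qps qp).
have [w Tw nNw] : exists2 w, T w & ~ N p w.
  apply: contrapT => H; apply: (N3 p pps).
  have TN : T `<=` N p by move=> w Tw; apply: contrapT => nw; apply: H; exists w.
  split=> //; rewrite -(addrK v b); case: (N0 p pps) => _; apply=> //; exact: TN.
have [|ss [ss1 ss2]] := @finite_witnesses (spec A) (set A) qs (fun q I => I = q :> set A).
  by move=> q _; exists (q : set A).
have [|r nr rs] := @spec_prod_out p ss.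
  by move=> _ /ss1 [q /qsps [_ nqp] ->]; split=> //; apply: spec_is_ideal.
(* As [r] lies in every prime of [qs], adding r w changes nothing there; as [r] is outside p and [w]
   outside N p, it moves b + v out of N p. *)
exists (v + r * w); first by apply: idealD => //; apply: idealM_l.
move=> q qps; have [qp|qqs] := psqs q qps.
  rewrite (eqp q qps qp) => h; apply: nNw; apply: (N2 p r w) => //.
  have -> : r * w = b + (v + r * w) - (b + v) by ring.
  by case: (N0 p pps) => _; apply.
have qr : (q : set A) r by have [I Is Iq] := ss2 q qqs; have := rs _ Is; rewrite Iq.
move=> h; apply: (Hv q qqs); have -> : b + v = b + (v + r * w) - r * w by ring.
by case: (N0 q qps) => _; apply=> //; apply: N1.
Qed.

(** Vanishing in degree 0 says that [J] kills no nonzero element of Z/B, so [J] lies in none of the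
    finitely many associated primes. *)
Lemma exists_regular (V : lmodType A) (J : set A) (Z B : set V) : noetherian V -> noetherian A^o ->
  is_ideal J -> is_submod Z -> is_submod B ->
  vanishes J Z B 0 -> exists2 x, J x & forall z, Z z -> B (x *: z) -> B z.
Proof.
move=> noeV noeA iJ sZ sB h.
have [ps [ps1 ps2]] := zero_divisor_primes noeV noeA sZ sB.
have [||||v Jv Hv] := @coset_avoidance id 0 J ps iJ.
- move=> p _; split; first exact: (idealT0 (spec_is_ideal p)).
  by move=> x y; apply: (idealB (spec_is_ideal p)).
- by move=> p r v _ pr _; apply: idealM_r => //; apply: spec_is_ideal.
- by move=> p r v _ npr _ /spec_mul [].
- move=> p /ps1 [u [Zu nBu pu]] [_ Jp]; apply: nBu.
  have [||g [_ Hg]] := h (fun=> u).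
  + by move=> s _.
  + by case=> [|x [|? ?]] //= -[Jx] // _; rewrite subr0; have := Jp x Jx; rewrite pu.
  by have := Hg [::] I; rewrite /= subr0.
exists v => // z Zz Bvz; apply: contrapT => nBz.
have [p pps pv] := ps2 _ _ Zz nBz Bvz.
by apply: (Hv p pps); rewrite add0r.
Qed.

Lemma cdepth_regular (V : lmodType A) (J : set A) (Z B : set V) t : noetherian V -> noetherian A^o ->
  is_ideal J -> is_submod Z -> is_submod B -> B `<=` Z ->
  cdepth J Z B t -> exists xs, [/\ size xs = t, (forall x, x \in xs -> J x) & regular Z B xs].
Proof.
move=> noeV noeA iJ sZ; elim: t B => [|t IH] B sB BZ d; first by exists [::].
have [x Jx xreg] := exists_regular noeV noeA iJ sZ sB (d 0%N isT).
have [||| xs [sxs Jxs rxs]] := IH (scaled_add B x Z).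
- exact: submod_scaled_add.
- move=> _ [b [_ [Bb [z Zz <-] ->]]]; apply: submodD => //; [exact: BZ|exact: submodZ].
- exact: cdepth_mod.
exists (x :: xs); split=> //=; first by rewrite sxs.
by move=> y; rewrite inE => /orP[/eqP ->|/Jxs].
Qed.

(** Noetherian induction: if x y lies in a maximal counterexample K, a prime over K contains K + (x)
    or K + (y), and these two larger ideals have finite covers. *)
Lemma prime_cover (I : set A) : noetherian A^o -> is_ideal I ->
  exists ps : seq (spec A), (forall p, inL p ps -> I `<=` p) /\
    forall q : spec A, I `<=` q -> exists2 p, inL p ps & p `<=` q.
Proof.
move=> noeA iI; apply: contrapT => nI.
pose cover (I : set A) := exists ps : seq (spec A), (forall p, inL p ps -> I `<=` p) /\
    forall q : spec A, I `<=` q -> exists2 p, inL p ps & p `<=` q.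
have [K [iK nK Kmax]] : exists K : set A, [/\ is_ideal K, ~ cover K &
    forall K' : set A, is_ideal K' -> ~ cover K' -> K `<=` K' -> K' `<=` K].
  have [||K [iK nK] Kmax] := @noetherian_maximal A^o [set I : set A | is_ideal I /\ ~ cover I] noeA.
  - by move=> N [].
  - by exists I.
  - by exists K; split=> // K' iK' nK'; apply: Kmax.
have [K1|nK1] := pselect (K 1).
  apply: nK; exists [::]; split=> // q Kq; case: (@spec_proper _ q); exact: Kq.
have [pK|npK] := pselect (is_prime K).
  apply: nK; exists [:: Spec pK]; split; first by move=> p [<-|].
  by move=> q Kq; exists (Spec pK) => //; left.
have [x [y [Kxy nKx nKy]]] : exists x y, [/\ K (x * y), ~ K x & ~ K y].
  apply: contrapT => H; apply: npK; split=> // x y Kxy.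
  by apply: contrapT => /not_orP [nx ny]; apply: H; exists x, y.
have cov z : ~ K z -> exists ps : seq (spec A), (forall p, inL p ps -> K `<=` p) /\
    forall q : spec A, K `<=` q -> (q : set A) z -> exists2 p, inL p ps & p `<=` q.
  move=> nKz; pose K' : set A := [set y | exists a b, K a /\ y = a + b * z].
  have iK' : is_ideal K' by apply: ideal_principal_add.
  have KK' : K `<=` K' by move=> a Ka; exists a, 0; rewrite mul0r addr0.
  have [[ps [h1 h2]]|nK'] := pselect (cover K').
    exists ps; split; first by move=> p /h1 h a /KK'/h.
    move=> q Kq qz; apply: h2 => _ [a [b [Ka ->]]]; have iq := spec_is_ideal q.
    by apply: idealD => //; [apply: Kq|apply: idealM_l].
  exfalso; apply: nKz; apply: (Kmax K') => //.
  by exists 0, 1; split; [exact: idealT0|rewrite add0r mul1r].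
have [ps [h1 h2]] := cov _ nKx; have [qs [g1 g2]] := cov _ nKy.
apply: nK; exists (ps ++ qs); split; first by move=> p /inL_cat [/h1|/g1].
move=> q Kq; have [qx|qy] := spec_mul (Kq _ Kxy).
  by have [p pps pq] := h2 q Kq qx; exists p => //; apply/inL_cat; left.
by have [p pps pq] := g2 q Kq qy; exists p => //; apply/inL_cat; right.
Qed.

(** The generators are eliminated one by one: as the coefficient of y on the right lies in p,
    subtracting it from s leaves a multiplier outside p that expresses y through the rest. *)
Lemma nakayama (I : set A) (p : spec A) (n : seq A) : is_ideal I ->
  (exists2 s, ~ (p : set A) s & forall x, inL x n -> exists2 w,
     (exists2 h : seq A, (forall c, c \in h -> (p : set A) c) & w = dot h n) & I (s * x - w)) ->
  exists2 s, ~ (p : set A) s & forall x, inL x n -> I (s * x).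
Proof.
move=> iI; elim: n => [|y n IH]; first by move=> _; exists 1 => //; exact: spec_proper.
have ip := spec_is_ideal p.
have head_p (h : seq A) : (forall c, c \in h -> (p : set A) c) -> (p : set A) (head 0 h).
  by case: h => [_|c h]; [exact: idealT0|apply; rewrite mem_head].
have behead_p (h : seq A) : (forall c, c \in h -> (p : set A) c) ->
    forall c, c \in behead h -> (p : set A) c.
  by case: h => [//|c h] H z zh; apply: H; rewrite inE zh orbT.
move=> [s ns H].
have [_ [hy py ->] Iy] := H y (or_introl erefl).
pose s' := s - head 0 hy.
have ns' : ~ (p : set A) s'.
  by move=> ps'; apply: ns; rewrite -(subrK (head 0 hy) s); apply: idealD => //; apply: head_p.
have Iy' : I (s' * y - dot (behead hy) n) by rewrite /s' mulrBl -addrA -opprD.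
have smul (c : A) (h : seq A) : c * dot h n = dot [seq c * x | x <- h] n.
  elim: (n) h => [|z n' IHn] [|x h] /=; rewrite ?mulr0 //.
    have -> l : dot (A := A) [::] l = 0 by elim: l => //= ? ? ->; rewrite mul0r addr0.
    by rewrite !mul0r !addr0 mulr0.
  by rewrite mulrDr mulrA IHn.
have dsum (h g : seq A) : (forall c, c \in h -> (p : set A) c) -> (forall c, c \in g -> (p : set A) c) ->
    exists2 l : seq A, (forall c, c \in l -> (p : set A) c) & dot h n + dot g n = dot l n.
  elim: (n) h g => [|z n' IHn] h g ph pg; first by exists [::]; rewrite /= ?addr0.
  have [l pl e] := IHn _ _ (behead_p _ ph) (behead_p _ pg).
  exists (head 0 h + head 0 g :: l); last by rewrite /= -e mulrDl addrACA.
  move=> c; rewrite inE => /orP[/eqP ->|/pl //]; apply: idealD => //; exact: head_p.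
have pmul (c : A) (h : seq A) : (forall x, x \in h -> (p : set A) x) ->
    forall x, x \in [seq c * x | x <- h] -> (p : set A) x.
  by move=> ph _ /mapP [x xh ->]; apply: idealM_l => //; apply: ph.
have [|s'' ns'' H''] := IH.
  exists (s' * s); first exact: spec_mulN.
  move=> x xn; have [_ [hx px ->] Ix] := H x (or_intror xn).
  have [l pl e] := dsum _ _ (pmul (head 0 hx) _ (behead_p _ py)) (pmul s' _ (behead_p _ px)).
  exists (dot l n); first by exists l.
  rewrite -e -!smul.
  have -> : s' * s * x - (head 0 hx * dot (behead hy) n + s' * dot (behead hx) n) =
     s' * (s * x - dot hx (y :: n)) + head 0 hx * (s' * y - dot (behead hy) n).
    by rewrite /=; ring.
  by apply: idealD => //; apply: idealM_l.
exists (s' * s''); first exact: spec_mulN.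
move=> x /= [<-|xn]; last by rewrite -mulrA; apply: idealM_l => //; apply: H''.
rewrite mulrAC.
have -> : s' * y * s'' = s'' * (s' * y - dot (behead hy) n) + s'' * dot (behead hy) n.
  by rewrite -mulrDr subrK mulrC.
apply: idealD => //; first exact: idealM_l.
elim: (n) (behead hy) H'' => [|z n' IHn] h H'' /=; first by rewrite mulr0; apply: idealT0.
rewrite mulrDr mulrCA; apply: idealD => //.
  by apply: idealM_l => //; apply: H''; left.
by apply: IHn => w wn; apply: H''; right.
Qed.
End Noetherian.

(** * Polynomial rings *)

Section NoetherianModules.
Variable A : comNzRingType.

Lemma noetherian_surj (V W : lmodType A) (phi : V -> W) : linear phi ->
  (forall w, exists v, phi v = w) -> noetherian V -> noetherian W.
Proof.
move=> l surj noeV N sN; have [s sN' Ns] := noeV _ (submod_preimage l sN).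
exists [seq phi x | x <- s].
  move=> w; elim: s sN' {Ns} => [|x s IH] sN' //= [<-|]; first by apply: sN'; left.
  by apply: IH => y ys; apply: sN'; right.
move=> w Nw; have [v vw] := surj w; subst w.
move: (Ns v Nw) => {Ns sN' sN noeV surj Nw N}; elim: s v => [|x s IH] v /=.
  by move=> ->; apply: lin0.
move=> [a [u [su ->]]]; exists a, (phi u); split; first exact: IH.
by rewrite (linD l) (linZ l).
Qed.

Lemma noetherian_prod (V W : lmodType A) : noetherian V -> noetherian W ->
  noetherian (V * W)%type.
Proof.
move=> noeV noeW N sN.
have sN1 : is_submod [set v : V | exists w, N (v, w)].
  split; first by exists 0; exact: (submod0 sN).
  - by move=> x y [u Nu] [v Nv]; exists (u + v); exact: (submodD sN Nu Nv).
  - by move=> a x [u Nu]; exists (a *: u); exact: (submodZ sN a Nu).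
have sN2 : is_submod [set w : W | N (0, w)].
  split; first exact: (submod0 sN).
  - by move=> x y Nu Nv /=; rewrite -(addr0 0); exact: (submodD sN Nu Nv).
  - by move=> a x Nu /=; rewrite -(scaler0 _ a); exact: (submodZ sN a Nu).
have [s1 s1N Ns1] := noeV _ sN1; have [s2 s2N Ns2] := noeW _ sN2.
have [t [t1 t2]] := finite_witnesses (P := fun v p => N p /\ p.1 = v) (fun v h =>
  let: ex_intro w Nw := s1N v h in ex_intro _ (v, w) (conj Nw erefl)).
pose u := [seq (0 : V, w) | w <- s2].
have Nu p : inL p u -> N p.
  rewrite /u; elim: (s2) s2N => [|w s IH] s2N //= [<-|]; first by apply: s2N; left.
  by apply: IH => y ys; apply: s2N; right.
exists (t ++ u) => [p /inL_cat [/t1 [v _ []]|/Nu] //|].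
move=> [v w] Nvw.
have [w' Nw'] : exists w', span t (v, w').
  suff sub : span s1 `<=` [set x | exists w', span t (x, w')].
    by apply: sub; apply: Ns1; exists w.
  apply: span_sub => [|x /t2 [[p1 p2] pt [_ /= e]]].
    split; first by exists 0; exact: (submod0 (submod_span _)).
    - by move=> x y [a ta] [b tb]; exists (a + b); exact: (submodD (submod_span t) ta tb).
    - by move=> c x [a ta]; exists (c *: a); exact: (submodZ (submod_span t) c ta).
  by exists p2; rewrite -e; apply: mem_span.
have sT : is_submod (span (t ++ u)) by apply: submod_span.
have tT : span t `<=` span (t ++ u).
  by apply: span_sub => // x xt; apply/mem_span/inL_cat; left.
apply: (submod_subl sT (y := (v, w'))); last exact: tT.
have -> : (v, w) - (v, w') = (0, w - w') by congr pair; rewrite /= subrr.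
have : span s2 (w - w').
  apply: Ns2; rewrite /= -(subrr v).
  have Nvw' : N (v, w') by apply: (span_sub sN _ Nw') => p /t1 [x _ []].
  exact: (submodB sN Nvw Nvw').
suff sub : span s2 `<=` [set y | span (t ++ u) (0, y)] by apply: sub.
apply: span_sub; first by apply: (@submod_preimage _ _ _ (fun y => (0, y))) => // a x y; congr pair; rewrite /= scaler0 addr0.
move=> x xs; apply/mem_span/inL_cat; right; rewrite /u.
by elim: (s2) xs => [|y s IH] //= [->|/IH]; auto.
Qed.

Lemma noetherian_KV n : noetherian A^o -> noetherian (KV A n).
Proof. by move=> noeA; elim: n => [|n IH] //=; apply: noetherian_prod. Qed.
End NoetherianModules.

Section Dickson.

Lemma nat_monotone_subseq (v : nat -> nat) : exists phi : nat -> nat,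
  {homo phi : i j / (i < j)%N} /\ {homo (v \o phi) : i j / (i <= j)%N}.
Proof.
have min n : exists m, (n <= m)%N /\ forall l, (n <= l)%N -> (v m <= v l)%N.
  have ex : exists x, `[< exists2 m, (n <= m)%N & v m = x >] by exists (v n); apply/asboolP; exists n.
  case: (ex_minnP ex) => x /asboolP [m nm vm] xmin; exists m; split=> // l nl.
  by rewrite vm; apply: xmin; apply/asboolP; exists l.
have [nxt nxtP] := choice min.
pose phi := fix phi k := if k is k'.+1 then nxt (phi k').+1 else nxt 0%N.
have step k : (phi k < phi k.+1)%N by case: (nxtP (phi k).+1).
exists phi; split; first exact: homo_ltn ltn_trans step.
apply: homo_leq => [x|y x z|k] //=; first exact: leq_trans.
case: k => [|k] /=.
  by case: (nxtP 0%N) => _; apply.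
case: (nxtP (phi k).+1) => _; apply.
exact: leq_trans (step k) (ltnW (step k.+1)).
Qed.

Lemma dickson d (u : nat -> 'X_{1..d}) : exists i j, (i < j)%N /\ (u i <= u j)%MM.
Proof.
have H (t : nat) : (t <= d)%N -> exists phi : nat -> nat, {homo phi : i j / (i < j)%N} /\
    forall i j (l : 'I_d), (i <= j)%N -> (l < t)%N -> (u (phi i) l <= u (phi j) l)%N.
  elim: t => [|t IH] td; first by exists id; split.
  have [phi [h1 h2]] := IH (ltnW td).
  have [psi [g1 g2]] := nat_monotone_subseq (fun i => u (phi i) (Ordinal td)).
  exists (phi \o psi); split; first by move=> i j /g1/h1.
  move=> i j l ij; rewrite ltnS leq_eqVlt => /orP[/eqP lt|lt].
    have -> : l = Ordinal td by apply: val_inj.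
    exact: g2.
  by apply: h2 => //; apply: (homo_leq leqnn leq_trans _ ij) => k; apply/ltnW/g1.
have [phi [h1 h2]] := H d (leqnn d); exists (phi 0%N), (phi 1%N).
by split; [exact: h1|apply/mnm_lepP => l; apply: h2].
Qed.

End Dickson.

Section MPoly.
Variables (k : fieldType) (d : nat).
Local Notation R := {mpoly k[d]}.

(** If finite generation failed, one could keep choosing an element outside the span of the previous
    ones with minimal leading monomial. By Dickson's lemma some leading monomial is divisible by an
    earlier one, and cancelling it contradicts minimality. *)
Lemma noetherian_mpoly : noetherian (R^o : lmodType R).
Proof.
move=> N sN; apply: contrapT => H.
have step (s : seq R) : exists f : R, (forall x, inL x s -> N x) ->
    [/\ N f, ~ span (V := R^o) s f & forall g, N g -> ~ span (V := R^o) s g -> ~ (mlead g < mlead f)%O].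
  have [sN'|] := pselect (forall x, inL x s -> N x); last by exists 0.
  have [f0 [Nf0 nf0]] : exists f, N f /\ ~ span (V := R^o) s f.
    apply: contrapT => H'; apply: H; exists s => // f Nf.
    by apply: contrapT => nf; apply: H'; exists f.
  move: {2}(mlead f0) (erefl (mlead f0)) => m.
  elim: (@ltom_wf d m) f0 Nf0 nf0 => {}m _ IH f Nf nf fm.
  have [[g [Ng ng gf]]|Hg] := pselect (exists g, [/\ N g, ~ span (V := R^o) s g & (mlead g < mlead f)%O]).
    by rewrite fm in gf; apply: (IH _ gf g).
  by exists f => _; split=> // g Ng ng gf; apply: Hg; exists g.
have [F FP] := choice step.
pose L := fix L n := if n is n'.+1 then F (L n') :: L n' else [::].
have LN n : forall x, inL x (L n) -> N x.
  elim: n => [|n IH] //= x [<-|]; last exact: IH.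
  by case: (FP _ IH).
have Lmono i j : (i < j)%N -> inL (F (L i)) (L j).
  elim: j => [//|j IH]; rewrite ltnS leq_eqVlt => /orP[/eqP ->|/IH]; by [left|right].
have [i [j [ij le_ij]]] := dickson (fun n => mlead (F (L n))).
set f := F (L i) in le_ij; set g := F (L j) in le_ij.
have [Ng ng gmin] := FP _ (LN j); have [Nf nf _] := FP _ (LN i).
rewrite -/g in Ng ng gmin; rewrite -/f in Nf nf.
have f0 : f != 0 by apply/eqP => e; apply: nf; rewrite e; exact: (submod0 (submod_span _)).
have g0 : g != 0 by apply/eqP => e; apply: ng; rewrite e; exact: (submod0 (submod_span _)).
pose c : R := (mleadc g / mleadc f) *: 'X_[(mlead g - mlead f)].
have c0 : mleadc g / mleadc f != 0 by rewrite mulf_neq0 ?invr_eq0 ?mleadc_eq0.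
have cf : span (V := R^o) (L j) (c * f).
  by apply: (submodZ (submod_span (V := R^o) _)); apply: mem_span; apply: Lmono.
pose h := g - c * f.
have lc : mlead c = (mlead g - mlead f)%MM by rewrite /c mleadZ // mleadXm.
have lcc : mleadc c = mleadc g / mleadc f by rewrite lc mcoeffZ mcoeffX eqxx mulr1.
have cn0 : c != 0 by rewrite -mleadc_eq0 lcc.
have lcf : mlead (c * f) = mlead g by rewrite mleadM // lc submK.
have cg : (c * f)@_(mlead g) = mleadc g.
  by have := mleadcM c f; rewrite -mleadM // lcf lcc divfK ?mleadc_eq0.
have nh : ~ span (V := R^o) (L j) h.
  by move=> sh; apply: ng; apply: (submod_subl (submod_span (V := R^o) _) sh cf).
have h0 : h != 0 by apply/eqP => e; apply: nh; rewrite e; exact: (submod0 (submod_span _)).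
apply: (gmin h) => //.
  apply: (submodB sN) => //; apply: (submodZ sN) => //.
rewrite lt_neqAle; apply/andP; split; last first.
  by apply: le_trans (mleadB_le _ _) _; rewrite lcf leUx lexx.
by apply/eqP => e; move: h0; rewrite -mleadc_eq0 e /h mcoeffB cg subrr eqxx.
Qed.

(** * Dimension *)

(** Exponent vectors of length [n] with entries below [N], nested so that an induction along a chain
    can split off the first exponent. *)
Fixpoint exponents (N n : nat) : finType :=
  if n is n'.+1 then ('I_N * exponents N n')%type : finType else unit.

Fixpoint monomial_value (N n : nat) (y : nat -> R) : exponents N n -> R :=
  match n return exponents N n -> R with
  | 0%N => fun=> 1
  | n'.+1 => fun e => y 0%N ^+ e.1 * monomial_value (n := n') (fun i => y i.+1) e.2
  end.

Lemma card_exponents N n : #|exponents N n| = (N ^ n)%N.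
Proof.
by elim: n => [|n IH]; rewrite ?card_unit //= card_prod card_ord IH expnS.
Qed.

Definition deg_le (b : nat) (p : R) : Prop := forall m, m \in msupp p -> (mdeg m <= b)%N.

Lemma deg_leM b c p q : deg_le b p -> deg_le c q -> deg_le (b + c) (p * q).
Proof.
move=> hp hq m /msuppM_le /allpairsP [[m1 m2] [/= /hp h1 /hq h2 ->]].
by rewrite mdegD leq_add.
Qed.

Lemma deg_leX b n p : deg_le b p -> deg_le (n * b) (p ^+ n).
Proof.
move=> hp; elim: n => [|n IH]; last by rewrite exprS mulSn; apply: deg_leM.
by rewrite expr0 => m; rewrite msupp1 inE => /eqP ->; rewrite mdeg0.
Qed.

Lemma monomial_value_deg N n D (y : nat -> R) (e : exponents N n) :
  (forall i, (i < n)%N -> deg_le D (y i)) -> deg_le (n * N * D) (monomial_value y e).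
Proof.
elim: n y e => [|n IH] y e hy /=.
  by move=> m; rewrite msupp1 inE => /eqP ->; rewrite mdeg0.
case: e => i e /=; rewrite mulSn mulnDl; apply: deg_leM; last by apply: IH => j jn; apply: hy.
by move=> m /(deg_leX (hy 0%N isT)) h; apply: leq_trans h _; rewrite leq_mul2r (ltnW (ltn_ord i)) orbT.
Qed.

(** Counting: N^(d+1) monomials in d + 1 polynomials have degrees linear in N, hence lie in a space
    of dimension of order N^d. *)
Lemma algebraic_dependence (y : nat -> R) : exists N (c : exponents N d.+1 -> k),
  (exists e, c e != 0) /\ \sum_e c e *: monomial_value y e = 0.
Proof.
pose D := \max_(i < d.+1) msize (y i).
have hy i : (i < d.+1)%N -> deg_le D (y i).
  move=> id m /msize_mdeg_lt /ltnW h; apply: leq_trans h _.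
  exact: (leq_bigmax (F := fun i : 'I_d.+1 => msize (y i)) (Ordinal id)).
(* [M] bounds the exponents of all monomials that occur. Since M <= b N and N > b^d, we get M^d <=
   b^d N^d < N^(d+1). *)
pose b := (d.+1 * D).+1; pose N := (b ^ d).+1; pose M := (d.+1 * N * D).+1.
have MN : (M ^ d < N ^ d.+1)%N.
  have le : (M <= b * N)%N.
    by rewrite /M /b [X in (_ <= X)%N]mulSn mulnAC -add1n leq_add2r.
  apply: leq_ltn_trans (_ : (b * N) ^ d < _)%N; first by case: (posnP d) => [->|d0]; rewrite ?expn0 // leq_exp2r.
  by rewrite expnMn expnS ltn_mul2r expn_gt0 /= /N ltnS leqnn.
pose E := exponents N d.+1; pose F := {ffun 'I_d -> 'I_M}.
pose mF (f : F) : 'X_{1..d} := [multinom (f i : nat) | i < d].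
pose B : 'M[k]_(#|E|, #|F|) := \matrix_(e, f) (monomial_value y (enum_val e))@_(mF (enum_val f)).
have : kermx B != 0.
  rewrite kermx_eq0 /row_free neq_ltn; apply/orP; left.
  apply: leq_ltn_trans (rank_leq_col B) _.
  by rewrite card_ffun !card_ord card_exponents.
move=> /rowV0Pn [v /sub_kermxP vB v0].
exists N, (fun e => v 0 (enum_rank e)); split.
  have [j vj] : exists j, v 0 j != 0.
    apply: contrapT => H; case/eqP: v0; apply/rowP => j; rewrite mxE.
    by apply/eqP/negPn/negP => vj; apply: H; exists j.
  by exists (enum_val j); rewrite enum_valK.
apply/mpolyP => m; rewrite mcoeff0 raddf_sum /=.
have [small|] := pselect (forall i, (m i < M)%N).
  have [f fm] : exists f : F, mF f = m.
    exists [ffun i => Ordinal (small i)]; by apply/mnmP => i; rewrite mnmE ffunE.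
  have := congr1 (fun w : 'rV_ _ => w 0 (enum_rank f)) vB.
  rewrite !mxE => e0; rewrite -[RHS]e0 (reindex (@enum_val E E)) /=; last first.
    by exists enum_rank => i _; rewrite ?enum_valK ?enum_rankK.
  by apply: eq_bigr => e _; rewrite mcoeffZ enum_valK !mxE enum_rankK fm.
move=> /existsNP [i /negP]; rewrite -leqNgt => big.
rewrite big1 // => e _; rewrite mcoeffZ memN_msupp_eq0 ?mulr0 //; apply/negP => /(monomial_value_deg hy).
rewrite leqNgt => /negP; apply; apply: leq_trans big _.
by rewrite mdegE (bigD1 i) //= leq_addr.
Qed.

(* The lowest power of the first element with a nonzero coefficient is        *)
(* cancelled modulo the first prime, then killed modulo the second one.       *)
Lemma chain_independent N n (c : nat -> spec R) (y : nat -> R) (a : exponents N n -> k) :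
  (forall i, (i < n)%N -> [/\ c i `<=` c i.+1, ((c i.+1 : set R) (y i)) & ~ (c i : set R) (y i)]) ->
  (exists e, a e != 0) -> ~ (c 0%N : set R) (\sum_e a e *: monomial_value y e).
Proof.
have Zc (p : spec R) x (u : k) : (p : set R) x -> (p : set R) (u *: x).
  by rewrite -mul_mpolyC; apply: idealM_l; apply: spec_is_ideal.
elim: n c y a => [|n IH] c y a hc [e ae].
  rewrite (bigD1 tt) //= big1 => [|[] //]; rewrite addr0 -mul_mpolyC mulr1 => h.
  apply: (@spec_proper _ (c 0%N)); have := idealM_l (a e)^-1%:MP (spec_is_ideal _) h.
  by case: e ae {h} => ae; rewrite -mpolyCM mulVf.
have ex : exists j : nat, [exists i : 'I_N, (nat_of_ord i == j) && [exists e', a (i, e') != 0]].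
  by exists (e.1 : nat); apply/existsP; exists e.1; rewrite eqxx /=; apply/existsP; exists e.2; case: (e) ae.
case: (ex_minnP ex) => j /existsP [i /andP [/eqP ij /existsP [e' ae']]] jmin h.
have small (i' : 'I_N) e'' : (i' < i)%N -> a (i', e'') = 0.
  move=> lt; apply/eqP/negPn/negP => nz; suff : (j <= i')%N by rewrite leqNgt -ij lt.
  by apply: jmin; apply/existsP; exists i'; rewrite eqxx /=; apply/existsP; exists e''.
have [c01 y1 ny0] := hc 0%N isT.
pose G (l : 'I_N) : R := \sum_(f : exponents N n) a (l, f) *: monomial_value (fun i => y i.+1) f.
have sumE : \sum_e a e *: monomial_value (n := n.+1) y e = \sum_(l : 'I_N) y 0%N ^+ l * G l.
  transitivity (\sum_(l : 'I_N) \sum_(f : exponents N n)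
      a (l, f) *: (y 0%N ^+ l * monomial_value (fun i => y i.+1) f)).
    by rewrite pair_bigA /=; apply: eq_bigr => -[l f] _.
  by apply: eq_bigr => l _; rewrite /G mulr_sumr; apply: eq_bigr => f _; rewrite -scalerAr.
have : exists r, \sum_(l : 'I_N) y 0%N ^+ l * G l = y 0%N ^+ i * (G i + y 0%N * r).
  exists (\sum_(l < N | (i < l)%N) y 0%N ^+ (l - i.+1) * G l).
  rewrite (bigID (fun l : 'I_N => (l < i)%N)) /= big1 ?add0r; last first.
    by move=> l li; rewrite /G big1 ?mulr0 // => f _; rewrite small ?scale0r.
  rewrite (bigD1 i) ?ltnn //= mulrDr; congr (_ + _).
  rewrite mulrA -exprSr mulr_sumr.
  apply: eq_big => l; first by rewrite -leqNgt ltn_neqAle andbC eq_sym.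
  rewrite -leqNgt => /andP [il nli]; rewrite mulrA -exprD subnKC // ltn_neqAle il andbT eq_sym.
  exact: nli.
move=> [r rE]; rewrite sumE rE in h.
have [/spec_exp //|hG] := spec_mul h.
apply: (IH (fun i => c i.+1) (fun i => y i.+1) (fun f => a (i, f))).
- by move=> l ln; apply: hc.
- by exists e'.
have -> : \sum_e a (i, e) *: monomial_value (fun i0 => y i0.+1) e = (G i + y 0%N * r) - y 0%N * r.
  by rewrite addrK.
apply: idealB; [exact: spec_is_ideal|exact: c01|].
by apply: idealM_r => //; apply: spec_is_ideal.
Qed.

(** Elements taken from the successive steps of a chain of length d + 1 would be algebraically
    independent by [chain_independent]. *)
Lemma dim_mpoly (p : spec R) n : prime_height_ge p n -> (n <= d)%N.
Proof.
move=> hp; rewrite leqNgt; apply/negP => dn.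
have [c [ch _]] := prime_heightW dn hp.
have sel i : exists x : R, (i < d.+1)%N -> (c i.+1 : set R) x /\ ~ (c i : set R) x.
  have [id|] := boolP (i < d.+1)%N; last by exists 0.
  by have [_ /existsNP [x /not_implyP [? ?]]] := ch i id; exists x.
have [y yP] := choice sel.
have [N [a [a0 sum0]]] := algebraic_dependence y.
apply: (@chain_independent N d.+1 c y a) => //; last by rewrite sum0; exact: (idealT0 (spec_is_ideal _)).
by move=> i id; have [? ?] := yP i id; split=> //; case: (ch i id).
Qed.
End MPoly.

(** * The Nullstellensatz and the depth of polynomial rings *)

Section Zariski.
Variable K : fieldType.

Definition adjoin (A : comNzRingType) (phi : {rmorphism A -> K}) (x : K) :
  {rmorphism {poly A} -> K} := horner_eval x \o map_poly phi.

Arguments adjoin : simpl never.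

Lemma adjoinC (A : comNzRingType) (phi : {rmorphism A -> K}) x c :
  adjoin phi x c%:P = phi c.
Proof. by rewrite /adjoin /= /horner_eval map_polyC hornerC. Qed.

Lemma adjoinX (A : comNzRingType) (phi : {rmorphism A -> K}) x : adjoin phi x 'X = x.
Proof. by rewrite /adjoin /= /horner_eval map_polyX hornerX. Qed.

Lemma adjoinE (A : comNzRingType) (phi : {rmorphism A -> K}) x P :
  adjoin phi x P = (map_poly phi P).[x].
Proof. by []. Qed.

Fixpoint generated (bs : seq K) (A : comNzRingType) (phi : {rmorphism A -> K}) (z : K) : Prop :=
  if bs is b :: bs' then generated bs' (adjoin phi b) z else exists a, z = phi a.

Lemma integral_trans (A B : comNzRingType) (f : {rmorphism A -> K}) (g : {rmorphism B -> K}) z :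
  (forall a, integralOver g (f a)) -> integralOver f z -> integralOver g z.
Proof.
move=> fg [p mp rp]; apply: (@integral_root_monic _ _ g z (map_poly f p)) => //.
  exact: monic_map.
by apply/integral_poly => i; rewrite coef_map; apply: fg.
Qed.

(** Multiplying an integral equation of the inverse of v by a power of v writes this inverse as a
    polynomial in v. *)
Lemma inverse_integral (B : comNzRingType) (f : {rmorphism B -> K}) v :
  f v != 0 -> integralOver f (f v)^-1 -> exists w, f w * f v = 1.
Proof.
move=> v0 [Q mQ]; have szQ : size (map_poly f Q) = size Q.
  by rewrite size_map_poly_id0 // (monicP mQ) rmorph1 oner_neq0.
rewrite /root horner_coef szQ; case sQ : (size Q) => [|n].
  by move/eqP: sQ; rewrite size_poly_eq0 => /eqP Q0; have := monic_neq0 mQ; rewrite Q0 eqxx.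
have e1 : (map_poly f Q)`_n = 1.
  by have := monicP mQ; rewrite lead_coefE sQ coef_map => ->; exact: rmorph1.
rewrite big_ord_recr /= e1 mul1r => /eqP h.
case: n sQ h {e1} => [|n] sQ h.
  by move: h; rewrite big_ord0 add0r => /eqP; rewrite oner_eq0.
exists (- \sum_(i < n.+1) Q`_i * v ^+ (n - i)).
have : (\sum_(i < n.+1) (map_poly f Q)`_i * (f v)^-1 ^+ i + (f v)^-1 ^+ n.+1) * f v ^+ n.+1 = 0.
  by rewrite h mul0r.
rewrite mulrDl -exprMn mulVf // expr1n => /eqP; rewrite addrC addr_eq0 => /eqP ->.
rewrite rmorphN mulNr rmorph_sum mulr_suml mulr_suml; congr (- _).
apply: eq_bigr => i _; rewrite coef_map rmorphM rmorphXn -!mulrA; congr (_ * _).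
have -> : f v ^+ n.+1 = f v ^+ i * f v ^+ (n - i).+1.
  by rewrite -exprD addnS subnKC // -ltnS.
by rewrite exprVn mulrA mulVf ?expf_neq0 // mul1r exprSr.
Qed.

Section Localized.
Variables (A : comNzRingType) (phi : {rmorphism A -> K}).
Local Notation inv_at a := (adjoin phi (phi a)^-1).

Lemma integral_base a c : integralOver (inv_at a) (phi c).
Proof. by rewrite -(adjoinC phi (phi a)^-1 c); apply: integral_id. Qed.

Lemma integral_inv_at a : integralOver (inv_at a) (phi a)^-1.
Proof. by rewrite -{2}(adjoinX phi (phi a)^-1); apply: integral_id. Qed.

Lemma adjoin_clear a Q : phi a != 0 -> exists N c, inv_at a Q * phi a ^+ N = phi c.
Proof.
move=> a0; elim/poly_ind: Q => [|Q b [N [c e]]].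
  by exists 0%N, 0; rewrite !rmorph0 mul0r.
exists N.+1, (c + b * a ^+ N.+1).
have -> : inv_at a (Q * 'X + b%:P) = inv_at a Q * (phi a)^-1 + phi b.
  by rewrite rmorphD rmorphM adjoinX adjoinC.
rewrite mulrDl rmorphD [phi (b * _)]rmorphM rmorphXn -e; congr (_ + _).
by rewrite exprS mulrA mulfVK.
Qed.

Lemma integral_localW a e z : phi a != 0 -> phi e != 0 ->
  integralOver (inv_at a) z -> integralOver (inv_at (a * e)) z.
Proof.
move=> a0 e0; apply: integral_trans => Q; rewrite adjoinE; apply: integral_horner.
  by apply/integral_poly => i; rewrite coef_map; apply: integral_base.
have -> : (phi a)^-1 = phi e * (phi (a * e))^-1.
  by rewrite rmorphM invfM mulrCA divff // mulr1.
by apply: integral_mul; [apply: integral_base|apply: integral_inv_at].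
Qed.

(** Inverting the leading coefficient as well makes the equation monic; [e] is that coefficient with
    its denominators cleared. *)
Lemma integral_of_root a (W : {poly K}) z : phi a != 0 ->
  (forall i, exists Q, W`_i = inv_at a Q) -> W != 0 -> root W z ->
  exists2 e, phi e != 0 & integralOver (inv_at (a * e)) z.
Proof.
move=> a0 WA W0 rW; have [Q WQ] := WA (size W).-1.
have [N [e eE]] := adjoin_clear Q a0; rewrite -WQ -lead_coefE in eE.
have l0 : lead_coef W != 0 by rewrite lead_coef_eq0.
have e0 : phi e != 0 by rewrite -eE mulf_neq0 // expf_neq0.
exists e => //; apply: (@integral_root_monic _ _ _ z ((lead_coef W)^-1 *: W)).
- by rewrite monicE lead_coefZ mulVf.
- by rewrite rootZ // invr_eq0.
apply/integral_poly => i; rewrite coefZ; apply: integral_mul; last first.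
  have [Q' ->] := WA i; apply: integral_localW => //; exact: integral_id.
have -> : (lead_coef W)^-1 = phi (a ^+ N * a) * (phi (a * e))^-1.
  rewrite !rmorphM rmorphXn -eE; have : phi a ^+ N != 0 by rewrite expf_neq0.
  by move: (phi a ^+ N) => X X0; field; rewrite a0 l0 X0.
by apply: integral_mul; [apply: integral_base|apply: integral_inv_at].
Qed.

End Localized.

Section Transcendental.
Variables (A : comNzRingType) (phi : {rmorphism A -> K}) (b : K).
Hypothesis trans : forall P : {poly A}, (map_poly phi P).[b] = 0 -> map_poly phi P = 0.
Local Notation phib := (adjoin phi b).

(** Otherwise 1 + b a(b) would be invertible after inverting a(b), so that 1 + X a divides a power
    of a. It is coprime to a, yet not constant. *)
Lemma transcendental_not_integral (a : {poly A}) : phib a != 0 ->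
  ~ (forall z, integralOver (adjoin phib (phib a)^-1) z).
Proof.
move=> a0 H; pose v : {poly A} := 1 + 'X * a.
have v0 : phib v != 0.
  apply/eqP => /trans /(congr1 (fun p : {poly K} => p`_0)).
  by rewrite rmorphD rmorphM rmorph1 /= map_polyX coefD coef1 coefXM coef0 addr0 => /eqP; rewrite oner_eq0.
have [w wE] : exists w, adjoin phib (phib a)^-1 w * phib v = 1.
  have := @inverse_integral _ (adjoin phib (phib a)^-1) v%:P; rewrite adjoinC.
  by apply=> //; apply: H.
have [N [c cE]] := adjoin_clear w a0.
have eq1 : phib (a ^+ N) = phib (v * c).
  by rewrite rmorphXn rmorphM -cE mulrA [phib v * _]mulrC wE mul1r.
have eq2 : map_poly phi a ^+ N = map_poly phi v * map_poly phi c.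
  apply/eqP; rewrite -subr_eq0 -rmorphXn -rmorphM -rmorphB; apply/eqP/trans.
  by rewrite -adjoinE rmorphB eq1 subrr.
have vE : map_poly phi v = 1 + 'X * map_poly phi a.
  by rewrite rmorphD rmorphM rmorph1 /= map_polyX.
have ma0 : map_poly phi a != 0.
  by apply: contraNneq a0 => e; rewrite adjoinE e horner0.
have cop : coprimep (map_poly phi v) (map_poly phi a ^+ N).
  apply: coprimep_expr; apply/Bezout_coprimepP; exists (1, - 'X).
  by rewrite /= vE mul1r mulNr addrK eqpxx.
have : map_poly phi v %= 1.
  by apply: (coprimepP _ _ cop) => //; rewrite eq2 dvdp_mulIl.
rewrite -size_poly_eq1 vE addrC size_polyDl; last by rewrite mulrC size_mulX // size_poly1 ltnS lt0n size_poly_eq0.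
by rewrite mulrC size_mulX // eqSS size_poly_eq0 (negPf ma0).
Qed.
End Transcendental.

(** Zariski's lemma by induction on the generators. Once the field is integral over A[b] with one
    element inverted, b is algebraic by [transcendental_not_integral]; then b and the inverse of
    that element are integral over A with one element inverted. *)
Lemma generated_integral (bs : seq K) (A : comNzRingType) (phi : {rmorphism A -> K}) :
  (forall z, generated bs phi z) ->
  exists2 a, phi a != 0 & forall z, integralOver (adjoin phi (phi a)^-1) z.
Proof.
elim: bs A phi => [|b bs IH] A phi gen.
  exists 1; first by rewrite rmorph1 oner_neq0.
  by move=> z; have [a ->] := gen z; apply: integral_base.
have [a' b0 H] := IH _ _ gen; set beta := adjoin phi b a' in b0 H.
have [P Pb P0] : exists2 P, (map_poly phi P).[b] = 0 & map_poly phi P <> 0.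
  apply: contrapT => H'; apply: (transcendental_not_integral (phi := phi) (b := b) _ b0 H).
  by move=> P Pb; apply: contrapT => P0; apply: H'; exists P.
have one0 : phi 1 != 0 by rewrite rmorph1 oner_neq0.
have [|||e e0 be] := @integral_of_root A phi 1 (map_poly phi P) b one0.
- by move=> i; exists (P`_i)%:P; rewrite adjoinC coef_map.
- exact/eqP.
- exact/rootP.
set c := 1 * e in be; have c0 : phi c != 0 by rewrite /c mul1r.
have [Q mQ rQ] : integralOver (adjoin phi (phi c)^-1) beta.
  rewrite /beta adjoinE; apply: integral_horner => //.
  by apply/integral_poly => i; rewrite coef_map; apply: integral_base.
set p := map_poly _ Q in rQ; have p0 : p != 0 by apply: monic_neq0; apply: monic_map.
(* [W] is the reversed polynomial of [p], so the inverse of [beta] is a root of it. *)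
pose W := \poly_(i < size p) p`_((size p).-1 - i).
have [|||e' e'0 ie'] := @integral_of_root A phi c W beta^-1 c0.
- move=> i; rewrite coef_poly; case: ifP => _; last by exists 0; rewrite rmorph0.
  by exists (Q`_((size p).-1 - i)); rewrite coef_map.
- apply/eqP => /polyP /(_ 0%N); rewrite coef_poly coef0 subn0 lt0n size_poly_eq0 p0 -lead_coefE.
  by move/eqP; rewrite lead_coef_eq0 (negPf p0).
- apply/rootP; rewrite horner_poly; apply: (mulIf (expf_neq0 (size p).-1 b0)).
  rewrite mul0r mulr_suml -[RHS](rootP rQ) horner_coef (reindex_inj rev_ord_inj) /=.
  apply: eq_bigr => i _; rewrite -mulrA.
  have lt := ltn_ord i; have -> : ((size p).-1 - (size p - i.+1) = i)%N.
    by move: lt => /=; lia.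
  congr (_ * _); rewrite exprVn.
  have e2 : (i + (size p - i.+1) = (size p).-1)%N.
    by move: lt => /=; lia.
  by rewrite -e2 exprD mulrCA mulVf ?mulr1 // expf_neq0.
exists (c * e'); first by rewrite rmorphM mulf_neq0.
move=> z; apply: integral_trans (H z) => r; rewrite adjoinE; apply: integral_horner => //.
apply/integral_poly => i.
have -> : (map_poly (adjoin phi b) r)`_i = (map_poly phi r`_i).[b] by rewrite coef_map.
apply: integral_horner.
  by apply/integral_poly => j; rewrite coef_map; apply: integral_base.
exact: integral_localW.
Qed.

Lemma generated_base bs (A : comNzRingType) (phi : {rmorphism A -> K}) a : generated bs phi (phi a).
Proof.
elim: bs A phi a => [|b bs IH] A phi a /=; first by exists a.
by rewrite -(adjoinC phi b); apply: IH.
Qed.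

Lemma generated_mem bs (A : comNzRingType) (phi : {rmorphism A -> K}) b :
  b \in bs -> generated bs phi b.
Proof.
elim: bs A phi => [|x bs IH] A phi //=; rewrite inE => /orP[/eqP ->|]; last exact: IH.
by rewrite -{2}(adjoinX phi x); apply: generated_base.
Qed.

Lemma generatedD bs (A : comNzRingType) (phi : {rmorphism A -> K}) x y :
  generated bs phi x -> generated bs phi y -> generated bs phi (x + y).
Proof.
elim: bs A phi => [|b bs IH] A phi /=; last exact: IH.
by move=> [a ->] [c ->]; exists (a + c); rewrite rmorphD.
Qed.

Lemma generatedM bs (A : comNzRingType) (phi : {rmorphism A -> K}) x y :
  generated bs phi x -> generated bs phi y -> generated bs phi (x * y).
Proof.
elim: bs A phi => [|b bs IH] A phi /=; last exact: IH.
by move=> [a ->] [c ->]; exists (a * c); rewrite rmorphM.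
Qed.
End Zariski.

Section Nullstellensatz.
Variables (k : fieldType) (d : nat).
Local Notation R := {mpoly k[d]}.

Definition in_spec (p : spec R) : {pred R} := fun x => `[< (p : set R) x >].

Lemma in_spec_idealr (p : spec R) : idealr_closed (in_spec p).
Proof.
have ip := spec_is_ideal p; split.
- by apply/asboolP; exact: (idealT0 ip).
- by apply/negP => /asboolP/spec_proper.
- move=> a u v /asboolP pu /asboolP pv; apply/asboolP.
  by apply: idealD => //; apply: idealM_l.
Qed.

HB.instance Definition _ (p : spec R) := isIdealr.Build R (in_spec p) (in_spec_idealr p).

Lemma residue_field (p : spec R) : is_maximal p ->
  exists (K : fieldType) (f : {rmorphism R -> K}),
    (forall z, exists x, z = f x) /\ (forall x, f x = 0 <-> (p : set R) x).
Proof.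
move=> pmax; pose Q := Quotient.quot (in_spec p).
pose pi : {rmorphism R -> Q} := \pi_Q%qT.
have piP (x y : R) : (pi x = pi y) <-> (p : set R) (x - y).
  split=> [/eqP|pxy]; first by rewrite -Quotient.idealrBE => /asboolP.
  by apply/eqP; rewrite -Quotient.idealrBE; apply/asboolP.
have pi0 (x : R) : (pi x = 0) <-> (p : set R) x.
  by rewrite -(rmorph0 pi) piP subr0.
have inv_ex (z : Q) : exists y : Q, (z != 0 -> y * z = 1) /\ (z = 0 -> y = 0).
  have [->|z0] := eqVneq z 0; first by exists 0; split=> //.
  have nz : ~ (p : set R) (repr z).
    by move=> /pi0; rewrite /pi /= reprK => /eqP; rewrite (negPf z0).
  pose J := [set y | exists a b, (p : set R) a /\ y = a + b * repr z].
  have iJ : is_ideal J by apply: ideal_principal_add; apply: spec_is_ideal.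
  have pJ : (p : set R) `<=` J by move=> a pa; exists a, 0; rewrite mul0r addr0.
  have [a [b [pa e1]]] : J 1.
    apply: contrapT => nJ1; apply: nz; rewrite -(pmax J iJ pJ nJ1).
    by exists 0, 1; split; [exact: (idealT0 (spec_is_ideal p))|rewrite add0r mul1r].
  exists (pi b); split=> [_|e]; last by rewrite e eqxx in z0.
  have zE : z = pi (repr z) by rewrite /pi /= reprK.
  rewrite [in LHS]zE -rmorphM -(rmorph1 pi); apply/piP.
  rewrite e1 opprD addrCA subrr addr0; apply: idealN => //; exact: spec_is_ideal.
have [inv invP] := choice inv_ex.
have mulV : forall x : Q, x != 0 -> inv x * x = 1 by move=> x; case: (invP x).
have inv0 : inv 0 = 0 by case: (invP 0) => _; apply.
pose K : fieldType := HB.pack Q (GRing.ComNzRing_isField.Build Q mulV inv0).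
have piS (z : Q) : exists x, z = pi x by exists (repr z); rewrite /pi /= reprK.
by exists K, pi; split; [exact: piS|exact: pi0].
Qed.

Lemma mpoly_rmorph_ext (S : nzRingType) (f g : {rmorphism R -> S}) :
  (forall c, f c%:MP = g c%:MP) -> (forall i, f 'X_i = g 'X_i) -> f =1 g.
Proof.
move=> fgC fgX x; rewrite (mpolyE x) !rmorph_sum; apply: eq_bigr => m _.
rewrite -mul_mpolyC !rmorphM fgC; congr (_ * _).
by rewrite mpolyXE_id !rmorph_prod; apply: eq_bigr => i _; rewrite !rmorphXn fgX.
Qed.

(** The residue field K is generated over k by the images of the variables. Were the image b of X_l
    transcendental, [generated_integral] over k[b] would contradict
    [transcendental_not_integral]. *)
Lemma maximal_univariate (p : spec R) (l : 'I_d) : is_maximal p ->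
  exists2 g : {poly k}, g != 0 & (p : set R) (map_poly (@mpolyC d k) g).['X_l].
Proof.
move=> pmax; have [K [f [fsurj fp]]] := residue_field pmax.
apply: contrapT => H.
pose phi : {rmorphism k -> K} := f \o @mpolyC d k.
pose b := f 'X_l.
have evE (g : {poly k}) : (map_poly phi g).[b] = f (map_poly (@mpolyC d k) g).['X_l].
  by rewrite horner_coef size_map_poly horner_coef size_map_poly rmorph_sum; apply: eq_bigr => i _; rewrite !coef_map rmorphM rmorphXn.
have trans (g : {poly k}) : (map_poly phi g).[b] = 0 -> map_poly phi g = 0.
  rewrite evE => /fp pg; suff -> : g = 0 by rewrite rmorph0.
  by apply/eqP/negPn/negP => g0; apply: H; exists g.
have [|a a0 aint] := @generated_integral K [seq f 'X_i | i <- enum 'I_d] _ (adjoin phi b).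
  move=> z; have [x ->] := fsurj z; rewrite (mpolyE x) rmorph_sum.
  set G := generated _ _.
  have G0 : G 0 by rewrite -(rmorph0 (adjoin phi b)); apply: generated_base.
  have G1 : G 1 by rewrite -(rmorph1 (adjoin phi b)); apply: generated_base.
  elim/big_ind: _ => //; first exact: generatedD.
  move=> m _; rewrite -mul_mpolyC rmorphM; apply: generatedM.
    by have := generated_base [seq f 'X_i | i <- enum 'I_d] (adjoin phi b) (x@_m)%:P; rewrite adjoinC.
  rewrite mpolyXE_id rmorph_prod; elim/big_ind: _ => //; first exact: generatedM.
  move=> i _; rewrite rmorphXn; elim: (m i) => [|e IH]; first by rewrite expr0.
  rewrite exprS; apply: generatedM => //; apply: generated_mem.
  by apply: map_f; rewrite mem_enum.
exact: (transcendental_not_integral trans a0 aint).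
Qed.
End Nullstellensatz.

Section DepthOfPolynomials.
Variables (k : fieldType) (d : nat).
Local Notation R := {mpoly k[d]}.

(** The expansion in powers of X_l. Its coefficients, free of X_l, are kept in the same ring, so
    that membership in ideals of R can be asked of them. *)
Definition expand_at (l : 'I_d) : {rmorphism R -> {poly R}} :=
  mmap (polyC \o @mpolyC d k) (fun i => if i == l then 'X else ('X_i : R)%:P).

Lemma expand_atC l c : expand_at l c%:MP = (c%:MP : R)%:P.
Proof. by rewrite /expand_at /= mmapC. Qed.

Lemma expand_atX l i : expand_at l 'X_i = if i == l then 'X else ('X_i : R)%:P.
Proof. by rewrite /expand_at /= mmapX mmap1U. Qed.

Lemma expand_atK l (x : R) : (expand_at l x).['X_l] = x.
Proof.
pose g : {rmorphism R -> R} := horner_eval ('X_l : R) \o expand_at l.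
apply: (mpoly_rmorph_ext (f := g) (g := idfun)) => [c|i] /=; rewrite /horner_eval.
  by rewrite expand_atC hornerC.
by rewrite expand_atX; case: eqP => [->|_]; rewrite ?hornerX ?hornerC.
Qed.

(** Descending induction on the index: modulo the higher coefficients of Z, already in [J], the
    product has the coefficient Z_i times the invertible leading coefficient of G. *)
Lemma coef_ideal_mul (J : set R) (Z G : {poly R}) (u : R) : is_ideal J ->
  u * lead_coef G = 1 -> (forall i, J (Z * G)`_i) -> forall i, J Z`_i.
Proof.
move=> iJ uG ZG.
have G0 : (0 < size G)%N.
  by rewrite size_poly_gt0; apply: contra_eq_neq uG => ->; rewrite lead_coef0 mulr0 eq_sym oner_neq0.
have H n i : (size Z - n <= i)%N -> J Z`_i.
  elim: n i => [|n IH] i; first by rewrite subn0 => zi; rewrite nth_default //; exact: idealT0.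
  move=> ni; have [|lt] := leqP (size Z - n) i; first exact: IH.
  have := ZG (i + (size G).-1)%N; rewrite coefM.
  have lti : (i < (i + (size G).-1).+1)%N by rewrite ltnS leq_addr.
  rewrite (bigD1 (Ordinal lti)) //= addKn -lead_coefE => h.
  have : J (Z`_i * lead_coef G).
    rewrite -(addrK (\sum_(j < (i + (size G).-1).+1 | j != Ordinal lti) Z`_j * G`_(i + (size G).-1 - j)) (_ * _)).
    apply: idealB => //; elim/big_ind: _; [exact: idealT0|by move=> *; apply: idealD|].
    move=> j ji; have [lt_ij|] := ltnP i j.
      by apply: idealM_r => //; apply: IH; move: ni lt_ij => /=; lia.
    rewrite leq_eqVlt => /orP[/eqP e|lt_ji]; first by case/eqP: ji; apply: val_inj.
    rewrite [G`__]nth_default ?mulr0; first exact: idealT0.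
    by move: lt_ji G0 => /=; lia.
  by move=> h'; have := idealM_l u iJ h'; rewrite mulrCA uG mulr1.
by move=> i; apply: (H (size Z)); rewrite subnn.
Qed.

(** For an ideal this means being generated by elements free of X_l. *)
Definition stable_at (J : set R) (l : 'I_d) : Prop :=
  forall f, J f -> forall i, J (expand_at l f)`_i.

Lemma stable_regular (J : set R) l (g : {poly k}) z : is_ideal J -> stable_at J l -> g != 0 ->
  J ((map_poly (@mpolyC d k) g).['X_l] * z) -> J z.
Proof.
move=> iJ sJ g0; set G := map_poly _ g => h.
have GE : expand_at l G.['X_l] = G.
  rewrite /G horner_coef rmorph_sum size_map_poly -[RHS]coefK size_map_poly poly_def.
  apply: eq_bigr => i _; rewrite rmorphM rmorphXn expand_atX eqxx -mul_polyC.
  by rewrite !coef_map /= expand_atC.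
have Jc : forall i, J (expand_at l z)`_i.
  apply: (@coef_ideal_mul J _ G ((lead_coef g)^-1)%:MP) => //.
    by rewrite lead_coef_map -mpolyCM mulVf // lead_coef_eq0.
  by move=> i; rewrite mulrC -{1}GE -rmorphM; apply: sJ.
rewrite -(expand_atK l z) horner_coef; elim/big_ind: _; [exact: idealT0|by move=> *; apply: idealD|].
by move=> i _; apply: idealM_r.
Qed.

Lemma stable_scaled (J : set R) l x : is_ideal J -> stable_at J l -> expand_at l x = x%:P ->
  stable_at (scaled_add (V := R^o) J x setT) l.
Proof.
move=> iJ sJ xE f /scaled_add_ideal [a [b [Ja ->]]] i; apply/scaled_add_ideal.
exists (expand_at l a)`_i, (expand_at l b)`_i; split; first exact: sJ.
by rewrite rmorphD rmorphM xE coefD coefMC.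
Qed.

(** Polynomials g_l(X_l), one for each variable in the list, form a regular sequence: the ideal of
    the earlier ones is stable at the next variable. *)
Lemma cdepth_variables (P : set R) (ls : seq 'I_d) (J : set R) :
  (forall l, exists2 g : {poly k}, g != 0 & P (map_poly (@mpolyC d k) g).['X_l]) ->
  uniq ls -> is_ideal J -> (forall l, l \in ls -> stable_at J l) ->
  cdepth P (setT : set R^o) J (size ls).
Proof.
move=> HP; elim: ls J => [|l ls IH] J /=; first by move=> _ _ _ j.
move=> /andP [nl uls] iJ sJ; have [g g0 Pg] := HP l.
apply: (@cdepth_mod_inv _ P R^o setT J (map_poly (@mpolyC d k) g).['X_l]) => //.
- by move=> z _; apply: stable_regular g0 => //; apply: sJ; rewrite mem_head.
- apply: IH => //; first exact: is_ideal_scaled_add.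
  move=> l' l'ls; apply: stable_scaled => //; first by apply: sJ; rewrite inE l'ls orbT.
  rewrite horner_coef rmorph_sum rmorph_sum; apply: eq_bigr => i _.
  rewrite !rmorphM !rmorphXn coef_map /= expand_atC expand_atX.
  by case: eqP => // e; rewrite e l'ls in nl.
Qed.

Lemma cdepth_mpoly (P : set R) :
  (forall l, exists2 g : {poly k}, g != 0 & P (map_poly (@mpolyC d k) g).['X_l]) ->
  cdepth P (setT : set R^o) [set 0] d.
Proof.
move=> HP; have := @cdepth_variables P (enum 'I_d) [set 0] HP.
rewrite size_enum_ord; apply.
- exact: enum_uniq.
- exact: ideal_zero.
- by move=> l _ f -> i; rewrite rmorph0 coef0.
Qed.

Lemma cdepth_maximal (p : spec R) : is_maximal p -> cdepth p (setT : set R^o) [set 0] d.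
Proof. by move=> pmax; apply: cdepth_mpoly => l; apply: maximal_univariate. Qed.

Lemma cdepth_irrelevant : cdepth (irrelevant_ideal k d) (setT : set R^o) [set 0] d.
Proof.
apply: cdepth_mpoly => l; exists 'X; first by rewrite polyX_eq0.
rewrite map_polyX hornerX; exists 1%N, (fun=> 1), (fun=> 'X_l).
by split; [move=> _; exists l|rewrite big_ord1 mul1r].
Qed.
End DepthOfPolynomials.

(** * Residual intersections *)

Section GeneratedIdeals.
Variable A : comNzRingType.
Implicit Types (S J : set A).

Lemma ideal_sum J (T : Type) (r : seq T) (P : pred T) (F : T -> A) : is_ideal J ->
  (forall i, P i -> J (F i)) -> J (\sum_(i <- r | P i) F i).
Proof.
move=> iJ H; apply: (big_ind J) => //; first exact: idealT0.
by move=> x y; apply: idealD.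
Qed.

Lemma ideal_gen_sub S J : is_ideal J -> S `<=` J -> ideal_gen S `<=` J.
Proof.
move=> iJ SJ x [n [c [s [Ss ->]]]]; apply: ideal_sum => // i _.
by apply: idealM_l => //; apply: SJ.
Qed.

Lemma mem_ideal_gen S x : S x -> ideal_gen S x.
Proof. by move=> Sx; exists 1%N, (fun=> 1), (fun=> x); split=> //; rewrite big_ord1 mul1r. Qed.

Lemma ideal_gen_ideal S : is_ideal (ideal_gen S).
Proof.
split.
- by exists 0%N, (fun=> 0), (fun=> 0); split; [case|rewrite big_ord0].
- move=> x y [n [c [s [Ss ->]]]] [n' [c' [s' [Ss' ->]]]].
  exists (n + n')%N, (fun i => match split i with inl j => c j | inr j => c' j end),
    (fun i => match split i with inl j => s j | inr j => s' j end); split.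
    by move=> i; case: (split i).
  rewrite big_split_ord /=; congr (_ + _); apply: eq_bigr => i _.
    by rewrite (unsplitK (inl i)).
  by rewrite (unsplitK (inr i)).
- move=> a x [n [c [s [Ss ->]]]]; exists n, (fun i => a * c i), s; split=> //.
  by rewrite big_distrr /=; apply: eq_bigr => i _; rewrite mulrA.
Qed.

Lemma ideal_gen_seq (s : seq A) : ideal_gen [set` s] = [set x | spanned s x].
Proof.
apply/seteqP; split=> [|_ [h ->]].
  by apply: ideal_gen_sub => [|x xs]; [exact: dot_ideal|exact: mem_dot].
by apply: dot_mem => [|x xs]; [exact: ideal_gen_ideal|exact: mem_ideal_gen].
Qed.
End GeneratedIdeals.

(** * Depth against the dimension at annihilators *)

Section DepthDimension.
Variable A : comNzRingType.
Hypothesis noeA : noetherian A^o.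

Lemma inL_mem (T : eqType) (x : T) (s : seq T) : inL x s <-> x \in s.
Proof.
elim: s => [|y s IH] //=; rewrite inE; split.
  by move=> [->|/IH ->]; rewrite ?eqxx ?orbT.
by move=> /orP[/eqP ->|/IH]; auto.
Qed.

Lemma ideal_colon1 (J : set A) (u : A) : is_ideal J -> is_ideal (ann (V := A^o) J u).
Proof. by move=> iJ; apply: (@ideal_ann A A^o). Qed.

Lemma span_spanned (n : seq A) : span (V := A^o) n = [set x | spanned n x].
Proof.
apply/seteqP; split=> x.
  elim: n x => [|y n IH] x /=; first by move=> ->; exists [::].
  by move=> [a [w [/IH [h ->] ->]]]; exists (a :: h); rewrite /= /GRing.scale.
move=> [h ->]; elim: n h => [|y n IH] h //=.
by exists (head 0 h), (dot (behead h) n).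
Qed.

Lemma dot_nil (n : seq A) : dot [::] n = 0.
Proof. by elim: n => //= x n ->; rewrite mul0r addr0. Qed.

Lemma spanned0 (n : seq A) : spanned n 0.
Proof. by exists [::]; rewrite dot_nil. Qed.

Lemma dot_scale c (h n : seq A) : c * dot h n = dot [seq c * x | x <- h] n.
Proof.
elim: n h => [|z n IH] [|x h] /=; rewrite ?mulr0 //.
  by rewrite !dot_nil !mul0r !addr0 mulr0.
by rewrite mulrDr mulrA IH.
Qed.

Lemma dot_mem_scaled c (J : set A) (n h : seq A) : is_ideal J ->
  (forall w, inL w n -> J (c * w)) -> J (c * dot h n).
Proof.
move=> iJ; elim: n h => [|w n IH] h Hw; first by rewrite mulr0; apply: idealT0.
rewrite /= mulrDr mulrCA; apply: idealD => //; first by apply: idealM_l => //; apply: Hw; left.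
by apply: IH => y yn; apply: Hw; right.
Qed.

Lemma common_multiplier (p : spec A) (T : Type) (Q : A -> T -> Prop) (s : seq T) :
  (forall a b x, Q a x -> Q (b * a) x) ->
  (forall x, inL x s -> exists2 a, ~ (p : set A) a & Q a x) ->
  exists2 a, ~ (p : set A) a & forall x, inL x s -> Q a x.
Proof.
move=> QM; elim: s => [|y s IH] H; first by exists 1 => //; apply: spec_proper.
have [|a na Ha] := IH; first by move=> x xs; apply: H; right.
have [b nb Hb] := H y (or_introl erefl).
exists (a * b); first exact: spec_mulN.
move=> x /= [<-|xs]; first exact: QM.
by rewrite mulrC; apply: QM; apply: Ha.
Qed.

(* If [x] is regular modulo [J], Nakayama's lemma shows that the elements     *)
(* annihilated by [J : u] do not all vanish modulo [(J, x)] near [p].         *)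
Lemma depth_chain (p : spec A) xs (J : set A) u : is_ideal J ->
  regular (V := A^o) setT J xs -> (forall x, x \in xs -> (p : set A) x) ->
  ann (V := A^o) J u `<=` p ->
  exists c, [/\ prime_chain (size xs) c, ann (V := A^o) J u `<=` c 0%N & (c (size xs) : set A) = p].
Proof.
elim: xs J u => [|x xs IH] J u iJ; first by move=> _ _ Jp; exists (fun=> p).
move=> [xreg reg] xsp Jup; pose J' := scaled_add (V := A^o) J x setT.
have iJ' : is_ideal J' by apply: is_ideal_scaled_add.
pose c : set A := ann (V := A^o) J u.
pose N : set A := [set v | forall a, c a -> J (a * v)].
have iN : is_ideal N.
  split=> [a _|v w Nv Nw a ca|b v Nv a ca]; first by rewrite mulr0; apply: idealT0.
    by rewrite mulrDr; apply: idealD; auto.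
  by rewrite mulrCA; apply: idealM_l; auto.
have Nu : N u by [].
have [v Nv J'v] : exists2 v, N v & ann (V := A^o) J' v `<=` p.
  apply: contrapT => H.
  have [n nN Nn] := noeA iN.
  have [s ns Hs] : exists2 s, ~ (p : set A) s & forall v, inL v n -> J' (s * v).
    apply: (@common_multiplier p _ (fun s v => J' (s * v))).
      by move=> a b v; rewrite -mulrA; apply: idealM_l.
    move=> v vn; apply: contrapT => Hv; apply: H; exists v; first exact: nN.
    by move=> s J's; apply: contrapT => ns; apply: Hv; exists s.
  have [|s' ns' Hs'] := @nakayama A J p n iJ.
    exists s => // v vn; have /scaled_add_ideal [j [w [Jj e]]] := Hs v vn.
    have Nw : N w.
      move=> a ca; apply: xreg => //; rewrite /GRing.scale /=.
      have -> : x * (a * w) = s * (a * v) - a * j by rewrite [s * _]mulrCA e; ring.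
      by apply: idealB => //; [apply: idealM_l; [|apply: nN]|apply: idealM_l].
    have := Nn w Nw; rewrite span_spanned => -[h wE].
    exists (dot [seq x * y | y <- h] n).
      exists [seq x * y | y <- h] => // _ /mapP [y _ ->].
      by apply: idealM_r; [exact: spec_is_ideal|apply: xsp; rewrite mem_head].
    by rewrite -dot_scale -wE e [w * x]mulrC addrK.
  apply: ns'; apply: Jup; have := Nn u Nu; rewrite span_spanned => -[h ->].
  rewrite /ann /= /GRing.scale /=.
  exact: dot_mem_scaled Hs'.
have [|c' [ch' cJ cp]] := IH J' v iJ' reg _ J'v.
  by move=> y yxs; apply: xsp; rewrite inE yxs orbT.
have cc' : c `<=` c' 0%N.
  by move=> a ca; apply: cJ; apply: scaled_addS => //; apply: Nv.
have cx : (c' 0%N : set A) x.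
  by apply/cJ/scaled_add_ideal; exists 0, v; split; [exact: idealT0|rewrite add0r mulrC].
have [|s|q [cq qc nqx]] := @prime_below A c (c' 0%N) x (ideal_colon1 u iJ).
- by move=> s ns cs; apply/ns/cc'.
- by rewrite /c /ann /= [s * x]mulrC -scalerA; apply: xreg.
exists (fun i => if i is i'.+1 then c' i' else q); split=> //.
case=> [|i] il; last exact: ch'.
exact: properP qc cx nqx.
Qed.
End DepthDimension.

Section Residual.
Variables (k : fieldType) (d : nat).
Local Notation R := {mpoly k[d]}.

Definition gdepth (J : set R) (t : nat) : Prop :=
  forall p : spec R, is_maximal p -> cdepth p (setT : set R^o) J t.

Let noeR : noetherian (R^o : lmodType R) := @noetherian_mpoly k d.

(** A maximal ideal p over J : u ends a chain of t primes above one that contains J : u, hence [c].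
    So p has height at least h + t, and [dim_mpoly] applies. *)
Lemma gdepth_height (J c : set R) u t h : is_ideal J -> gdepth J t -> ~ J u ->
  (forall a, c a -> J (a * u)) -> height_ge c h -> (h + t <= d)%N.
Proof.
move=> iJ dJ nJu cu hc.
have [|p pmax Jp] := exists_maximal (ideal_colon1 u iJ).
  by rewrite /ann /= scale1r.
have [|xs [sxs xsp xreg]] := cdepth_regular noeR noeR (spec_is_ideal p) (submodT _) iJ _ (dJ p pmax).
  by [].
have [c' [ch c0 cn]] := depth_chain noeR iJ xreg xsp Jp.
have h0 : prime_height_ge (c' 0%N) h by apply: hc => a /cu/c0.
by have := chain_height ch h0; rewrite sxs => /dim_mpoly.
Qed.

Section Generators.
Variable m : seq R.
Let I : set R := [set x | spanned m x].

Let iI : is_ideal I. Proof. exact: dot_ideal. Qed.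
Let mI x : x \in m -> I x. Proof. exact: mem_dot. Qed.

(* The multipliers carrying [I] into [as_] plus [r] further elements of [I]. *)
Definition generic_bound (as_ : seq R) (r : nat) : set R :=
  [set s | exists us : seq R, [/\ (size us <= r)%N, forall u, u \in us -> I u &
     forall x, I x -> exists y, spanned as_ y /\ spanned us (s * x - y)]].

Lemma spanned_ideal (s : seq R) : is_ideal [set x | spanned s x].
Proof. exact: dot_ideal. Qed.

Lemma spanned_sub (s : seq R) (J : set R) : is_ideal J -> (forall x, x \in s -> J x) ->
  forall y, spanned s y -> J y.
Proof. by move=> iJ sJ y [h ->]; apply: dot_mem. Qed.

Lemma spanned_cat (s t : seq R) x :
  spanned (s ++ t) x <-> exists y z, [/\ spanned s y, spanned t z & x = y + z].
Proof.
split.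
  move=> [h ->]; elim: s h => [|a s IH] h /=.
    by exists 0, (dot h t); split; [exists [::]|exists h|rewrite add0r].
  have [_ [_ [[h1 ->] [h2 ->] ->]]] := IH (behead h).
  by exists (dot (head 0 h :: h1) (a :: s)), (dot h2 t); split; [exists (head 0 h :: h1)|exists h2|rewrite /= addrA].
move=> [y [z [sy tz ->]]]; apply: (idealD (spanned_ideal _)).
  by apply: (spanned_sub (spanned_ideal _) _ sy) => w ws; apply: mem_dot; rewrite mem_cat ws.
by apply: (spanned_sub (spanned_ideal _) _ tz) => w ws; apply: mem_dot; rewrite mem_cat ws orbT.
Qed.

Lemma spanned_cons (a : R) s x : spanned (a :: s) x <-> exists c y, spanned s y /\ x = c * a + y.
Proof.
split=> [[h ->]|[c [_ [[h ->] ->]]]]; last by exists (c :: h).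
by exists (head 0 h), (dot (behead h) s); split; [exists (behead h)|].
Qed.

Lemma spanned_exchange (P : spec R) (us : seq R) y : spanned us y ->
  (exists2 h : seq R, (forall c, c \in h -> (P : set R) c) & y = dot h us) \/
  (exists c u us1 us2, [/\ us = us1 ++ u :: us2, ~ (P : set R) c & spanned (us1 ++ us2) (y - c * u)]).
Proof.
elim: us y => [|u us IH] y; first by move=> [h ->]; left; exists [::].
move=> /spanned_cons [c [z [sz ->]]].
have [Pc|nPc] := pselect ((P : set R) c); last first.
  by right; exists c, u, [::], us; split=> //; rewrite /= [_ + z]addrC addrK.
have [[h hP ->]|[e [v [us1 [us2 [-> nPe hs]]]]]] := IH z sz.
  by left; exists (c :: h) => // x; rewrite inE => /orP[/eqP ->|/hP].
right; exists e, v, (u :: us1), us2; split=> //=.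
apply/spanned_cons; exists c, (z - e * v); split=> //; by rewrite addrA.
Qed.

Section Selection.
Variables (as_ bs : seq R) (b : R) (i : nat).
Let a_ := as_ ++ b :: bs.
Let K : set R := colon [set x | spanned a_ x] I.
Let Kj : set R := colon [set x | spanned as_ x] I.
Hypothesis ie : i = (size as_ + (size bs).+1)%N.
Hypothesis aI : forall x, x \in a_ -> I x.
Hypothesis hK : height_ge K i.
Hypothesis dKj : gdepth Kj (d - size as_).
Hypothesis small : (size as_ < d)%N.
(** The condition G relative to [as_]: near a prime over [I] of height at most size as_ + r, the
    ideal [I] is generated by [as_] and r further elements. *)
Hypothesis hF : forall r, (size as_ + r < i)%N -> forall P : spec R, I `<=` P ->
  generic_bound as_ r `<=` P -> prime_height_ge P (size as_ + r).+1.

Lemma colon_ideal (J L : set R) : is_ideal J -> is_ideal (colon J L).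
Proof.
move=> iJ; split=> [y _|x z hx hz y Ly|c x hx y Ly]; first by rewrite mul0r; apply: idealT0.
  by rewrite mulrDl; apply: idealD; [|apply: hx|apply: hz].
by rewrite -mulrA; apply: idealM_l => //; apply: hx.
Qed.

Let iKj : is_ideal Kj. Proof. exact/colon_ideal/spanned_ideal. Qed.

Let Kj_bound r : Kj `<=` generic_bound as_ r.
Proof.
move=> s Ks; exists [::]; split=> // x Ix; exists (s * x); split; first exact: Ks.
by rewrite subrr; exists [::].
Qed.

Let a_sub x : spanned a_ x -> I x. Proof. exact: spanned_sub. Qed.

(* For a prime [X], the preimage of [as_ + X I] in the localization at [X].   *)
Definition local_image (X : set R) : set R :=
  [set u | exists s y h, [/\ ~ X s, spanned as_ y, (forall c, c \in h -> X c) & s * u = y + dot h m]].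

Lemma dot_coef_sum (X : set R) (h g : seq R) : is_ideal X -> (forall c, c \in h -> X c) ->
  (forall c, c \in g -> X c) ->
  exists2 l : seq R, (forall c, c \in l -> X c) & dot h m + dot g m = dot l m.
Proof.
move=> iX; have head_p (l : seq R) : (forall c, c \in l -> X c) -> X (head 0 l).
  by case: l => [_|c l]; [exact: idealT0|apply; rewrite mem_head].
have behead_p (l : seq R) : (forall c, c \in l -> X c) -> forall c, c \in behead l -> X c.
  by case: l => [//|c l] H z zh; apply: H; rewrite inE zh orbT.
elim: (m) h g => [|z n' IHn] h g ph pg; first by exists [::]; rewrite /= ?addr0.
have [l pl e] := IHn _ _ (behead_p _ ph) (behead_p _ pg).
exists (head 0 h + head 0 g :: l); last by rewrite /= -e mulrDl addrACA.
by move=> c; rewrite inE => /orP[/eqP ->|/pl //]; apply: idealD => //; apply: head_p.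
Qed.

Lemma dot_coef_scale (X : set R) c (h : seq R) : is_ideal X -> (forall c, c \in h -> X c) ->
  exists2 l : seq R, (forall c, c \in l -> X c) & c * dot h m = dot l m.
Proof.
move=> iX hX; exists [seq c * x | x <- h]; last exact: dot_scale.
by move=> _ /mapP [x /hX Xx ->]; apply: idealM_l.
Qed.

Lemma dot_dot (X : set R) (us h : seq R) : (forall u, u \in us -> I u) -> is_ideal X ->
  (forall c, c \in h -> X c) ->
  exists2 g : seq R, (forall c, c \in g -> X c) & dot h us = dot g m.
Proof.
move=> usI iX; elim: us h usI => [|u us IH] h usI hX; first by exists [::]; rewrite ?dot_nil.
have [e ue] := usI u (mem_head _ _).
have [||g gX E] := IH (behead h).
- by move=> w wus; apply: usI; rewrite inE wus orbT.
- by case: (h) hX => [|c l] // hX w wl; apply: hX; rewrite inE wl orbT.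
have h0 : X (head 0 h) by case: (h) hX => [_|c l]; [exact: idealT0|apply; rewrite mem_head].
have [|l lX lE] := @dot_coef_sum X [seq x * head 0 h | x <- e] g iX _ gX.
  by move=> _ /mapP [x _ ->]; apply: idealM_l.
exists l => //; rewrite -lE -E /= ue dot_scale; congr (dot _ _ + _).
by apply: eq_map => x; rewrite mulrC.
Qed.

Lemma local_image_ideal (p : spec R) : is_ideal (local_image p).
Proof.
have ip := spec_is_ideal p; have ia := spanned_ideal as_; split.
- by exists 1, 0, [::]; split; rewrite ?mulr0 ?dot_nil ?add0r //; [exact: spec_proper|exact: spanned0].
- move=> u v [s [y [h [ns sy ph e]]]] [t [z [g [nt tz pg f]]]].
  have [h' ph' e'] := dot_coef_scale t ip ph; have [g' pg' f'] := dot_coef_scale s ip pg.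
  have [l pl el] := dot_coef_sum ip ph' pg'.
  exists (s * t), (t * y + s * z), l; split=> //; first exact: spec_mulN.
    by apply: idealD => //; apply: idealM_l.
  have -> : s * t * (u + v) = t * (s * u) + s * (t * v) by ring.
  by rewrite e f !mulrDr e' f' -el addrACA.
- move=> c u [s [y [h [ns sy ph e]]]]; have [l pl el] := dot_coef_scale c ip ph.
  exists s, (c * y), l; split=> //; first exact: idealM_l.
  by rewrite mulrCA e mulrDr el.
Qed.

(** Otherwise, since [K] multiplies [I] into the ideal of all generators, I = (as_) + p I locally at
    p. Nakayama's lemma then gives I = (as_) there, against [Kj] lying in p. *)
Lemma local_image_proper (p : spec R) : ~ (K `<=` p) -> Kj `<=` p ->
  ~ (local_image p b /\ [set x | spanned bs x] `<=` local_image p).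
Proof.
move=> /existsNP [s /not_implyP [Ks nps]] Kjp [Nb NT].
have iN := local_image_ideal p; have ip := spec_is_ideal p.
have aN x : spanned a_ x -> local_image p x.
  move=> /spanned_cat [y [z [sy /spanned_cons [c [w [sw ->]]] ->]]].
  apply: idealD => //; last by apply: idealD => //; [apply: idealM_l|apply: NT].
  exists 1, y, [::]; split=> //; first exact: spec_proper.
  by rewrite mul1r dot_nil addr0.
have [t nt Ht] : exists2 t, ~ (p : set R) t & forall x, inL x m -> exists y h,
    [/\ spanned as_ y, (forall c, c \in h -> (p : set R) c) & t * x = y + dot h m].
  apply: (@common_multiplier _ p _ (fun t x => exists y h,
    [/\ spanned as_ y, (forall c, c \in h -> (p : set R) c) & t * x = y + dot h m])).
    move=> c e x [y [h [sy ph E]]]; have [l pl el] := dot_coef_scale e ip ph.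
    exists (e * y), l; split=> //; first by apply: (idealM_l _ (spanned_ideal as_)).
    by rewrite -mulrA E mulrDr el.
  move=> x /inL_mem xm; have [t [y [h [nt sy ph E]]]] := aN _ (Ks x (mI xm)).
  exists (t * s); first exact: spec_mulN.
  by exists y, h; rewrite -mulrA.
have [|t' nt' Ht'] := @nakayama R [set x | spanned as_ x] p m (spanned_ideal _).
  exists t => // x xm; have [y [h [sy ph E]]] := Ht x xm.
  by exists (dot h m); [exists h|rewrite E addrK].
by apply/nt'/Kjp => x [h ->]; exact: (dot_mem_scaled _ (spanned_ideal as_) Ht').
Qed.

Lemma inL_filter (T : Type) (P : T -> Prop) (s : seq T) :
  exists t, forall x, inL x t <-> inL x s /\ P x.
Proof.
elim: s => [|y s [t tP]]; first by exists [::] => x; split=> [|[]].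
have [Py|nPy] := pselect (P y).
  by exists (y :: t) => x /=; rewrite tP; split=> [[<-|[]]|[[->|]]]; auto.
by exists t => x; rewrite tP /=; split=> [[]|[[<- //|]]]; auto.
Qed.

(* [b + v] has to avoid the local images at the associated primes of [R / Kj] *)
(* and at the minimal primes of the ideals [I + generic_bound as_ r].         *)
Lemma select_generator : exists v, [/\ spanned bs v,
  forall z, Kj ((b + v) * z) -> Kj z &
  forall r, ((size as_).+1 + r < i)%N -> forall P : spec R, I `<=` P ->
    generic_bound (b + v :: as_) r `<=` P -> prime_height_ge P ((size as_).+1 + r).+1].
Proof.
have [qs [qs1 qs2]] := zero_divisor_primes noeR noeR (submodT _) iKj.
(* An associated prime q of R / Kj is the annihilator of some u. By [gdepth_height] it contains no
   ideal of height above size as_ together with [Kj], which excludes both [I] and [K]. *)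
have qsI q : inL q qs -> [/\ ~ (I `<=` q), ~ (K `<=` q) & Kj `<=` q].
  move=> /qs1 [u [_ nu qu]]; rewrite qu.
  have Kju c : Kj c -> Kj (c * u) by apply: idealM_r.
  split; last exact: Kju.
    move=> Iu; have := @gdepth_height Kj [set y | I y \/ Kj y] u _ (size as_).+1 iKj dKj nu.
    suff hI : height_ge [set y | I y \/ Kj y] (size as_).+1.
      have H2 a : I a \/ Kj a -> Kj (a * u) by move=> [/Iu|/Kju].
      by move=> /(_ H2 hI); move: small; lia.
    move=> P hP; rewrite -[(size as_)]addn0; apply: hF.
    - by rewrite addn0 ie addnS ltnS leq_addr.
    - by move=> x Ix; apply: hP; left.
    move=> s [us [us0 _ Hs]]; apply: hP; right => x Ix.
    have [y [sy]] := Hs x Ix; case: us us0 {Hs} => // _ [h /= /eqP].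
    by rewrite subr_eq0 => /eqP ->.
  move=> Ku; have := @gdepth_height Kj K u _ i iKj dKj nu Ku hK.
  by rewrite ie; move: small; lia.
have cov r : exists ps : seq (spec R), (forall p, inL p ps -> I `<=` p /\ generic_bound as_ r `<=` p) /\
    forall q : spec R, I `<=` q -> generic_bound as_ r `<=` q -> exists2 p, inL p ps & p `<=` q.
  pose S : set R := [set y | I y \/ generic_bound as_ r y].
  have [ps [h1 h2]] := prime_cover noeR (ideal_gen_ideal S); exists ps; split.
    move=> p /h1 Sp; split=> x hx; apply/Sp/mem_ideal_gen; first by left.
    by right.
  move=> q Iq Fq; apply: h2; apply: ideal_gen_sub; first exact: spec_is_ideal.
  by move=> x [/Iq|/Fq].
have [ps [psI psr]] : exists ps : seq (spec R),
    (forall p, inL p ps -> ~ (K `<=` p) /\ Kj `<=` p) /\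
    (forall r (P : spec R), (r < i)%N -> I `<=` P -> generic_bound as_ r `<=` P -> ~ (K `<=` P) ->
       exists2 p, inL p ps & p `<=` P /\ (I `<=` p /\ generic_bound as_ r `<=` p)).
  elim: (i) => [|n [ps [h1 h2]]]; first by exists [::].
  have [cs [c1 c2]] := cov n; have [cs' cs'P] := inL_filter (fun p : spec R => ~ (K `<=` p)) cs.
  exists (cs' ++ ps); split.
    move=> p /inL_cat [/cs'P [/c1 [_ cp] np]|/h1 //]; split=> // s Ks.
    by apply/cp/Kj_bound.
  move=> r P; rewrite ltnS leq_eqVlt => /orP[/eqP ->|rn] IP FP KP.
    have [p pcs pP] := c2 P IP FP; exists p; last by split=> //; apply: c1.
    by apply/inL_cat; left; apply/cs'P; split=> // Kp; apply: KP => x /Kp/pP.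
  by have [p pps H] := h2 r P rn IP FP KP; exists p => //; apply/inL_cat; right.
have bsI v : spanned bs v -> I v.
  by move=> sv; apply: a_sub; apply/spanned_cat; exists 0, v; split; [exact: spanned0|apply/spanned_cons; exists 0, v; rewrite mul0r add0r|rewrite add0r].
have good p : inL p (qs ++ ps) -> ~ (K `<=` p) /\ Kj `<=` p.
  by move=> /inL_cat [/qsI []|/psI].
have [||||v sv Hv] := @coset_avoidance R local_image b [set x | spanned bs x] (qs ++ ps) (spanned_ideal _).
- move=> p _; have iN := local_image_ideal p; split; first exact: idealT0.
  by move=> x y; apply: idealB.
- move=> p r v _ pr /bsI [h ->]; exists 1, 0, [seq r * x | x <- h]; split.
  + exact: spec_proper.
  + exact: (idealT0 (spanned_ideal _)).
  + by move=> _ /mapP [x _ ->]; apply: idealM_r => //; apply: spec_is_ideal.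
  + by rewrite mul1r add0r dot_scale.
- move=> p r v _ npr _ [s [y [h [ns sy ph e]]]]; exists (s * r), y, h; split=> //.
    exact: spec_mulN.
  by rewrite -mulrA.
- by move=> p /good [nK Kp]; apply: local_image_proper.
have Iw : I (b + v).
  apply: idealD => //; last exact: bsI.
  by apply: aI; rewrite mem_cat mem_head orbT.
exists v; split=> //.
  move=> z Kz; apply: contrapT => nKz.
  have [q qqs qw] := qs2 _ _ Logic.I nKz Kz.
  have [/existsNP [e /not_implyP [[h eE] nqe]] _ _] := qsI q qqs.
  apply: (Hv q); first by apply/inL_cat; left.
  exists e, 0, [seq (b + v) * x | x <- h]; split=> //.
  - exact: (idealT0 (spanned_ideal _)).
  - by move=> _ /mapP [x _ ->]; apply: idealM_r => //; apply: spec_is_ideal.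
  - by rewrite add0r -dot_scale -eE mulrC.
move=> r ri P IP FP; apply: contrapT => nh.
have nKP : ~ (K `<=` P) by move=> /hK; apply: contra_not nh; apply: prime_heightW.
have FP' : generic_bound as_ r `<=` P.
  move=> s [us [us1 us2 us3]]; apply: FP; exists us; split=> // x Ix.
  have [y [sy su]] := us3 x Ix; exists y; split=> //.
  by apply/spanned_cons; exists 0, y; rewrite mul0r add0r.
have [p pps [pP [Ip Fp]]] := psr r P (leq_ltn_trans (leq_addl _ _) ri) IP FP' nKP.
have hp : prime_height_ge p (size as_ + r).+1.
  by apply: hF => //; apply: ltn_trans ri; rewrite ltn_add2r.
(* By [hF] the prime p has height at least size as_ + r + 1, and P has no larger height, so that p =
   P. *)
have Pp : P `<=` p.
  move=> x Px; apply: contrapT => npx; apply: nh; rewrite addSn.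
  exact: prime_heightS pP Px npx hp.
have eP : (P : set R) = p by apply/seteqP.
have [s [us [us1 us2 us3] nPs]] : exists2 s, generic_bound as_ r.+1 s & ~ (P : set R) s.
  have : ~ (generic_bound as_ r.+1 `<=` P).
    move=> F1; apply: nh; have := hF _ IP F1; rewrite addnS addSn; apply.
    by rewrite -addSn.
  by move=> /existsNP [s /not_implyP [? ?]]; exists s.
(* Near P, the ideal [I] needs only [as_] and r + 1 elements [us]. As b + v avoids the local image,
   one of its coefficients on [us] is outside P; exchanging that element for b + v leaves r elements
   besides [b + v :: as_]. *)
have [y [sy su]] := us3 _ Iw.
have [[h ph hE]|[c [u [us1' [us2' [usE nPc hs]]]]]] := spanned_exchange P su.
  apply: (Hv p); first by apply/inL_cat; right.
  rewrite -eP; have [g gP gE] := dot_dot us2 (spec_is_ideal P) ph.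
  by exists s, y, g; split=> //; rewrite -gE -hE [y + _]addrC subrK.
apply: (spec_mulN nPs nPc); apply: FP.
exists (us1' ++ us2'); split.
- by move: us1; rewrite usE !size_cat /= addnS ltnS.
- by move=> z zus; apply: us2; rewrite usE mem_cat inE; move: zus; rewrite mem_cat => /orP[->|->]; rewrite ?orbT.
move=> x Ix; have [y' [sy' su']] := us3 x Ix.
move: su'; rewrite usE => /spanned_cat [z1 [_ [sz1 /spanned_cons [e [z2 [sz2 ->]]] E]]].
have iU := spanned_ideal (us1' ++ us2'); have iA := spanned_ideal as_.
exists (e * s * (b + v) + (c * y' - e * y)); split.
  apply/spanned_cons; exists (e * s), (c * y' - e * y); split=> //.
  by apply: (idealB iA); apply: (idealM_l _ iA).
have -> : s * c * x - (e * s * (b + v) + (c * y' - e * y)) =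
    c * (z1 + z2) - e * (s * (b + v) - y - c * u).
  have -> : z1 + z2 = s * x - y' - e * u by rewrite E; ring.
  by ring.
apply: (idealB iU); apply: (idealM_l _ iU) => //.
by apply/spanned_cat; exists z1, z2.
Qed.
End Selection.

Hypothesis slides_m : forall p : spec R, is_maximal p -> slides p m [set 0] d.
Hypothesis I_neq0 : exists2 x, I x & x <> 0.
Hypothesis I_Ginf : forall (P : spec R) r, I `<=` P -> ~ prime_height_ge P r.+1 ->
  exists s us, [/\ ~ (P : set R) s, (size us <= r)%N, forall u, u \in us -> I u &
    forall x, I x -> spanned us (s * x)].

(** One generic element at a time moves from [bs] to [as_]. The hypotheses carried along are sliding
    depth and depth modulo [Kj], the inclusion of [Kj] meet [I] in the ideal of [as_], and the
    relative condition G. *)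
Lemma residual_step (bs as_ : seq R) (Kj := colon [set x | spanned as_ x] I)
    (K := colon [set x | spanned (as_ ++ bs) x] I) :
  (forall x, x \in as_ ++ bs -> I x) -> height_ge K (size as_ + size bs) ->
  (forall p : spec R, is_maximal p -> slides p m Kj (d - size as_)) ->
  gdepth Kj (d - size as_) -> (forall y, Kj y -> I y -> spanned as_ y) ->
  (forall r, (size as_ + r < size as_ + size bs)%N -> forall P : spec R, I `<=` P ->
    generic_bound as_ r `<=` P -> prime_height_ge P (size as_ + r).+1) ->
  gdepth K (d - (size as_ + size bs)).
Proof.
elim: bs as_ @Kj @K => [|b bs IH] as_ Kj K asI hK sl dK KI hF.
  by rewrite /K cats0 addn0.
have [ds|small] := leqP d (size as_).
  have -> : (d - (size as_ + size (b :: bs)) = 0)%N by move: ds => /=; lia.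
  by move=> p pm j.
have [v [sv vreg vF]] := select_generator erefl asI hK dK small hF.
set a' := b + v in vreg vF; set as' := a' :: as_ in vF.
have spanE x : spanned (as_ ++ b :: bs) x <-> spanned (as' ++ bs) x.
  split.
    move=> /spanned_cat [y [_ [sy /spanned_cons [c [z [sz ->]]] ->]]].
    apply/spanned_cons; exists c, (y + (z - c * v)); split; last by rewrite /a'; ring.
    apply/spanned_cat; exists y, (z - c * v); split=> //.
    by apply: (idealB (spanned_ideal bs)) => //; apply: (idealM_l _ (spanned_ideal bs)).
  move=> /spanned_cons [c [_ [/spanned_cat [y [z [sy sz ->]]] ->]]].
  apply/spanned_cat; exists y, (c * b + (z + c * v)); split=> //; last by rewrite /a'; ring.
  apply/spanned_cons; exists c, (z + c * v); split=> //.
  by apply: (idealD (spanned_ideal bs)) => //; apply: (idealM_l _ (spanned_ideal bs)).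
have KE : K = colon [set x | spanned (as' ++ bs) x] I.
  by congr (colon _ _); apply/seteqP; split=> x /spanE.
have Isp x : spanned (as' ++ bs) x -> I x.
  by move=> /spanE; apply: spanned_sub.
have as'I x : x \in as' ++ bs -> I x by move=> xa; apply/Isp/mem_dot.
have spI x : spanned as' x -> I x.
  by apply: spanned_sub => // y ya; apply: as'I; rewrite mem_cat ya.
have aI : I a' by apply: as'I; rewrite mem_head.
have iKj : is_ideal Kj by apply/colon_ideal/spanned_ideal.
have spKj x : spanned as_ x -> Kj x by move=> sx y _; apply: (idealM_r _ (spanned_ideal as_)).
pose K' : set R := scaled_add (V := R^o) Kj a' setT.
pose K2 : set R := colon [set x | spanned as' x] I.
have iK' : is_ideal K' by apply: is_ideal_scaled_add.
have spK' x : spanned as' x -> K' x.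
  move=> /spanned_cons [c [y [sy ->]]]; apply/scaled_add_ideal.
  by exists y, c; rewrite addrC; split=> //; apply: spKj.
have K'sp x : K' x -> I x -> spanned as' x.
  move=> /scaled_add_ideal [y [c [Ky ->]]] Ix; apply/spanned_cons; exists c, y.
  rewrite addrC; split=> //; apply: KI => //; rewrite -(addrK (c * a') y).
  by apply: idealB => //; apply: idealM_l.
(* [K'] meets [I] exactly in the ideal of [as'], so [K2] is also the colon ideal K' : I to which the
   Koszul step applies. *)
have K2E y : K2 y <-> forall x, x \in m -> K' (y * x).
  split=> [K2y x xm|H x [h ->]]; first by apply/spK'/K2y/mI.
  apply: (dot_mem_scaled _ (spanned_ideal as')) => w /inL_mem wm.
  exact: (K'sp _ (H w wm) (idealM_l _ iI (mI wm))).
have [e eE] : exists e, (d - size as_ = e.+1)%N.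
  by exists (d - (size as_).+1)%N; move: small; lia.
have eE' : (d - size as' = e)%N by rewrite /as' /=; lia.
rewrite eE in dK sl.
have dK' : gdepth K' (d - size as').
  by rewrite eE' => p pm; apply: (cdepth_step iKj vreg (dK p pm)).
have dK2 : gdepth K2 (d - size as').
  by rewrite eE' => p pm; apply: (cdepth_residual iKj aI vreg (dK p pm) (sl p pm) K2E).
rewrite KE in hK *; rewrite /= addnS -addSn -/(size as') in hK vF *.
have [bs0|bs1] := eqVneq bs [::]; first by rewrite bs0 cats0 addn0.
have {}bs1 : (0 < size bs)%N by case: (bs) bs1.
(* Both [I] and [K2] multiply y into [K']. Their sum has height above size as', which the depth of R
   / K' allows only if y is zero modulo [K']. *)
have K2I y : K2 y -> I y -> K' y.
  move=> K2y Iy; apply: contrapT => nK.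
  have H a : [set a | I a \/ K2 a] a -> K' (a * y).
    by move=> [Ia|/(_ y Iy)]; [rewrite mulrC; apply/spK'/K2y|apply: spK'].
  have := gdepth_height iK' dK' nK H (h := (size as').+1).
  suff hh : height_ge [set a | I a \/ K2 a] (size as').+1 by move=> /(_ hh); rewrite /as' /=; move: small; lia.
  move=> P hP; rewrite -[size as']addn0; apply: vF => //=; first by lia.
    by move=> x Ix; apply: hP; left.
  move=> s [us [us0 _ Hs]]; apply: hP; right=> x Ix.
  have [y' [sy' su]] := Hs x Ix; move: su; case: us us0 {Hs} => // _ [h /= /eqP].
  by rewrite subr_eq0 => /eqP ->.
apply: (IH as') => //=.
- by move=> p pm; rewrite eE'; apply: (slides_residual iKj iI mI aI vreg (dK p pm) (sl p pm) K2E K2I).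
- by move=> y K2y Iy; apply: K'sp => //; apply: K2I.
Qed.

Lemma residual_depth (bs : seq R) : (forall x, x \in bs -> I x) ->
  height_ge (colon [set x | spanned bs x] I) (size bs) ->
  gdepth (colon [set x | spanned bs x] I) (d - size bs).
Proof.
have K0 : colon [set x | spanned [::] x] I = [set 0].
  apply/seteqP; split=> y; last by move=> -> x _ /=; rewrite mul0r; apply: spanned0.
  have [x Ix /eqP x0] := I_neq0; move=> /(_ x Ix) [h /= /eqP].
  by rewrite mulf_eq0 (negPf x0) orbF => /eqP.
move=> bsI hK; apply: (@residual_step bs [::]) => //; rewrite ?K0 ?subn0 //.
- by move=> p pm; apply: cdepth_maximal.
- by move=> y -> _; apply: spanned0.
move=> r _ P IP FP; apply: contrapT => /(I_Ginf IP) [s [us [nPs us1 us2 us3]]].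
apply/nPs/FP; exists us; split=> // x Ix; exists 0; rewrite subr0.
by split; [exact: spanned0|exact: us3].
Qed.
End Generators.
End Residual.

(** * Lex-segment ideals *)

Section Monomials.
Variables (k : fieldType) (d : nat).
Local Notation R := {mpoly k[d]}.
Implicit Types (Q : 'X_{1..d} -> Prop) (u v w : 'X_{1..d}).

Definition supported Q : set R := [set f | forall w, w \in msupp f -> Q w].

Lemma supported_ideal Q : (forall v w, Q w -> Q (v + w)%MM) -> is_ideal (supported Q).
Proof.
move=> QD; split=> [w|f g hf hg w|f g hg w]; first by rewrite msupp0.
  by move=> /msuppD_le; rewrite mem_cat => /orP[/hf|/hg].
by move=> /msuppM_le /allpairsP [[u v] /= [_ /hg Qv ->]]; apply: QD.
Qed.

Lemma supportedX Q w : supported Q 'X_[w] <-> Q w.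
Proof.
split=> [|Qw v]; first by apply; rewrite msuppX mem_head.
by rewrite msuppX inE => /eqP ->.
Qed.

Lemma ideal_supported (J : set R) f : is_ideal J ->
  (forall w, w \in msupp f -> J 'X_[w]) -> J f.
Proof.
move=> iJ H; rewrite [f]mpolyE big_seq; apply: ideal_sum => // w wf.
by rewrite -mul_mpolyC; apply: idealM_l => //; apply: H.
Qed.

Lemma monomial_supported (L : set R) : monomial_ideal L ->
  L = supported (fun w => L 'X_[w]).
Proof.
move=> [S LE]; have iL : is_ideal L by rewrite LE; apply: ideal_gen_ideal.
apply/seteqP; split=> f; last exact: ideal_supported.
have iS : is_ideal (supported (fun w => L 'X_[w])).
  by apply: supported_ideal => v w; rewrite mpolyXD; apply: idealM_l.
rewrite {1}LE; apply: ideal_gen_sub => // _ [m Sm <-]; apply/supportedX.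
by rewrite LE; apply: mem_ideal_gen; exists m.
Qed.

Lemma irrelevant_ideal_ideal : is_ideal (irrelevant_ideal k d).
Proof. exact: ideal_gen_ideal. Qed.

Lemma ideal_pow_ideal (A : comNzRingType) (J : set A) n : is_ideal (ideal_pow J n).
Proof. by case: n => [|n] //=; apply: ideal_gen_ideal. Qed.

Lemma irrelevant_pow_supported n :
  ideal_pow (irrelevant_ideal k d) n = supported (fun w => (n <= mdeg w)%N).
Proof.
have iS n' : is_ideal (supported (fun w => (n' <= mdeg w)%N)).
  by apply: supported_ideal => v w h; rewrite mdegD; apply: leq_trans h (leq_addl _ _).
have iP := ideal_pow_ideal (irrelevant_ideal k d).
apply/seteqP; split=> f.
  elim: n f => [|n IH] f //=; apply: ideal_gen_sub => // _ [y [z [my /IH Sz ->]]] w.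
  move=> /msuppM_le /allpairsP [[u v] /= [uy vz ->]]; rewrite mdegD -add1n leq_add ?Sz //.
  suff : supported (fun w => (1 <= mdeg w)%N) y by apply.
  move: my; apply: ideal_gen_sub => // _ [i _ <-]; apply/supportedX.
  by rewrite mdeg1.
move=> Sf; apply: ideal_supported => // w /Sf {Sf f}.
elim: n w => [|n IH] w //= nw.
have [i wi] : exists i, w i != 0%N.
  apply: contrapT => /forallNP w0; suff : mdeg w = 0%N by move: nw; case: mdeg.
  by rewrite mdegE big1 // => i _; apply/eqP; have /negP := w0 i; rewrite negbK.
have wE : w = (U_(i) + (w - U_(i)))%MM by rewrite addmC submK // lep1mP.
apply: mem_ideal_gen; exists 'X_i, 'X_[w - U_(i)]; split.
- by apply: mem_ideal_gen; exists i.
- by apply: IH; move: nw; rewrite {1}wE mdegD mdeg1.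
- by rewrite -mpolyXD -wE.
Qed.

Lemma saturation_supported (L : set R) : monomial_ideal L ->
  saturation L (irrelevant_ideal k d) =
  supported (fun w => exists n, forall v, mdeg v = n -> L 'X_[v + w]).
Proof.
move=> mL; have LE := monomial_supported mL.
have iL : is_ideal L by case: mL => S ->; apply: ideal_gen_ideal.
have LS v w : L 'X_[w] -> L 'X_[v + w] by rewrite mpolyXD; apply: idealM_l.
apply/seteqP; split=> f.
  move=> [n Hn] w wf; exists n => v vn.
  have : L (f * 'X_[v]).
    by apply: Hn; rewrite irrelevant_pow_supported; apply/supportedX; rewrite vn.
  rewrite {1}LE => /(_ (v + w)%MM); apply; rewrite (perm_mem (msuppMX _ _)); exact: map_f.
move=> Sf.
(* One power of the irrelevant ideal serves all the finitely many terms of f, since a monomial of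
   large degree is divisible by one of any prescribed smaller degree. *)
have [n Hn] : exists n, forall w, w \in msupp f -> forall v, (n <= mdeg v)%N -> L 'X_[v + w].
  move: Sf; rewrite /supported /=; elim: (msupp f) => [|w s IH] Sf; first by exists 0%N.
  have [|n Hn] := IH; first by move=> v vs; apply: Sf; rewrite inE vs orbT.
  have [n' Hn'] := Sf w (mem_head _ _); exists (n' + n)%N => u.
  rewrite inE => /orP[/eqP ->|us] v nv; last by apply: Hn => //; apply: leq_trans (leq_addl _ _) nv.
  have [v' v'n [v'' ->]] : exists2 v', mdeg v' = n' & exists v'', v = (v'' + v')%MM.
    have : (n' <= mdeg v)%N by apply: leq_trans (leq_addr _ _) nv.
    elim: (n') => [|m IHm] mv; first by exists 0%MM; [exact: mdeg0|exists v; rewrite addm0].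
    have [v' v'm [v'' vE]] := IHm (ltnW mv).
    have [i vi] : exists i, v'' i != 0%N.
      apply: contrapT => /forallNP w0; suff : mdeg v'' = 0%N.
        by move: mv; rewrite vE mdegD v'm => + v0; rewrite v0 ltnn.
      by rewrite mdegE big1 // => i _; apply/eqP; have /negP := w0 i; rewrite negbK.
    exists (U_(i) + v')%MM; first by rewrite mdegD mdeg1 v'm.
    by exists (v'' - U_(i))%MM; rewrite addmA submK ?lep1mP.
  by rewrite -addmA; apply/LS/Hn'.
exists n => y; rewrite irrelevant_pow_supported => Sy; rewrite {1}LE => w.
move=> /msuppM_le /allpairsP [[u v] /= [uf vy ->]]; rewrite addmC.
exact/Hn/Sy.
Qed.

Fixpoint lex_le (ls : seq 'I_d) u v : Prop :=
  if ls is l :: ls' then (u l < v l)%N \/ (u l = v l /\ lex_le ls' u v) else True.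

Lemma lex_le_refl ls u : lex_le ls u u.
Proof. by elim: ls => //= l ls IH; right. Qed.

Lemma lex_le_trans ls u v w : lex_le ls u v -> lex_le ls v w -> lex_le ls u w.
Proof.
elim: ls => //= l ls IH [a|[a b]] [c|[c e]].
- by left; apply: ltn_trans c.
- by left; rewrite -c.
- by left; rewrite a.
- by right; rewrite a c; split=> //; apply: IH.
Qed.

Lemma lex_le_add ls u v w : lex_le ls u v -> lex_le ls u (w + v)%MM.
Proof.
elim: ls => //= l ls IH; rewrite mnmDE => -[a|[a /IH b]]; first by left; lia.
by case: (w l) => [|n]; [right|left; lia].
Qed.

Lemma lex_le_eq ls u u' v : (forall l, l \in ls -> u l = u' l) -> lex_le ls u v -> lex_le ls u' v.
Proof.
elim: ls => //= l ls IH H; rewrite -(H l (mem_head _ _)) => -[a|[a b]]; first by left.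
by right; split=> //; apply: IH => // i il; apply: H; rewrite inE il orbT.
Qed.

Lemma lex_le_lt (ls : seq 'I_d) u v (i : 'I_d) : sorted ltn [seq val l | l <- ls] -> i \in ls ->
  (forall j : 'I_d, (j < i)%N -> u j = v j) -> (u i < v i)%N -> ~ lex_le ls v u.
Proof.
move=> + + uv uvi; elim: ls => //= l ls IH so; rewrite inE.
have [<- _|il /= ils] := eqVneq i l; first by case=> [a|[a _]]; lia.
have li : (l < i)%N.
  move: so; rewrite path_sortedE; last exact: ltn_trans.
  by move=> /andP[/allP h _]; apply: h; apply: map_f.
by rewrite (uv l li) => -[|[_]]; [rewrite ltnn|apply: IH => //; apply: path_sorted so].
Qed.

Fixpoint lex_above (s : seq ('I_d * nat)) w : Prop :=
  if s is (l, c) :: s' then (c < w l)%N \/ (c = w l /\ lex_above s' w) else True.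

Lemma lex_least Q ls : (forall u v, Q u -> lex_le ls u v -> Q v) -> (exists w, Q w) ->
  exists2 s, unzip1 s = ls & forall w, Q w <-> lex_above s w.
Proof.
elim: ls Q => [|l ls IH] Q QM [w0 Qw0].
  by exists [::] => // w; split=> // _; apply: QM Qw0 _.
have ex : exists n, `[< exists2 w, Q w & w l = n >] by exists (w0 l); apply/asboolP; exists w0.
case: (ex_minnP ex) => c /asboolP [w1 Qw1 w1c] cmin.
(* Forgetting the first coordinate: the slice of [Q] at its least first exponent c, closed upward in
   the remaining variables. *)
pose Q' w := exists2 w', Q w' /\ w' l = c & lex_le ls w' w.
have [||s sE sQ] := IH Q'.
- by move=> u v [w' Qw' w'u] uv; exists w' => //; apply: lex_le_trans uv.
- by exists w1, w1 => //; apply: lex_le_refl.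
exists ((l, c) :: s); rewrite /= ?sE // => w; split=> [Qw|[cw|[cw /sQ [w' [Qw' w'c] w'w]]]].
- have : (c <= w l)%N by apply: cmin; apply/asboolP; exists w.
  rewrite leq_eqVlt => /orP[/eqP cw|]; [right; split=> //|by left].
  by apply/sQ; exists w; [|exact: lex_le_refl].
- by apply: QM Qw1 _; left; rewrite w1c.
- by apply: QM Qw' _; right; rewrite w'c.
Qed.

Section LexSegment.
Variable L : set R.
Hypothesis hL : lex_segment_ideal L.

Lemma mem_lex_monomials w i : (w \in lex_monomials d i) = (mdeg w == i).
Proof.
rewrite mem_sort mem_filter; have [wi|//] := eqVneq (mdeg w) i.
have wi' : (mdeg w < i.+1)%N by rewrite wi.
by apply/mapP; exists (BMultinom wi') => //; rewrite mem_enum.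
Qed.

Lemma lex_segment_up v w : mdeg v = mdeg w -> (v <= w)%O -> L 'X_[v] -> L 'X_[w].
Proof.
move=> vw le Lv; have [_ /(_ (mdeg v)) [r _ H]] := hL.
have [vr|nv] := boolP (v \in take r (lex_monomials d (mdeg v))); last first.
  have hv : ('X_[v] : R) \is (mdeg v).-homog for mdeg by rewrite dhomogX.
  have [c /(congr1 (mcoeff v))] := (H 'X_[v]).1 (conj Lv hv).
  rewrite mcoeffX eqxx raddf_sum big_seq big1 => [/eqP|m mr]; first by rewrite oner_eq0.
  rewrite /= mcoeffZ mcoeffX; case: eqP mr nv => [->|_ _ _]; last by rewrite mulr0.
  by move=> ->.
have wr : w \in take r (lex_monomials d (mdeg v)).
  have wl : w \in lex_monomials d (mdeg v) by rewrite mem_lex_monomials vw.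
  have vl : v \in lex_monomials d (mdeg v) by rewrite mem_lex_monomials.
  move: vr; rewrite !in_take //; apply: leq_ltn_trans.
  rewrite leqNgt; apply/negP => vw'.
  have so : sorted (fun m1 m2 : 'X_{1..d} => (m2 <= m1)%O) (lex_monomials d (mdeg v)).
    by apply: sort_sorted => x y; apply: le_total.
  have ge_trans : transitive (fun m1 m2 : 'X_{1..d} => (m2 <= m1)%O).
    by move=> x y z a b; apply: le_trans b a.
  have wv : (w <= v)%O.
    exact: (sorted_leq_index ge_trans (fun x => lexx x) so _ _ vl wl (ltnW vw')).
  by move: vw'; rewrite (@le_anti _ _ v w) ?ltnn // le wv.
apply: ((H 'X_[w]).2 _).1; exists (fun m => (m == w)%:R).
rewrite (bigD1_seq w) ?take_uniq //=.
  by rewrite eqxx scale1r big1 ?addr0 // => m /negPf ->; rewrite scale0r.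
rewrite sort_uniq filter_uniq // map_inj_uniq ?enum_uniq //; exact: val_inj.
Qed.

(** All variables but the last, whose powers only serve to adjust degrees. *)
Definition sat_variables : seq 'I_d := [seq i : 'I_d <- enum 'I_d | (i.+1 < d)%N].

Lemma lex_le_mnm u v : mdeg u = mdeg v -> lex_le sat_variables u v -> (u <= v)%O.
Proof.
move=> uv le; rewrite leNgt; apply/negP => /(ltmcP (esym uv)) [i ij ui].
have so : sorted ltn [seq val l | l <- sat_variables].
  apply: (subseq_sorted ltn_trans (s2 := [seq val l | l <- enum 'I_d])).
    by apply: map_subseq; apply: filter_subseq.
  by rewrite val_enum_ord; apply: iota_ltn_sorted.
have [il|ni] := boolP (i \in sat_variables); first exact: lex_le_lt so il ij ui le.
have id : (d <= i.+1)%N by move: ni; rewrite mem_filter mem_enum andbT -leqNgt.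
move: uv; rewrite !mdegE (bigD1 i) //= [RHS](bigD1 i) //=.
suff -> : (\sum_(j < d | j != i) u j = \sum_(j < d | j != i) v j)%N by move=> /addIn uvi; move: ui; rewrite uvi ltnn.
apply: eq_bigr => j ji; rewrite ij //; have := ltn_ord j; move: ji; rewrite -val_eqE /=; lia.
Qed.

Lemma saturation_lex_up u v :
  (exists n, forall w, mdeg w = n -> L 'X_[w + u]) -> lex_le sat_variables u v ->
  exists n, forall w, mdeg w = n -> L 'X_[w + v].
Proof.
have iL : is_ideal L by case: hL => -[S ->] _; apply: ideal_gen_ideal.
move=> [n Hn] uv; exists (n + mdeg u)%N => w wn.
have [d0|d0] := posnP d.
  have -> : (w + v = w + u)%MM by apply/mnmP; move: (w) (u) (v); rewrite d0 => ? ? ? [].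
  have -> : (w + u = u + (w + u))%MM by apply/mnmP; move: (w) (u) (v); rewrite d0 => ? ? ? [].
  rewrite mpolyXD; apply: idealM_l => //; apply: Hn.
  suff u0 : mdeg u = 0%N by rewrite wn u0 addn0.
  by rewrite mdegE big1 // => i; have := ltn_ord i; rewrite {2}d0.
have lst : (d.-1 < d)%N by rewrite prednK.
(* z has the degree of w + v and precedes it in the order, as only the last exponent of u was
   raised. It lies in L because it is divisible by x_l^n u. *)
pose l := Ordinal lst; pose z := (U_(l) *+ (n + mdeg v) + u)%MM.
apply: (@lex_segment_up z) => [||].
- by rewrite /z !mdegD mdegMn mdeg1 mul1n wn; lia.
- apply: lex_le_mnm; first by rewrite /z !mdegD mdegMn mdeg1 mul1n wn; lia.
  apply: lex_le_add; apply: lex_le_eq uv => i; rewrite mem_filter => /andP[id _].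
  by rewrite /z mnmDE mulmnE mnm1E -val_eqE /= (_ : (d.-1 == i) = false) //; lia.
- have -> : z = (U_(l) *+ mdeg v + (U_(l) *+ n + u))%MM by apply/mnmP => i; rewrite /z !mnmDE !mulmnE; lia.
  rewrite mpolyXD; apply: idealM_l => //; apply: Hn.
  by rewrite mdegMn mdeg1 mul1n.
Qed.

Lemma saturation_lex (Ls := saturation L (irrelevant_ideal k d)) :
  Ls = [set 0] \/ exists2 s, unzip1 s = sat_variables & Ls = supported (lex_above s).
Proof.
rewrite /Ls saturation_supported; last by case: hL.
set Q := fun w => _; have [[w Qw]|noQ] := pselect (exists w, Q w); [right|left].
  have [|s sE sQ] := @lex_least Q sat_variables _ (ex_intro _ w Qw).
    by move=> u v; apply: saturation_lex_up.
  by exists s => //; apply/seteqP; split=> f h v /h /sQ.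
apply/seteqP; split=> f /=; last by move=> -> w; rewrite msupp0.
move=> h; apply/eqP; rewrite -msupp_eq0; case e : (msupp f) => [//|w s].
by case: noQ; exists w; apply: h; rewrite e mem_head.
Qed.
End LexSegment.

(* The generators of x_1^c_1 (x_1, x_2^c_2 (x_2, ...)).                       *)
Fixpoint lex_gens (s : seq ('I_d * nat)) : seq R :=
  if s is (l, c) :: s' then [seq 'X_l ^+ c * x | x <- 'X_l :: lex_gens s'] else [:: 1].

Lemma dot_map (y : R) h (m : seq R) : dot h [seq y * x | x <- m] = y * dot h m.
Proof. by elim: m h => [|x m IH] h /=; rewrite ?mulr0 // IH mulrDr mulrCA. Qed.

Lemma lex_above_add s v w : lex_above s w -> lex_above s (v + w)%MM.
Proof.
elim: s => //= -[l c] s IH; rewrite mnmDE => -[a|[a /IH b]]; first by left; lia.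
by case: (v l) => [|n]; [right|left; lia].
Qed.

Lemma lex_above_eq s v w : (forall l, l \in unzip1 s -> v l = w l) -> lex_above s v -> lex_above s w.
Proof.
elim: s => //= -[l c] s IH H; rewrite -(H l (mem_head _ _)) => -[a|[a b]]; first by left.
by right; split=> //; apply: IH => // i il; apply: H; rewrite inE il orbT.
Qed.

Lemma lex_gens_monomial s x : x \in lex_gens s -> exists2 w, x = 'X_[w] & lex_above s w.
Proof.
elim: s x => [|[l c] s IH] x /=.
  by rewrite inE => /eqP ->; exists 0%MM => //; rewrite mpolyX0.
rewrite inE => /orP[/eqP ->|/mapP [_ /IH [w -> sw] ->]].
  exists (U_(l) *+ c + U_(l))%MM; first by rewrite mpolyXD mpolyXn.
  by left; rewrite mnmDE mulmnE mnm1E eqxx mul1n; lia.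
exists (U_(l) *+ c + w)%MM; first by rewrite mpolyXD mpolyXn.
rewrite mnmDE mulmnE mnm1E eqxx mul1n.
case: (w l) => [|n]; [right; split; first by rewrite addn0|left; lia].
exact: lex_above_add.
Qed.

Lemma spanned_lex_gens s : uniq (unzip1 s) ->
  [set x | spanned (lex_gens s) x] = supported (lex_above s).
Proof.
move=> us; apply/seteqP; split=> f.
  apply: spanned_sub; first by apply: supported_ideal => v w; apply: lex_above_add.
  by move=> _ /lex_gens_monomial [w -> sw]; apply/supportedX.
move=> Sf; apply: ideal_supported; first exact: spanned_ideal.
move=> w /Sf {Sf f}; elim: s us w => [|[l c] s IH] /=.
  by move=> _ w _; exists [:: 'X_[w]]; rewrite /= mulr1 addr0.
move=> /andP[ls us] w cw; have iU := spanned_ideal (lex_gens ((l, c) :: s)).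
have cle : (c <= w l)%N by case: cw => [/ltnW //|[-> _]].
have wE : w = (U_(l) *+ c + (w - U_(l) *+ c))%MM.
  by apply/mnmP => i; rewrite mnmDE mnmBE mulmnE mnm1E; case: eqP => [<-|_]; lia.
rewrite wE mpolyXD -mpolyXn; set v := (w - _)%MM.
suff [h ->] : spanned ('X_l :: lex_gens s) 'X_[v] by exists h; exact: esym (dot_map _ h ('X_l :: _)).
case: cw => [cw|[cw sw]].
  have vl : v l != 0%N by rewrite mnmBE mulmnE mnm1E eqxx; lia.
  exists [:: 'X_[v - U_(l)]]; rewrite /= dot_nil addr0 -mpolyXD submK // lep1mP //.
have [|h hE] := IH us v; last by exists (0 :: h); rewrite /= mul0r add0r.
apply: lex_above_eq sw => i il; rewrite mnmBE mulmnE mnm1E.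
by case: eqP => [li|_]; [move: ls; rewrite li il|rewrite mul0n subn0].
Qed.

Lemma exists_retraction (l : 'I_d) : {f : {rmorphism R -> R} |
  (forall i, f 'X_i = if i == l then 0 else 'X_i) /\
  forall x, exists y, x = f x + 'X_l * y}.
Proof.
pose f : {rmorphism R -> R} := horner_eval (0 : R) \o expand_at k l.
exists f; split=> [i|x].
  by rewrite /f /= /horner_eval expand_atX; case: eqP; rewrite ?hornerX ?hornerC.
have /factor_theorem [q qE] : root (expand_at k l x - (f x)%:P) 0.
  by rewrite rootE hornerD hornerN hornerC subrr.
exists q.['X_l]; rewrite -{1}(expand_atK l x) -(subrK (f x)%:P (expand_at k l x)) qE.
by rewrite subr0 !(hornerD, hornerM, hornerX, hornerC) addrC mulrC.
Qed.

Definition kill_variable l : {rmorphism R -> R} := sval (exists_retraction l).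

Lemma kill_variableX l i : kill_variable l 'X_i = if i == l then 0 else 'X_i.
Proof. exact: (svalP (exists_retraction l)).1. Qed.

Lemma kill_variableE l (x : R) : exists y, x = kill_variable l x + 'X_l * y.
Proof. exact: (svalP (exists_retraction l)).2. Qed.

(** From the unit ideal, each level adjoins a variable absent from the previous generators and then
    scales everything by a power of it. *)
Lemma slides_lex_gens (J : set R) s : uniq (unzip1 s) ->
  cdepth J (setT : set R^o) [set 0] d -> slides J (lex_gens s) [set 0] d.
Proof.
move=> us d0; elim: s us => [_|[l c] s IH /= /andP[ls us]]; first exact: slides_one.
have X0 (i : 'I_d) : 'X_i != 0 :> R by rewrite -msupp_eq0 msuppX.
have Xreg e (z : R) : 'X_l ^+ e * z = 0 -> z = 0.
  by move=> /eqP; rewrite mulf_eq0 expf_eq0 (negPf (X0 l)) andbF => /eqP.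
apply: (slides_iso (cycle_iso_scale ('X_l :: lex_gens s) (Xreg c))).
apply: (slides_cons d0) (IH us).
apply: (@retraction_reg _ 'X_l (kill_variable l)) => //.
- exact: (Xreg 1%N).
- by rewrite kill_variableX eqxx.
- exact: kill_variableE.
have pX i : l != i -> kill_variable l 'X_i = 'X_i.
  by rewrite kill_variableX eq_sym => /negPf ->.
move: (kill_variable l) pX => pi pX; elim: s ls {us IH} => [|[i e] s IH] /=.
  by move=> _ y; rewrite inE => /eqP ->; rewrite rmorph1.
rewrite inE negb_or => /andP[li ls] y.
by rewrite inE => /orP[/eqP ->|/mapP [z /(IH ls) zE ->]]; rewrite rmorphM rmorphXn pX ?zE.
Qed.

Fixpoint kill (ls : seq 'I_d) : {rmorphism R -> R} :=
  if ls is l :: ls' then kill_variable l \o kill ls' else idfun.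

Lemma killX ls l : kill ls 'X_l = if l \in ls then 0 else 'X_l.
Proof.
elim: ls => //= i ls ->; rewrite inE; case: (l \in ls); first by rewrite orbT rmorph0.
by rewrite orbF kill_variableX.
Qed.

Lemma kill_prime ls : is_prime [set x : R | kill ls x = 0].
Proof.
split=> [|/eqP|x y /= /eqP]; last by rewrite rmorphM mulf_eq0 => /orP[]/eqP; auto.
  split=> [|x y /= hx hy|a x /= hx]; first by rewrite /= rmorph0.
    by rewrite rmorphD hx hy addr0.
  by rewrite rmorphM hx mulr0.
by rewrite rmorph1 oner_eq0.
Qed.

(** The kernels of setting more and more of the variables to 0 form a strict chain of primes below
    P. *)
Lemma variables_height (P : spec R) ls : uniq ls -> (forall l, l \in ls -> (P : set R) 'X_l) ->
  prime_height_ge P (size ls).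
Proof.
move=> uls lsP; have iP := spec_is_ideal P.
apply: (@prime_height_sub _ P (Spec (kill_prime ls))).
  move=> x /= kx; suff : (P : set R) (x - kill ls x) by rewrite kx subr0.
  elim: ls lsP {uls kx} => [|l ls IH] lsP /=; first by rewrite subrr; apply: idealT0.
  have [y yE] := kill_variableE l (kill ls x).
  have -> : x - kill_variable l (kill ls x) = x - kill ls x + 'X_l * y by rewrite {2}yE; ring.
  apply: idealD => //; first by apply: IH => i il; apply: lsP; rewrite inE il orbT.
  by apply: idealM_r => //; apply: lsP; rewrite mem_head.
elim: ls uls {lsP} => [_|l ls IH /= /andP[lls /IH]]; first exact: prime_height0.
apply: (@prime_heightS _ _ _ 'X_l) => /=; last 2 first.
- by rewrite killX (negPf lls) kill_variableX eqxx.
- by rewrite killX (negPf lls); apply/eqP; rewrite -msupp_eq0 msuppX.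
by move=> x /= ->; rewrite rmorph0.
Qed.

(** A variable X_l outside P makes the ideal trivial near P. For X_l in P, a trivial inner ideal
    leaves the single generator X_l^c; otherwise X_l adds one generator and one variable of P. *)
Lemma lex_gens_local (P : spec R) s (I := [set x | spanned (lex_gens s) x]) :
  (exists2 t, I t & ~ (P : set R) t) \/
  exists vs us t, [/\ subseq vs (unzip1 s) /\ ~ (P : set R) t,
    forall l, l \in vs -> (P : set R) 'X_l, size us = size vs :> nat,
    forall y, y \in us -> I y & forall x, I x -> spanned us (t * x)].
Proof.
elim: s @I => [|[l c] s IH] I /=.
  by left; exists 1; [exists [:: 1]; rewrite /= mulr1 addr0|exact: spec_proper].
have IE x : I x <-> exists2 y, spanned ('X_l :: lex_gens s) y & x = 'X_l ^+ c * y.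
  split=> [[h ->]|[y [h ->] ->]].
    by exists (dot h ('X_l :: lex_gens s)); [exists h|exact: (dot_map _ h ('X_l :: _))].
  by exists h; exact: esym (dot_map _ h ('X_l :: _)).
have tailI y : spanned (lex_gens s) y -> spanned ('X_l :: lex_gens s) y.
  by move=> sy; apply/spanned_cons; exists 0, y; rewrite mul0r add0r.
have headI : spanned ('X_l :: lex_gens s) 'X_l by apply: mem_dot; rewrite mem_head.
have [PX|nPX] := pselect ((P : set R) 'X_l); last first.
  left; exists ('X_l ^+ c * 'X_l); first by apply/IE; exists 'X_l.
  by rewrite -exprSr => /spec_exp.
right; have [[t It nPt]|[vs [us [t [[vss nPt] vsP sz usI It]]]]] := IH.
  exists [:: l], [:: 'X_l ^+ c * t], t; split=> //.
  - by split=> //; rewrite /= eqxx sub0seq.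
  - by move=> i; rewrite inE => /eqP ->.
  - by move=> u; rewrite inE => /eqP ->; apply/IE; exists t => //; apply: tailI.
  move=> x /IE [y _ ->]; exists [:: y]; rewrite /= addr0; ring.
exists (l :: vs), [seq 'X_l ^+ c * x | x <- 'X_l :: us], t; split=> //.
- by split=> //=; rewrite eqxx.
- by move=> i; rewrite inE => /orP[/eqP ->|/vsP].
- by rewrite size_map /= sz.
- move=> u /mapP [y]; rewrite inE => /orP[/eqP -> ->|/usI sy ->]; apply/IE.
    by exists 'X_l.
  by exists y => //; apply: tailI.
move=> x /IE [y /spanned_cons [a [z [sz' ->]]] ->].
have [h hE] := It z sz'; exists (t * a :: h); rewrite (dot_map _ _ ('X_l :: us)) /= -hE; ring.
Qed.

Lemma lex_gens_Ginf (P : spec R) s r (I := [set x | spanned (lex_gens s) x]) :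
  uniq (unzip1 s) -> I `<=` P -> ~ prime_height_ge P r.+1 ->
  exists t us, [/\ ~ (P : set R) t, (size us <= r)%N, forall y, y \in us -> I y &
    forall x, I x -> spanned us (t * x)].
Proof.
move=> us IP hP; have [[t It []]|[vs [vu [t [[vss nPt] vsP sz usI It]]]]] := lex_gens_local P s.
  exact: IP.
exists t, vu; split=> //; rewrite sz leqNgt; apply/negP => rv; apply: hP.
by apply: prime_heightW rv _; apply: variables_height vsP; apply: subseq_uniq us.
Qed.
End Monomials.

(** * Koszul homology of homogeneous generators *)

Section Exterior.
Variable A : comNzRingType.

Lemma exteriorD n (f g : exterior A n) T : (f + g) T = f T + g T.
Proof. by rewrite ffunE. Qed.

Lemma exteriorZ n a (f : exterior A n) T : (a *: f) T = a * f T.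
Proof. by rewrite ffunE. Qed.

Lemma exterior0 n T : (0 : exterior A n) T = 0.
Proof. by rewrite ffunE. Qed.

Definition coef_diff n (c : 'I_n -> A) (f : exterior A n) : exterior A n :=
  [ffun T : {set 'I_n} =>
     \sum_(j | j \notin T) (-1) ^+ #|[set l in T | (l < j)%N]%SET| * c j * f (j |: T)%SET].

(** Identifies the recursive model with the functions on subsets in terms of which sliding depth is
    stated. *)
Fixpoint to_exterior n : KV A n -> exterior A n :=
  match n return KV A n -> exterior A n with
  | 0%N => fun a => [ffun=> a]
  | n'.+1 => fun w => [ffun T : {set 'I_n'.+1} =>
      to_exterior (if ord0 \in T then w.2 else w.1) (lift ord0 @^-1: T)%SET]
  end.

Lemma to_exterior0 (a : KV A 0) T : to_exterior a T = a.
Proof. by rewrite ffunE. Qed.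

Lemma to_exteriorS n (w : KV A n.+1) T :
  to_exterior w T = to_exterior (if ord0 \in T then w.2 else w.1) (lift ord0 @^-1: T)%SET.
Proof. by rewrite ffunE. Qed.

Arguments to_exterior {n} w : simpl never.

Lemma to_exterior_linear n : linear (@to_exterior n).
Proof.
elim: n => [|n IH] a u v; apply/ffunP => T.
  by rewrite exteriorD exteriorZ !to_exterior0.
rewrite exteriorD exteriorZ !to_exteriorS.
have -> : (if ord0 \in T then (a *: u + v).2 else (a *: u + v).1) =
    a *: (if ord0 \in T then u.2 else u.1) + (if ord0 \in T then v.2 else v.1).
  by case: ifP.
by rewrite IH exteriorD exteriorZ.
Qed.

Lemma ord_neq0 n (j : 'I_n.+1) : j != ord0 -> exists i, j = lift ord0 i.
Proof. by rewrite eq_sym => /unlift_some [i -> _]; exists i. Qed.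

Lemma preim_imset_lift n (T : {set 'I_n}) : (lift ord0 @^-1: (lift ord0 @: T) = T)%SET.
Proof. by apply/setP => j; rewrite inE mem_imset //; apply: lift_inj. Qed.

Lemma preim_lift0 n (T : {set 'I_n.+1}) : (lift ord0 @^-1: (ord0 |: T) = lift ord0 @^-1: T)%SET.
Proof. by apply/setP => j; rewrite !inE lift_eqF. Qed.

Lemma preim_liftU n j (T : {set 'I_n.+1}) :
  (lift ord0 @^-1: (lift ord0 j |: T) = j |: (lift ord0 @^-1: T))%SET.
Proof. by apply/setP => l; rewrite !inE (inj_eq lift_inj). Qed.

Lemma ord0_imset_lift n (T : {set 'I_n}) : ord0 \in (lift ord0 @: T)%SET = false.
Proof. by apply/negP => /imsetP [j _ /eqP]; rewrite eq_liftF. Qed.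

Lemma to_exterior_inj n : injective (@to_exterior n).
Proof.
elim: n => [|n IH] u v /ffunP e; first by have := e finset.set0; rewrite !to_exterior0.
case: u v e => [u1 u2] [v1 v2] e; congr (_, _); apply/IH/ffunP => T.
  by have := e (lift ord0 @: T)%SET; rewrite !to_exteriorS ord0_imset_lift preim_imset_lift.
have := e (ord0 |: lift ord0 @: T)%SET.
by rewrite !to_exteriorS !in_setU1 eqxx /= preim_lift0 preim_imset_lift.
Qed.

Lemma to_exterior_surj n f : exists w, @to_exterior n w = f.
Proof.
elim: n f => [|n IH] f.
  exists (f finset.set0); apply/ffunP => T; rewrite to_exterior0; congr (f _).
  by apply/setP => -[].
have [u uE] := IH [ffun T : {set 'I_n} => f (lift ord0 @: T)%SET].
have [v vE] := IH [ffun T : {set 'I_n} => f (ord0 |: lift ord0 @: T)%SET].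
exists (u, v); apply/ffunP => T; rewrite to_exteriorS /=.
have [T0|T0] := boolP (ord0 \in T); rewrite ?uE ?vE !ffunE; congr (f _); apply/setP => j.
  rewrite in_setU1; have [->//|j0 /=] := eqVneq j ord0.
  have [i ->] := ord_neq0 j0.
  by rewrite mem_imset ?inE //; apply: lift_inj.
have [->|j0 /=] := eqVneq j ord0; first by rewrite ord0_imset_lift (negPf T0).
have [i ->] := ord_neq0 j0.
by rewrite mem_imset ?inE //; apply: lift_inj.
Qed.

Lemma to_exterior_deg n i (w : KV A n) : kdeg n i w <-> exterior_deg i (to_exterior w).
Proof.
elim: n i w => [|n IH] i w.
  split=> [[->|->] T|/(_ finset.set0)].
    by rewrite to_exterior0 (_ : T = finset.set0) ?cards0 //; apply/setP => -[].
    by rewrite to_exterior0.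
  by rewrite to_exterior0 cards0 eq_sym; have [->|i0 ->] := eqVneq i 0%N; [left|right|].
have cardP (T : {set 'I_n.+1}) : #|T| = ((ord0 \in T) + #|lift ord0 @^-1: T|%SET)%N.
  rewrite (cardsD1 ord0); congr (_ + _)%N.
  rewrite -(card_imset _ (@lift_inj _ ord0)); apply: eq_card => j.
  rewrite in_setD1; have [->|j0 /=] := eqVneq j ord0; first by rewrite ord0_imset_lift.
  have [l ->] := ord_neq0 j0.
  by rewrite mem_imset ?inE //; apply: lift_inj.
split=> [[d1 d2] T|H].
  rewrite to_exteriorS cardP; case: (ord0 \in T); rewrite ?add1n ?add0n => Ti; last exact: ((IH i w.1).1 d1 _ Ti).
  case: i d1 d2 Ti => [_ e _|i _ /IH d2 Ti]; last exact: d2.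
  by rewrite (_ : w.2 = 0) ?(lin0 (@to_exterior_linear n)) ?exterior0.
split.
  apply/IH => T Ti; have := H (lift ord0 @: T)%SET.
  by rewrite cardP to_exteriorS ord0_imset_lift preim_imset_lift; apply.
have H2 (T : {set 'I_n}) : (#|T|.+1 != i)%N -> to_exterior w.2 T = 0.
  move=> Ti; have := H (ord0 |: lift ord0 @: T)%SET.
  by rewrite cardP to_exteriorS !in_setU1 eqxx /= preim_lift0 preim_imset_lift; apply.
case: i {H} H2 => [|i] H2 /=; last by apply/IH => T Ti; apply: H2.
apply: to_exterior_inj; rewrite (lin0 (@to_exterior_linear n)).
by apply/ffunP => T; rewrite H2 ?exterior0.
Qed.

Lemma to_exterior_diff (m : seq A) (c : 'I_(size m) -> A) w : (forall j, c j = m`_j) ->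
  to_exterior (kd w) = coef_diff c (to_exterior w).
Proof.
elim: m c w => [|x m IH] c w cE; apply/ffunP => T.
  by rewrite to_exterior0 ffunE big1 // => -[].
have := IH (fun j => c (lift ord0 j)); set c' := fun j => _ => {}IH.
have {}IH v : to_exterior (kd v) = coef_diff c' (to_exterior v) by apply: IH => j; rewrite cE.
have l := @to_exterior_linear (size m).
(* The first index, when in T, precedes every other and flips the sign; this is the minus sign in
   the second component of [kd]. *)
have cardE (j : 'I_(size m)) : #|[set i in T | (i < lift ord0 j)%N]%SET| =
    ((ord0 \in T) + #|[set i in lift ord0 @^-1: T | (i < j)%N]%SET|)%N.
  rewrite (cardsD1 ord0) !inE /= andbT; congr (_ + _)%N.
  rewrite -[RHS](card_imset _ (@lift_inj _ ord0)); apply: eq_card => i.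
  rewrite in_setD1; have [->|i0 /=] := eqVneq i ord0; first by rewrite ord0_imset_lift.
  have [e ->] := ord_neq0 i0.
  by rewrite mem_imset ?inE //; apply: lift_inj.
rewrite [LHS]to_exteriorS [RHS]ffunE big_mkcond.
pose F (j : 'I_(size m).+1) := if j \notin T then (-1) ^+ #|[set l in T | (l < j)%N]%SET| * c j *
  to_exterior (n := (size m).+1) w (j |: T)%SET else 0.
rewrite [RHS](_ : _ = F ord0 + \sum_(i < size m) F (lift ord0 i)); last exact: big_ord_recl.

have tailE u s : u = (if ord0 \in T then w.2 else w.1) -> s = (if ord0 \in T then -1 else 1 : A) ->
    \sum_(i < size m) F (lift ord0 i) =
    s * to_exterior (kd u) (lift ord0 @^-1: T)%SET.
  move=> -> ->; rewrite IH ffunE big_distrr /= [RHS]big_mkcond; apply: eq_bigr => j _.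
  rewrite inE /F; case: (lift ord0 j \in T) => //; rewrite ?mulr0 //.
  have T0 : (ord0 \in lift ord0 j |: T) = (ord0 \in T) by rewrite in_setU1 eq_liftF.
  rewrite cardE to_exteriorS preim_liftU T0 /=.
  by case: (ord0 \in T); rewrite ?exprS ?add0n ?mul1r ?mulrA.
have x0 : c ord0 = x by rewrite cE.
have kdE : kd w = (kd w.1 + x *: w.2, - kd w.2) by [].
have [T0|T0] := boolP (ord0 \in T); rewrite ?T0 ?(negPf T0) in tailE *.
  by rewrite (tailE w.2 (-1)) // kdE -scaleN1r (linZ l) exteriorZ /F T0 add0r.
rewrite (tailE w.1 1) // mul1r kdE (linD l) (linZ l) exteriorD exteriorZ /F T0 to_exteriorS x0 in_setU1 eqxx preim_lift0 addrC.
congr (_ + _); rewrite (_ : [set l0 in T | (l0 < 0)%N]%SET = finset.set0) ?cards0 ?mul1r //.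
by apply/setP => j; rewrite !inE andbF.
Qed.

Lemma koszul_exterior n (a : n.-tuple A) i :
  exists phi : KV A (size a) -> exterior A n, [/\ linear phi, forall f, exists w, phi w = f,
    forall w, kcyc a [set 0] i w <-> koszul_cycles a i (phi w) &
    forall w, kbnd a i w <-> koszul_boundaries a i (phi w)].
Proof.
case: a => m e; have /eqP en := e; move: e; rewrite -{n}en => e; set a := Tuple e.
have D w : to_exterior (kd w) = koszul_diff a (to_exterior w).
  by apply: to_exterior_diff => j; rewrite (tnth_nth 0).
have l := @to_exterior_linear (size m); exists to_exterior; split=> //.
- exact: to_exterior_surj.
- move=> w; rewrite kcyc0 /koszul_cycles /= to_exterior_deg -D; split=> -[dw kw]; split=> //.
    by rewrite kw (lin0 l).
  by apply: to_exterior_inj; rewrite kw (lin0 l).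
move=> w; split=> [[g dg <-]|[g dg gw]].
  by rewrite D; exists (to_exterior g) => //; apply/to_exterior_deg.
have [h hE] := to_exterior_surj g; exists h; first by apply/to_exterior_deg; rewrite hE.
by apply: to_exterior_inj; rewrite D hE.
Qed.

Lemma koszul_submod n (a : n.-tuple A) i : [/\ is_submod (koszul_cycles a i),
  is_submod (koszul_boundaries a i) & koszul_boundaries a i `<=` koszul_cycles a i].
Proof.
have [phi [l surj ZE BE]] := koszul_exterior a i.
have sub (X : set (KV A (size a))) (Y : set (exterior A n)) :
    is_submod X -> (forall w, X w <-> Y (phi w)) -> is_submod Y.
  move=> sX XY; have := submod_image l sX; congr is_submod.
  apply/seteqP; split=> [_ [g /XY Yg <-] //|f Yf].
  by have [w wE] := surj f; exists w => //; apply/XY; rewrite wE.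
split.
- by apply: sub ZE; apply/submod_kcyc/ideal_zero.
- by apply: sub BE; apply: submod_kbnd.
by move=> f; have [w <-] := surj f; move=> /BE/kbnd_sub/ZE.
Qed.

Lemma koszul_depth (J : set A) n (a : n.-tuple A) i t :
  cdepth J (kcyc a [set 0] i) (kbnd a i) t ->
  cdepth J (koszul_cycles a i) (koszul_boundaries a i) t.
Proof.
have [phi [l surj ZE BE]] := koszul_exterior a i; have [_ sB _] := koszul_submod a i.
have sZ' := submod_kcyc a i (ideal_zero A); apply: (cdepth_image l sZ' sB).
- by move=> v /ZE.
- by move=> v _ /BE.
- by move=> v /BE.
- move=> z Zz; have [v vE] := surj z; exists v; first by apply/ZE; rewrite vE.
  by rewrite vE subrr; apply: submod0.
Qed.

Lemma noetherian_exterior n : noetherian A^o -> noetherian (exterior A n).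
Proof.
move=> noeA; apply: (noetherian_surj (@to_exterior_linear n)); last exact: noetherian_KV.
exact: to_exterior_surj.
Qed.
End Exterior.

Section Graded.
Variables (k : fieldType) (d : nat).
Local Notation R := {mpoly k[d]}.

(** Substituting X_i T for X_i makes the coefficient of T^q the homogeneous part of degree q. *)
Lemma exists_grading : {tau : {rmorphism R -> {poly R}} |
  (forall c, tau c%:MP = (c%:MP : R)%:P) /\ forall i, tau 'X_i = ('X_i : R)%:P * 'X}.
Proof.
exists (mmap (polyC \o @mpolyC d k) (fun i => ('X_i : R)%:P * 'X)).
by split=> [c|i] /=; rewrite ?mmapC // mmapX mmap1U.
Qed.

Definition grading : {rmorphism R -> {poly R}} := sval exists_grading.

Lemma gradingC c : grading c%:MP = (c%:MP : R)%:P.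
Proof. exact: (svalP exists_grading).1. Qed.

Lemma grading_var i : grading 'X_i = ('X_i : R)%:P * 'X.
Proof. exact: (svalP exists_grading).2. Qed.

Lemma gradingX w : grading 'X_[w] = ('X_[w] : R)%:P * 'X^(mdeg w).
Proof.
rewrite mpolyXE_id rmorph_prod mdegE -prodrXr rmorph_prod -big_split /=.
by apply: eq_bigr => i _; rewrite rmorphXn grading_var exprMn rmorphXn.
Qed.

Lemma grading_homog x e : x \is e.-homog -> grading x = x%:P * 'X^e.
Proof.
move=> /dhomogP hx; rewrite {1 2}[x]mpolyE !rmorph_sum mulr_suml big_seq [RHS]big_seq.
apply: eq_bigr => w wx; rewrite -!mul_mpolyC !rmorphM /= gradingC gradingX -mulrA.
by rewrite -(hx w wx).
Qed.

Lemma grading1 x : (grading x).[1] = x.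
Proof.
pose g : {rmorphism R -> R} := horner_eval (1 : R) \o grading.
apply: (mpoly_rmorph_ext (f := g) (g := idfun)) => [c|i] /=; rewrite /horner_eval.
  by rewrite gradingC hornerC.
by rewrite grading_var hornerM hornerX hornerC mulr1.
Qed.

Lemma grading_irrelevant x : irrelevant_ideal k d x -> (grading x)`_0 = 0.
Proof.
apply: (@ideal_gen_sub _ _ [set x | (grading x)`_0 = 0]) => [|_ [i _ <-]] /=.
  split=> [|y z /= hy hz|y z /= hz]; first by rewrite /= rmorph0 coef0.
    by rewrite rmorphD coefD hy hz addr0.
  by rewrite rmorphM coef0M hz mulr0.
by rewrite grading_var coefMX.
Qed.

Variables (n : nat) (a : n.-tuple R) (e : 'I_n -> nat).
Hypothesis ae : forall j, tnth a j \is (e j).-homog.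

(** The degree of the basis element e_S for which the Koszul differential is homogeneous of degree
    0. *)
Definition weight (S : {set 'I_n}) : nat := (\sum_(j in S) e j)%N.

Definition component q (f : exterior R n) : exterior R n :=
  [ffun S : {set 'I_n} => (grading (f S) * 'X^(weight S))`_q].

Lemma componentE q f S : component q f S = (grading (f S) * 'X^(weight S))`_q.
Proof. by rewrite ffunE. Qed.

Lemma component0 q : component q 0 = 0.
Proof. by apply/ffunP => S; rewrite componentE !exterior0 rmorph0 mul0r coef0. Qed.

Lemma componentD q : {morph component q : f g / f + g}.
Proof.
by move=> f g; apply/ffunP => S; rewrite exteriorD !componentE exteriorD rmorphD mulrDl coefD.
Qed.

Lemma componentZ q x f :
  component q (x *: f) = \sum_(u < q.+1) (grading x)`_u *: component (q - u) f.
Proof.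
apply/ffunP => S; rewrite componentE exteriorZ rmorphM -mulrA coefM sum_ffunE.
by apply: eq_bigr => u _; rewrite exteriorZ componentE.
Qed.

Lemma component_diff q f : koszul_diff a (component q f) = component q (koszul_diff a f).
Proof.
apply/ffunP => T; rewrite componentE ffunE [in RHS]ffunE rmorph_sum mulr_suml coef_sum.
apply: eq_bigr => j jT; rewrite componentE /weight big_setU1 //= rmorphM rmorphM rmorphXn rmorphN1.
rewrite (grading_homog (ae j)) exprD -!mulrA.
have sgn s (p : {poly R}) : ((-1) ^+ s * p)`_q = (-1) ^+ s * p`_q.
  by rewrite -(rmorphN1 polyC) -rmorphXn /= coefCM.
by rewrite sgn coefCM [grading _ * (_ * _)]mulrCA.
Qed.

Lemma component_deg q i f : exterior_deg i f -> exterior_deg i (component q f).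
Proof. by move=> df S Si; rewrite componentE df // rmorph0 mul0r coef0. Qed.

Lemma component_sum f : exists N, f = \sum_(q < N) component q f.
Proof.
pose P S := grading (f S) * 'X^(weight S).
exists (\max_S size (P S)); apply/ffunP => S; rewrite sum_ffunE.
have -> : f S = (P S).[1] by rewrite hornerM hornerXn expr1n mulr1 grading1.
rewrite (@horner_coef_wide _ (\max_S size (P S))); last exact: (leq_bigmax S).
by apply: eq_bigr => q _; rewrite componentE expr1n mulr1.
Qed.

Variable i : nat.
Let Z := koszul_cycles a i.
Let B := koszul_boundaries a i.

(** Elements of the irrelevant ideal have no part of degree 0, so the degree q part of a cycle is,
    modulo boundaries, a combination of cycle components of lower degree. This gives the properness
    required of a regular sequence. *)
Lemma graded_nakayama (xs : seq R) : (forall x, x \in xs -> irrelevant_ideal k d x) ->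
  Z `<=` add_scaled Z B xs -> Z `<=` B.
Proof.
move=> xsm ZB; have [_ sB _] := koszul_submod a i.
have H q : forall f, Z f -> B (component q f).
  elim/ltn_ind: q => q IH f /ZB [_ [w [[g dg <-] Zw ->]]].
  rewrite componentD (big_morph _ (componentD q) (component0 q)); apply: submodD => //.
    by exists (component q g); [exact: component_deg|exact: component_diff].
  apply: submod_sum => // j _; rewrite componentZ big_ord_recl grading_irrelevant; last exact/xsm/mem_nth.
  rewrite scale0r add0r; apply: submod_sum => // u _; apply: submodZ => //; apply: IH => //.
  by have := ltn_ord u; rewrite lift0; lia.
move=> f Zf; have [N ->] := component_sum f.
by apply: submod_sum => // q _; apply: H.
Qed.
End Graded.

Lemma sliding_depth_slides (k : fieldType) (d : nat) (I : set {mpoly k[d]}) (m : seq {mpoly k[d]}) :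
  I = [set x | spanned m x] -> slides (irrelevant_ideal k d) m [set 0] d -> sliding_depth I.
Proof.
move=> Im sl n a ha Ia i; have noeR := @noetherian_mpoly k d.
have aE x : spanned m x <-> spanned a x.
  by have : I x <-> I x := conj id id; rewrite {1}Im Ia ideal_gen_seq.
have sla : slides (irrelevant_ideal k d) a [set 0] d.
  apply: slides_change sl => x xs; first by apply/aE/mem_dot.
  by apply/aE/mem_dot.
have /boolp.choice [e ae] : forall j, exists q, tnth a j \is q.-homog.
  by move=> j; apply: ha; apply: mem_tnth.
have [ZB|nZB] := pselect (koszul_cycles a i `<=` koszul_boundaries a i); [by left|right].
have H := koszul_depth (cdepth_homology (@cdepth_irrelevant k d) (i := i) sla).
rewrite (size_tuple a) in H; have [sZ sB BZ] := koszul_submod a i.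
have iJ : is_ideal (irrelevant_ideal k d) by apply: ideal_gen_ideal.
have [xs [sxs xsm reg]] := cdepth_regular (@noetherian_exterior _ n noeR) noeR iJ sZ sB BZ H.
exists (Tuple (introT eqP sxs)); split=> //; split; first by apply/regular_seqE.
by move=> /(graded_nakayama ae xsm).
Qed.

(** * Localization *)

Section Localized.
Variables (A : idomainType) (p : spec A).
Local Notation Ap := (localization p).
Implicit Types (I K : set A) (z : Ap).

Lemma embed_subproof (a : A) : tofrac a \in loc_pred p.
Proof.
apply/asboolP; exists a, 1; split=> //; first exact: spec_proper.
by rewrite rmorph1 divr1.
Qed.

Definition embed a : Ap := Localization (embed_subproof a).

Lemma embed_is_nmod : nmod_morphism embed.
Proof. by split=> [|a b]; apply: val_inj; rewrite /= ?rmorph0 ?rmorphD. Qed.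

Lemma embed_is_monoid : monoid_morphism embed.
Proof. by split=> [|a b]; apply: val_inj; rewrite /= ?rmorph1 ?rmorphM. Qed.

HB.instance Definition _ := GRing.isNmodMorphism.Build A Ap embed embed_is_nmod.
HB.instance Definition _ := GRing.isMonoidMorphism.Build A Ap embed embed_is_monoid.

Lemma embed_inj : injective embed.
Proof. by move=> a b /(congr1 val) /= /eqP; rewrite tofrac_eq => /eqP. Qed.

Lemma embed_unit s : ~ (p : set A) s -> exists u, embed s * u = 1.
Proof.
move=> ps; have h : (tofrac s)^-1 \in loc_pred p.
  by apply/asboolP; exists 1, s; split=> //; rewrite rmorph1 div1r.
by exists (Localization h); apply: val_inj; rewrite /= divff //; exact: spec_out_neq0 ps.
Qed.

Lemma loc_idealE I z :
  loc_ideal p I z <-> exists a s, [/\ I a, ~ (p : set A) s & embed s * z = embed a].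
Proof.
split=> -[a [s [Ia ps e]]]; exists a, s; split=> //.
  by apply: val_inj; rewrite /= e mulrCA divff ?mulr1 //; exact: spec_out_neq0 ps.
by rewrite -[tofrac a]/(val (embed a)) -e /= [_ * loc_val z]mulrC mulfK //; exact: spec_out_neq0 ps.
Qed.

Lemma loc_fraction z : exists a s, ~ (p : set A) s /\ embed s * z = embed a.
Proof.
have /loc_idealE [a [s [_ ps e]]] : loc_ideal p setT z.
  by case: z => x h; exact: (asboolP _ h).
by exists a, s.
Qed.

Lemma loc_ideal_ideal I : is_ideal I -> is_ideal (loc_ideal p I).
Proof.
move=> iI; split.
- by apply/loc_idealE; exists 0, 1; split; [exact: idealT0|exact: spec_proper|rewrite mulr0 rmorph0].
- move=> y z /loc_idealE [a [s [Ia ps e]]] /loc_idealE [b [t [Ib pt f]]]; apply/loc_idealE.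
  exists (t * a + s * b), (s * t); split; last by rewrite rmorphD !rmorphM /= -e -f; ring.
    by apply: idealD => //; apply: idealM_l.
  exact: spec_mulN.
- move=> c z /loc_idealE [a [s [Ia ps e]]]; apply/loc_idealE.
  have [b [t [pt f]]] := loc_fraction c; exists (b * a), (t * s); split; last first.
  + by rewrite !rmorphM /= -e -f; ring.
  + exact: spec_mulN.
  exact: idealM_l.
Qed.

Lemma loc_ideal_mem I a : I a -> loc_ideal p I (embed a).
Proof. by move=> Ia; apply/loc_idealE; exists a, 1; rewrite rmorph1 mul1r; split=> //; exact: spec_proper. Qed.

Lemma loc_ideal_proper I : I `<=` p -> ~ loc_ideal p I 1.
Proof. by move=> Ip /loc_idealE [a [s [/Ip pa ps]]]; rewrite mulr1 => /embed_inj e; rewrite e in ps. Qed.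

Lemma embed_dot (h m : seq A) : embed (dot h m) = dot (map embed h) (map embed m).
Proof.
elim: m h => [|x m IH] h; first exact: rmorph0.
have -> : dot h (x :: m) = head 0 h * x + dot (behead h) m by [].
rewrite rmorphD rmorphM /= IH; case: h => [|a h] //=; by rewrite rmorph0.
Qed.

Lemma loc_mu_le_local I t us : is_ideal I -> ~ (p : set A) t -> (forall u, u \in us -> I u) ->
  (forall x, I x -> spanned us (t * x)) -> loc_mu_le p I (size us).
Proof.
move=> iI pt usI H; exists (size us) => //; exists (map_tuple embed (in_tuple us)).
rewrite ideal_gen_seq; have iU : is_ideal [set z : Ap | spanned (map embed us) z] by exact: dot_ideal.
apply/seteqP; split=> z.
  move=> [h ->]; apply: dot_mem; first exact: loc_ideal_ideal.
  by move=> _ /mapP [u uus ->]; apply/loc_ideal_mem/usI.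
move=> /loc_idealE [a [s [Ia ps e]]]; have [h hE] := H a Ia.
have [u uE] := embed_unit (spec_mulN pt ps).
have -> : z = u * embed (t * a) by rewrite rmorphM /= -e -[LHS]mul1r -uE rmorphM /=; ring.
by apply: (idealM_l _ iU); rewrite hE embed_dot; exists (map embed h).
Qed.

Lemma regular_loc K xs : is_ideal K -> regular (V := A^o) setT K xs ->
  regular (V := Ap^o) setT (loc_ideal p K) (map embed xs).
Proof.
elim: xs K => [|x xs IH] K iK //= [xreg reg]; split.
  move=> z _ /loc_idealE [b [u [Kb pu e]]]; have [a [s [ps f]]] := loc_fraction z.
  apply/loc_idealE; exists (u * a), (u * s); split; last by rewrite !rmorphM /= -f; ring.
    apply: xreg => //; suff -> : x *: (u * a : A^o) = s * b by apply: idealM_l.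
    apply: embed_inj; rewrite /GRing.scale /= !rmorphM /= -e -f /GRing.scale /=; ring.
  exact: spec_mulN.
have iK' := is_ideal_scaled_add x iK.
suff -> : scaled_add (V := Ap^o) (loc_ideal p K) (embed x) setT =
    loc_ideal p (scaled_add (V := A^o) K x setT) by apply: IH.
have iL := loc_ideal_ideal iK; have iL' := loc_ideal_ideal iK'.
apply/seteqP; split=> z.
  have sx : scaled_add (V := A^o) K x setT x.
    by apply/scaled_add_ideal; exists 0, 1; rewrite add0r mul1r; split=> //; exact: idealT0.
  move=> /scaled_add_ideal [y [c [/loc_idealE [a [s [Ka ps e]]] ->]]].
  apply: (idealD iL'); last exact/(idealM_l _ iL')/loc_ideal_mem.
  apply/loc_idealE; exists a, s; split=> //; apply/scaled_add_ideal.
  by exists a, 0; rewrite mul0r addr0.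
move=> /loc_idealE [_ [s [/scaled_add_ideal [a [c [Ka ->]]] ps e]]].
have [u uE] := embed_unit ps; apply/scaled_add_ideal; exists (u * embed a), (u * embed c).
split; first exact/(idealM_l _ iL)/loc_ideal_mem.
have -> : z = u * (embed s * z) by rewrite mulrA [u * _]mulrC uE mul1r.
by rewrite e rmorphD rmorphM /= mulrDr mulrA.
Qed.

Lemma contract_prime (q : spec Ap) : is_prime [set a | (q : set Ap) (embed a)].
Proof.
have iq := spec_is_ideal q; split=> [||a b /=]; last by rewrite rmorphM => /spec_mul.
  split=> [|a b /= qa qb|a b /= qb]; first by rewrite /= rmorph0; apply: idealT0.
    by rewrite rmorphD; apply: idealD.
  by rewrite rmorphM; apply: idealM_l.
by rewrite /= rmorph1; apply: spec_proper.
Qed.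

Lemma contract_chain t (c : nat -> spec Ap) : prime_chain t c ->
  prime_chain t (fun i => Spec (contract_prime (c i))).
Proof.
move=> ch i it; have [sub /existsNP [z /not_implyP [cz ncz]]] := ch i it.
have [a [s [ps e]]] := loc_fraction z; apply: (@properP _ _ _ a) => [b /sub //||] /=.
  by rewrite -e; apply: idealM_l => //; apply: spec_is_ideal.
rewrite -e => /spec_mul [cs|//]; have [u uE] := embed_unit ps.
by apply: (@spec_proper _ (c i)); rewrite -uE; apply: idealM_r => //; apply: spec_is_ideal.
Qed.

End Localized.

(** * Cohen-Macaulay quotients *)

Section Conditions.
Variables (k : fieldType) (d : nat).
Local Notation R := {mpoly k[d]}.

Lemma add_scaled_ideal (A : comNzRingType) (J : set A) xs : is_ideal J ->
  is_ideal (add_scaled (V := A^o) setT J xs).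
Proof.
elim: xs J => [|x xs IH] J iJ; first by rewrite add_scaled_nil.
by rewrite add_scaled_cons; apply/IH/is_ideal_scaled_add.
Qed.

Lemma add_scaled_sub (A : comNzRingType) (J K : set A) xs : is_ideal K -> J `<=` K ->
  (forall x, x \in xs -> K x) -> add_scaled (V := A^o) setT J xs `<=` K.
Proof.
move=> iK JK xsK _ [b [w [/JK Kb _ ->]]]; apply: idealD => //; apply: ideal_sum => // j _.
by apply: (idealM_r _ iK); apply/xsK/mem_nth.
Qed.

(** Depth is at most dimension by [regular_chain]. A chain of primes over the localized K contracts
    to one starting at height at least i, so the dimension is at most d - i, and a regular sequence
    of that length exists. *)
Lemma quo_cohen_macaulay_of_depth (K : set R) i : is_ideal K -> height_ge K i ->
  gdepth K (d - i) -> quo_cohen_macaulay K.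
Proof.
move=> iK hK dK p pm Kp t; have iL := loc_ideal_ideal p iK.
have nL : ~ loc_ideal p K 1 by apply: loc_ideal_proper.
split=> [[/(_ 1 Logic.I) //|[xs [xsp [reg nT]]]]|[c [ch Kc]]].
  have iS := add_scaled_ideal xs iL.
  have [|q _ Sq] := exists_maximal iS.
    by move=> S1; apply: nT => z _; rewrite -[z]mulr1; apply: (idealM_l _ iS).
  have [q0 [Kq _ [c [ch c0 _]]]] := regular_chain iL ((regular_seqE _ _ _).1 reg) Sq.
  by exists c; rewrite c0; split=> //; move: ch; rewrite size_tuple.
pose c' i := Spec (contract_prime (c i)); have ch' : prime_chain t c' := contract_chain ch.
have hc : prime_height_ge (c' 0%N) i by apply: hK => a Ka; apply/Kc/loc_ideal_mem.
have le := dim_mpoly (chain_height ch' hc).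
have tle : (t <= d - i)%N by lia.
have noeR := @noetherian_mpoly k d.
have sT := submodT (R^o : lmodType R).
have [|xs [sxs xsp reg]] := cdepth_regular noeR noeR (spec_is_ideal p) sT iK _ (cdepthW tle (dK p pm)).
  by [].
right; have ts : size (map (@embed _ p) xs) == t by rewrite size_map sxs.
exists (Tuple ts); split; first by move=> _ /mapP [x xxs ->]; apply/loc_ideal_mem/xsp.
split; first by apply/regular_seqE/regular_loc.
move=> /(_ 1 Logic.I) S1; apply: (@loc_ideal_proper _ p p) => //.
apply: add_scaled_sub S1; first exact/loc_ideal_ideal/spec_is_ideal.
  by move=> z /loc_idealE [a [s [/Kp pa ps e]]]; apply/loc_idealE; exists a, s.
by move=> _ /mapP [x xxs ->]; apply/loc_ideal_mem/xsp.
Qed.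

Definition few_local_generators (I : set R) (P : spec R) : Prop :=
  forall r, ~ prime_height_ge P r.+1 ->
    exists t us, [/\ ~ (P : set R) t, (size us <= r)%N, forall u, u \in us -> I u &
      forall x, I x -> spanned us (t * x)].

(** The height of P is finite by [dim_mpoly], so n can be taken to be exactly this height. *)
Lemma few_local_generators_mu (I : set R) (P : spec R) : is_ideal I -> few_local_generators I P ->
  exists n, prime_height_ge P n /\ loc_mu_le P I n.
Proof.
move=> iI H; have [n hn hn'] : exists2 n, prime_height_ge P n & ~ prime_height_ge P n.+1.
  apply: contrapT => N; have h n : prime_height_ge P n.
    elim: n => [|n IH]; first exact: prime_height0.
    by apply: contrapT => h; apply: N; exists n.
  by have /dim_mpoly := h d.+1; rewrite ltnn.
have [t [us [Pt us1 us2 us3]]] := H n hn'; exists n; split=> //.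
have [m le mu] := loc_mu_le_local iI Pt us2 us3; exists m => //; exact: leq_trans le us1.
Qed.

Lemma irrelevant_variable (P : spec R) : ~ (irrelevant_ideal k d `<=` P) -> exists l, ~ (P : set R) 'X_l.
Proof.
move=> H; apply: contrapT => /forallNP N; apply: H.
by apply: ideal_gen_sub => [|_ [l _ <-]]; [exact: spec_is_ideal|exact: contrapT (N l)].
Qed.

Lemma irrelevant_height (P : spec R) : irrelevant_ideal k d `<=` P -> prime_height_ge P d.
Proof.
move=> mP; have := @variables_height k d P (enum 'I_d) (enum_uniq _); rewrite size_enum_ord; apply.
by move=> l _; apply/mP/mem_ideal_gen; exists l.
Qed.

Lemma variable_pow l n : ideal_pow (irrelevant_ideal k d) n ('X_l ^+ n).
Proof. by rewrite irrelevant_pow_supported mpolyXn; apply/supportedX; rewrite mdegMn mdeg1 mul1n. Qed.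

Lemma irrelevant_maximal : exists2 q : spec R, is_maximal q & (q : set R) = irrelevant_ideal k d.
Proof.
have iM := @irrelevant_ideal_ideal k d.
have n1 : ~ irrelevant_ideal k d 1.
  by move=> /grading_irrelevant /eqP; rewrite rmorph1 coef1 oner_eq0.
have [q qm Mq] := exists_maximal iM n1; exists q => //; apply/seteqP; split=> // x qx.
have Mx : irrelevant_ideal k d (x - (x@_0%MM)%:MP).
  have : ideal_pow (irrelevant_ideal k d) 1 (x - (x@_0%MM)%:MP).
    rewrite irrelevant_pow_supported => w; rewrite lt0n mdeg_eq0 mcoeff_msupp mcoeffB mcoeffC.
    by have [->|//] := eqVneq w 0%MM; rewrite mulr1 subrr eqxx.
  apply: ideal_gen_sub => // _ [y [z [My _ ->]]]; exact: idealM_r.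
have qc : (q : set R) (x@_0%MM)%:MP.
  by rewrite -(subKr x (x@_0%MM)%:MP); apply: idealB => //; [exact: spec_is_ideal|exact: Mq].
have [c0|c0] := eqVneq (x@_0%MM) 0; first by rewrite c0 mpolyC0 subr0 in Mx.
case: (@spec_proper _ q); rewrite -mpolyC1 -(mulVf c0) mpolyCM.
by apply: idealM_l => //; apply: spec_is_ideal.
Qed.

Lemma saturation_common (L : set R) (us : seq R) :
  (forall u, u \in us -> saturation L (irrelevant_ideal k d) u) ->
  exists n, forall u z, u \in us -> ideal_pow (irrelevant_ideal k d) n z -> L (u * z).
Proof.
elim: us => [|u us IH] H; first by exists 0%N.
have [|n Hn] := IH; first by move=> v vus; apply: H; rewrite inE vus orbT.
have [n' Hn'] := H u (mem_head _ _); exists (n + n')%N => v z.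
rewrite irrelevant_pow_supported inE => /orP[/eqP ->|vus] Sz.
  apply: Hn'; rewrite irrelevant_pow_supported => w /Sz; apply: leq_trans; exact: leq_addl.
apply: Hn => //; rewrite irrelevant_pow_supported => w /Sz; apply: leq_trans; exact: leq_addr.
Qed.

Lemma saturation_sub (L : set R) : is_ideal L -> L `<=` saturation L (irrelevant_ideal k d).
Proof. by move=> iL x Lx; exists 0%N => y _; apply: idealM_r. Qed.

(** Some variable lies outside P, and a power of it carries the local generators of the saturation
    into [L]. *)
Lemma few_local_generators_saturation (L : set R) (P : spec R) : is_ideal L -> L `<=` P ->
  (saturation L (irrelevant_ideal k d) `<=` P ->
   few_local_generators (saturation L (irrelevant_ideal k d)) P) ->
  ~ (irrelevant_ideal k d `<=` P) -> few_local_generators L P.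
Proof.
set Ls := saturation L _ => iL LP H /irrelevant_variable [l nPl] r hr.
have LsP : Ls `<=` P.
  move=> x [n /(_ _ (variable_pow l n))/LP /spec_mul[//|/spec_exp/nPl //]].
have [t [us [Pt us1 us2 us3]]] := H LsP r hr; have [n Hn] := saturation_common us2.
exists ('X_l ^+ n * t), [seq 'X_l ^+ n * u | u <- us]; split.
- by apply: spec_mulN => // /spec_exp.
- by rewrite size_map.
- by move=> _ /mapP [u uus ->]; rewrite mulrC; apply: Hn => //; apply: variable_pow.
- move=> x /(saturation_sub iL)/us3 [h hE]; exists h.
  by rewrite dot_map -mulrA hE.
Qed.

(** Positive depth at the irrelevant ideal means that it kills no nonzero class modulo [J]; the
    powers are removed one at a time. *)
Lemma depth_saturated (J : set R) (q : spec R) t y n : is_ideal J ->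
  (q : set R) = irrelevant_ideal k d -> cdepth q (setT : set R^o) J t.+1 ->
  (forall z, ideal_pow (irrelevant_ideal k d) n z -> J (y * z)) -> J y.
Proof.
move=> iJ qE dJ; elim: n y => [|n IH] y H; first by rewrite -[y]mulr1; apply: H.
apply: IH => z mz; have [||g [_ /(_ [::] Logic.I)]] := dJ 0%N isT (fun=> y * z) => //.
  move=> s /list_inS [x [[|? ?] [-> qx // _]]]; rewrite /cobord subr0 /GRing.scale /= mulrCA; apply: H.
  by apply: mem_ideal_gen; exists x, z; split=> //; rewrite -qE.
by rewrite /= subr0.
Qed.

Lemma saturation_generators (L : set R) : lex_segment_ideal L ->
  let Ls := saturation L (irrelevant_ideal k d) in
  exists m, [/\ Ls = [set x | spanned m x],
    forall J : set R, cdepth J (setT : set R^o) [set 0] d -> slides J m [set 0] d &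
    forall P : spec R, Ls `<=` P -> few_local_generators Ls P].
Proof.
move=> hL Ls; case: (saturation_lex hL) => [E|[s sE E]]; rewrite -/Ls in E.
  exists [::]; split.
  - by rewrite E; apply/seteqP; split=> x; [move=> ->; exists [::]|case].
  - by move=> J d0; apply: slides_nil.
  - by move=> P _ r _; exists 1, [::]; rewrite E; split=> [|||x ->] //; [exact: spec_proper|exists [::]; rewrite mulr0].
have us : uniq (unzip1 s) by rewrite sE filter_uniq // enum_uniq.
rewrite -(spanned_lex_gens k us) in E; exists (lex_gens k s); split=> //.
  by move=> J d0; apply: slides_lex_gens.
by move=> P; rewrite E => IP r hr; apply: lex_gens_Ginf.
Qed.

Section LexSegment.
Variable L : set R.
Hypothesis hL : lex_segment_ideal L.
Let Ls := saturation L (irrelevant_ideal k d).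

Let iL : is_ideal L.
Proof. by case: hL => -[S ->] _; apply: ideal_gen_ideal. Qed.

Let iLs : is_ideal Ls.
Proof. by have [m [E _ _]] := saturation_generators hL; rewrite /Ls E; apply: spanned_ideal. Qed.

Lemma saturation_G_infty : G_infty Ls.
Proof.
have [m [_ _ H]] := saturation_generators hL => s P LsP _.
exact: few_local_generators_mu (H P LsP).
Qed.

Lemma saturation_sliding_depth : sliding_depth Ls.
Proof.
have [m [E H _]] := saturation_generators hL; apply: sliding_depth_slides E _.
exact/H/cdepth_irrelevant.
Qed.

Lemma lex_segment_G : G d L.
Proof.
have [m [_ _ H]] := saturation_generators hL => P LP hP.
apply: few_local_generators_mu => //; apply: few_local_generators_saturation => //; first exact: H.
by move=> /irrelevant_height.
Qed.

Lemma saturation_residual_depth (bs : seq R) : (exists2 x, Ls x & x <> 0) ->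
  (forall x, x \in bs -> Ls x) ->
  height_ge (colon [set x | spanned bs x] Ls) (size bs) ->
  gdepth (colon [set x | spanned bs x] Ls) (d - size bs).
Proof.
have [m [E S H]] := saturation_generators hL; rewrite /Ls E => nz bsL.
apply: residual_depth => //.
- by move=> p pm; apply/S/cdepth_maximal.
- by move=> P r IP hP; have := H P; rewrite E; apply.
Qed.

Lemma proper_neq0 (I J : set R) : is_ideal I -> I `<` J -> exists2 x, J x & x <> 0.
Proof.
move=> iI [_ /existsNP [x /not_implyP [Jx nIx]]]; exists x => // x0; apply: nIx.
by rewrite x0; apply: idealT0.
Qed.

Lemma saturation_AN : AN_minus (d%:Z - 1) Ls.
Proof.
move=> i _ _ K [[a [aL KE hK]] _]; have iK : is_ideal K by rewrite KE; apply/colon_ideal/ideal_gen_ideal.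
apply: (quo_cohen_macaulay_of_depth iK hK).
have nz := proper_neq0 (ideal_gen_ideal _) aL; rewrite ideal_gen_seq in KE aL.
rewrite -(size_tuple a) KE; apply: saturation_residual_depth => //; last by rewrite -KE size_tuple.
by move=> x xa; apply: aL.1; apply: mem_dot.
Qed.

(** A power of the irrelevant ideal carries the saturation into [L], hence [K] into [K']. Therefore
    [K'] still has the required height, its quotient has positive depth, and [K'] is saturated, so
    it contains [K]. *)
Lemma colon_saturation (bs : seq R) : (size bs < d)%N -> (exists2 x, Ls x & x <> 0) ->
  (forall x, x \in bs -> L x) -> height_ge (colon [set x | spanned bs x] L) (size bs) ->
  colon [set x | spanned bs x] L = colon [set x | spanned bs x] Ls /\
  height_ge (colon [set x | spanned bs x] Ls) (size bs).
Proof.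
set K := colon _ L; set K' := colon _ Ls => small nz bsL hK.
have iS := spanned_ideal bs; have iK' : is_ideal K' by apply: colon_ideal.
have [m [E _ _]] := saturation_generators hL.
have [n Hn] : exists n, forall u z, u \in m -> ideal_pow (irrelevant_ideal k d) n z -> L (u * z).
  by apply: saturation_common => u um; rewrite E; apply: mem_dot.
have KK' y : K y -> forall z, ideal_pow (irrelevant_ideal k d) n z -> K' (y * z).
  move=> Ky z mz x; rewrite /Ls E => -[h ->].
  apply: (dot_mem_scaled _ iS) => w /inL_mem wm.
  by rewrite -mulrA [z * w]mulrC; apply/Ky/Hn.
have hK' : height_ge K' (size bs).
  (* Primes over the irrelevant ideal have height at least d, more than needed; any other prime over
     [K'] also contains [K]. *)
  move=> P K'P; have [mP|/irrelevant_variable [l nPl]] := pselect (irrelevant_ideal k d `<=` P).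
    by apply: prime_heightW (ltnW small) _; apply: irrelevant_height.
  apply: hK => y /KK' /(_ _ (variable_pow l n))/K'P /spec_mul [//|/spec_exp/nPl //].
split=> //; apply/seteqP; split=> y Ky; last first.
  by move=> x Lx; apply/Ky/saturation_sub.
have bsLs x : x \in bs -> Ls x by move=> /bsL; apply: saturation_sub.
have [q qm qE] := irrelevant_maximal.
have := saturation_residual_depth nz bsLs hK' qm; rewrite -/K'.
have -> : (d - size bs = (d - (size bs).+1).+1)%N by lia.
by move=> dK'; apply: (depth_saturated iK' qE dK' (KK' y Ky)).
Qed.

Lemma lex_segment_AN : AN_minus (d%:Z - 1) L.
Proof.
move=> i _ id K [[a [aL KE hK]] _]; have iK : is_ideal K by rewrite KE; apply/colon_ideal/ideal_gen_ideal.
apply: (quo_cohen_macaulay_of_depth iK hK).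
have [x Lx x0] := proper_neq0 (ideal_gen_ideal _) aL; rewrite ideal_gen_seq in KE aL.
have nz : exists2 x, Ls x & x <> 0 by exists x => //; apply: saturation_sub.
have small : (size a < d)%N by rewrite size_tuple; lia.
have aL' y : y \in a -> L y by move=> ya; apply: aL.1; apply: mem_dot.
have hK1 : height_ge (colon [set x | spanned a x] L) (size a) by rewrite -KE size_tuple.
have [KK' hK'] := colon_saturation small nz aL' hK1.
have <- : size a = i by apply: size_tuple.
rewrite KE KK'; apply: saturation_residual_depth => // y /aL'.
exact: saturation_sub.
Qed.
End LexSegment.
End Conditions.

Theorem proposition6p5 (k : fieldType) (d : nat) (L : set {mpoly k[d]})
    (hL : lex_segment_ideal L) :
  (let Lsat := saturation L (irrelevant_ideal k d) in
   G_infty Lsat /\ sliding_depth Lsat /\ AN_minus (d%:Z - 1) Lsat)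
  /\ (G d L /\ AN_minus (d%:Z - 1) L).
Proof.
split; last by split; [exact: lex_segment_G|exact: lex_segment_AN].
split; first exact: saturation_G_infty.
by split; [exact: saturation_sliding_depth|exact: saturation_AN].
Qed.
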